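(* Let $\Omega\subset\mathbb R^{n+1}$ be a bounded domain of class $C^2$ with boundary $S=\partial\Omega$, $\beta\in C^1(S,(0,\pi))$, and let $V\in\mathbf V^m_\beta(\Omega)$ with boundary varifold $\Gamma$. Then $V$ has bounded first variation. More precisely, there exist a $\mu_V$-measurable vector field $\widetilde H$ on $S$, orthogonal to $S$ for $\mu_V$-a.e. $x\in S$, with $\|\widetilde H\|_{L^\infty(\mu_V)}$ depending only on the second fundamental form of $S$, and a positive Radon measure $\sigma_V^\perp$ on $S$, such that for all $\varphi\in C^1(\overline\Omega,\mathbb R^{n+1})$ $$\delta V(\varphi)=-\int_{\overline\Omega}\langle\mathbf H,\varphi\rangle d\mu_V-\int_S\langle\widetilde H,\varphi\rangle d\mu_V-\int_S\langle\nu^S,\varphi\rangle d\sigma_V^\perp-\int_{S\cap\{\cos\beta\ne0\}}\langle\mathbf n_V(x),\varphi^T(x)\rangle d\sigma_\Gamma(x),$$ where $\varphi^T(x)=T_xS(\varphi(x))$ for $x\in S$; the last integral can also be written as $\int_S\langle\cos\beta\,\mathbf n_W,\varphi\rangle d\sigma_\Gamma$. Moreover: (1) (normal part of the boundary measure) For any $x_0\in S$ and any $\rho\le\rho_S$, there exists $c=c(\Omega)>0$ such that the following local and global estimates hold: $$\sigma_V^\perp(B_{\rho/2}(x_0))\le\frac c\rho\,\mu_V(B_\rho(x_0))+\int_{B_\rho(x_0)}|\mathbf H|\,d(\mu_V\llcorner\Omega),\qquad \sigma_V^\perp(S)\le c\,\mu_V(\overline\Omega)+\int_\Omega|\mathbf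 H|\,d\mu_V.$$ (2) (tangential part of the boundary measure) For any $x_0\in\mathrm{spt}\,\sigma_\Gamma$ at which $\mathbf n_V$ is approximately continuous with respect to $\sigma_\Gamma$ and satisfies $$|\mathbf n_V(x_0)|\ge\sqrt{\sin^2\beta(x_0)+\epsilon^2\cos^2\beta(x_0)}\quad\text{for some }\epsilon\in(0,1],$$ there exist $C_0=C_0(\Omega)>0$ and $0<\rho_1<\frac{\rho_S}2$ such that for all $0<\rho<\rho_1$ $$\epsilon|\cos\beta(x_0)|\,\sigma_\Gamma(B_{\rho/2}(x_0))\le\frac{C_0}\rho\mu_V(B_{2\rho}(x_0))+\sigma_\Gamma(B_\rho(x_0))+\int_{B_{2\rho}(x_0)}|\mathbf H|\,d\mu_V.$$ In particular, if for such an $x_0$ there are in addition a unit vector $\tau^V_{x_0}\in T_{x_0}S$ and $\epsilon_{x_0},\rho_{x_0}\in(0,1]$ with $\langle\cos\beta(x)\mathbf n_W(x),\tau^V_{x_0}\rangle\ge\epsilon_{x_0}$ for $\sigma_\Gamma$-a.e. $x\in B_{\rho_{x_0}}(x_0)$, then the local estimate improves as follows: for any $0<\rho<\min\{\rho_{x_0},\frac{\rho_S}2\}$ $$\epsilon_{x_0}\,\sigma_\Gamma(B_{\rho/2}(x_0))\le\frac{C_0}\rho\mu_V(B_{2\rho}(x_0))+\int_{B_{2\rho}(x_0)}|\mathbf H|\,d\mu_V.$$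
   Context: Notation: $n\ge2$, $m\in\mathbb N$, $1\le m\le n$. $B_r(x)$ is the closed ball in $\mathbb R^{n+1}$. $G(m,n+1)$ is the Grassmannian of unoriented $m$-dimensional linear subspaces of $\mathbb R^{n+1}$; for a plane $P$ and a vector $v$, $P(v)$ is the orthogonal projection of $v$ onto $P$ (likewise $T_xS(v)$). $G_m(U)=U\times G(m,n+1)$. $\nu^S$ is the inward pointing unit normal along $S$. $\rho_S>0$ is a constant such that the normal exponential map $S\times[0,\rho_S)\to U^+_{\rho_S}(S)$, $(x,\rho)\mapsto x+\rho\nu^S(x)$, onto the one-sided tubular neighbourhood of $S$ is a diffeomorphism. An $m$-varifold on $\overline\Omega$ is a positive Radon measure $V$ on $G_m(\overline\Omega)$; $\mu_V$ is its push-forward to $\overline\Omega$; $\delta V(\varphi)=\int_{G_m(\overline\Omega)}\mathrm{div}_P\varphi(x)\,dV(x,P)$. $V$ has bounded first variation if $\sup\{|\delta V(\varphi)|:\varphi\in C^1(\overline\Omega,\mathbb R^{n+1}),|\varphi|\le1\}<\infty$. $\mathfrak X_t(\Omega)=\{\varphi\in C^1(\overline\Omega,\mathbb R^{n+1}):\varphi(x)\in T_xS\ \forall x\in S\}$. Capillary bundle: for $x\in S$, $G_{m,\beta}(x)$ is the set of $P\in G(m,n+1)$ with (i) $|P(\nu^S(x))|=\sin\beta(x)$ and (ii) $(P\cap T_xS)\perp P(\nu^S(x))$. $G_{m,\beta}(S)=\{(x,P):x\in S,P\in G_{m,\beta}(x)\}$ with the subspace topology of $S\times G(m,n+1)$.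 For $(x,P)\in G_{m,\beta}(S)$, $\mathbf n(x,P)=P(\nu^S(x))/|P(\nu^S(x))|$. Capillary varifolds: $V\in\mathbf V^m_\beta(\Omega)$ with boundary varifold $\Gamma$ means: $V$ is an $m$-varifold on $\overline\Omega$, $\Gamma$ is a Radon measure on $G_{m,\beta}(S)$, and there is a generalized mean curvature vector $\mathbf H\in L^1_{\rm loc}(\mu_V)$ with values in $\mathbb R^{n+1}$, $\mathbf H(x)\in T_xS$ for $\mu_V$-a.e. $x\in S$, such that for all compactly supported $\varphi\in\mathfrak X_t(\Omega)$: $\delta V(\varphi)=-\int_{\overline\Omega}\langle\mathbf H,\varphi\rangle d\mu_V-\int_{G_{m,\beta}(S)}\langle\mathbf n(x,P),\varphi(x)\rangle d\Gamma(x,P)$. Disintegrate $\Gamma=\sigma_\Gamma\otimes\Gamma^x$, where $\sigma_\Gamma$ is the push-forward of $\Gamma$ to $S$ and $\Gamma^x$ is a probability measure on $G_{m,\beta}(x)$ for $\sigma_\Gamma$-a.e. $x$. Put $\mathbf n_V(x)=\int_{G_{m,\beta}(x)}\mathbf n(x,P)\,d\Gamma^x(P)$, and let $\mathbf n_W$ be given by $\cos\beta(x)\mathbf n_W(x)=T_xS(\mathbf n_V(x))$ (both sides vanish where $\cos\beta(x)=0$). *)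

(* Defs.v *)
From HB Require Import structures.
From mathcomp Require Import all_boot all_order all_algebra.
From mathcomp Require Import all_classical all_reals all_analysis.
Set Implicit Arguments.
Unset Strict Implicit.
Unset Printing Implicit Defensive.
Import Order.TTheory GRing.Theory Num.Theory.
Import numFieldNormedType.Exports.
Local Open Scope classical_set_scope.
Local Open Scope ring_scope.

HB.instance Definition _ (T U : ptopologicalType) := Pointed.on (T * U)%type.

Definition borel (T : ptopologicalType) : Type := g_sigma_algebraType (@open T).
HB.instance Definition _ (T : ptopologicalType) := Measurable.on (borel T).

Section Euclidean.
Context {R : realType} {n : nat}.
Implicit Types u v x : 'rV[R]_n.

(* The library norm on 'rV[R]_n is the sup norm; it induces the Euclidean
   topology, but lengths and balls must be taken with enorm. *)
Definition dot u v : R := \sum_(i < n) u 0 i * v 0 i.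
Definition enorm u : R := Num.sqrt (dot u u).
Definition eball x (r : R) : set 'rV[R]_n := [set y | enorm (y - x) <= r].

End Euclidean.

Section Regularity.
Context {R : realType} {n : nat}.
Local Notation E := 'rV[R]_n.+1.

Definition grad (f : E -> R) (x : E) : E :=
  \row_i 'D_(delta_mx 0 i) f x.

Definition C1_on (W : normedModType R) (U : set E) (f : E -> W) : Prop :=
  forall x, U x -> differentiable f x /\
    forall v, {for x, continuous (fun y => 'D_v f y)}.

Definition C2_on (W : normedModType R) (U : set E) (f : E -> W) : Prop :=
  C1_on U f /\ forall v, C1_on U (fun y => 'D_v f y).

(* f is C^1 in the open set U and f, Df extend continuously to A, where
   U `<=` A `<=` closure U. *)
Definition C1_upto (W : normedModType R) (U A : set E) (f : E -> W) : Prop :=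
  [/\ {within A, continuous f},
      forall x, U x -> differentiable f x
    & forall v, exists2 g : E -> W,
        {within A, continuous g} & forall x, U x -> g x = 'D_v f x].

Definition frontier (Omega : set E) : set E :=
  closure Omega `\` interior Omega.

(* Near x, Omega is the superlevel set {f > 0} of the C^2 submersion f; then
   frontier Omega is {f = 0} there and grad f points into Omega. *)
Definition local_defining (Omega : set E) (x : E) (U : set E) (f : E -> R) :=
  [/\ open U, U x, C2_on U f,
      forall y, U y -> grad f y != 0
    & forall y, U y -> (Omega y <-> 0 < f y)].

Definition bounded_C2_domain (Omega : set E) : Prop :=
  [/\ open Omega, connected Omega, Omega !=set0, bounded_set Omega
    & forall x, frontier Omega x -> exists U f, local_defining Omega x U f].

Definition C1_on_frontier (W : normedModType R) (Omega : set E) (g : E -> W) :=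
  forall x, frontier Omega x -> exists U (G : E -> W),
    [/\ open U, U x, C1_on U G
      & forall y, U y -> frontier Omega y -> G y = g y].

Definition inner_normal (Omega : set E) (x : E) : E :=
  get [set v | exists U f, local_defining Omega x U f /\
                           v = (enorm (grad f x))^-1 *: grad f x].

Definition tangent (Omega : set E) (x : E) : set E :=
  [set v | dot v (inner_normal Omega x) = 0].

Definition tproj (Omega : set E) (x v : E) : E :=
  v - dot v (inner_normal Omega x) *: inner_normal Omega x.

(* II_x(u, v) = - <D_u nu, v>, nu the inner normal; on tangent vectors u the derivative of nu does
   not depend on the extension N of nu off the frontier. *)
Definition second_ff (Omega : set E) (x u v : E) : R :=
  get [set r | exists N : E -> E,
    [/\ differentiable N x,
        \forall y \near x, frontier Omega y -> N y = inner_normal Omega y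
      & r = - dot ('D_u N x) v]].

Definition second_ff_norm (Omega : set E) : R :=
  sup [set r | exists x u v,
    [/\ frontier Omega x, tangent Omega x u /\ enorm u = 1,
        tangent Omega x v /\ enorm v = 1 & r = `|second_ff Omega x u v|]].

Definition inner_tube (Omega : set E) (rho : R) : set E :=
  [set y | closure Omega y /\
           exists2 x, frontier Omega x & enorm (y - x) < rho].

(* (x, r) |-> x + r nu(x) is a C^1 diffeomorphism of S x [0, rho) onto the
   one-sided tube, with inverse y |-> (xi y, t y). *)
Definition tubular_radius (Omega : set E) (rho : R) : Prop :=
  0 < rho /\ C1_on_frontier Omega (inner_normal Omega) /\
  exists (xi : E -> E) (t : E -> R),
    [/\ forall x r, frontier Omega x -> 0 <= r < rho ->
          let y := x + r *: inner_normal Omega x in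
          [/\ inner_tube Omega rho y, xi y = x & t y = r],
        forall y, inner_tube Omega rho y ->
          [/\ frontier Omega (xi y), 0 <= t y < rho
            & y = xi y + t y *: inner_normal Omega (xi y)],
        C1_upto (Omega `&` inner_tube Omega rho) (inner_tube Omega rho) xi
      & C1_upto (Omega `&` inner_tube Omega rho) (inner_tube Omega rho)
          (t : E -> R^o)].

Definition C1_closure (Omega : set E) (phi : E -> E) : Prop :=
  C1_upto Omega (closure Omega) phi.

Definition tangential_field (Omega : set E) (phi : E -> E) : Prop :=
  C1_closure Omega phi /\
  forall x, frontier Omega x -> tangent Omega x (phi x).

(* Row i is D_{e_i} phi (x), extended continuously to closure Omega. *)
Definition ext_jacobian (Omega : set E) (phi : E -> E) (x : E) : 'M[R]_n.+1 :=
  \matrix_(i < n.+1)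
    lim ('D_(delta_mx 0 i) phi y @[y --> within Omega (nbhs x)]).

End Regularity.

Section Varifolds.
Context {R : realType} {n : nat}.
Local Notation E := 'rV[R]_n.+1.
Local Notation M := 'M[R]_n.+1.
Implicit Types (Omega : set E) (beta : E -> R) (m : nat).

(* An m-plane is identified with the matrix P of the orthogonal projection
   onto it; P acts on row vectors by v *m P. *)
Definition grassmannian m : set M :=
  [set P | [/\ P^T = P, P *m P = P & \rank P = m]].

Definition plane_bundle m (A : set E) : set (E * M) :=
  [set y | A y.1 /\ grassmannian m y.2].

Definition pdiv Omega (phi : E -> E) (P : M) (x : E) : R :=
  \tr (P *m ext_jacobian Omega phi x).

(* On R^N (where this is used), a Borel measure which is finite on compact sets
   is automatically regular. *)
Definition radon (T : ptopologicalType)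
    (mu : {measure set (borel T) -> \bar R}) : Prop :=
  forall K : set T, compact K -> (mu K < +oo)%E.

Definition point_of (y : borel (E * M)%type) : borel E := y.1.

Lemma measurable_point_of : measurable_fun [set: borel (E * M)%type] point_of.
Proof.
apply: (@measurability _ _ (borel (E * M)%type) (borel E) _ _ (@open E)) => //.
move=> _ [B oB <-]; rewrite setTI; apply: sub_sigma_algebra.
have cfst : continuous (fst : E * M -> E) by move=> y; exact: cvg_fst.
by move/continuousP : cfst; exact.
Qed.

(* mu_V, and likewise sigma_Gamma. *)
Definition base_measure (V : {measure set (borel (E * M)%type) -> \bar R}) :
  set (borel E) -> \bar R := pushforward V point_of.

Section base_measure_is_measure.
Variable V : {measure set (borel (E * M)%type) -> \bar R}.

Let base0 : base_measure V set0 = 0%E.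
Proof. by rewrite /base_measure /pushforward preimage_set0 measure0. Qed.

Let base_ge0 A : (0 <= base_measure V A)%E.
Proof. by rewrite /base_measure /pushforward measure_ge0. Qed.

Let base_sigma_additive : semi_sigma_additive (base_measure V).
Proof.
move=> F mF tF mUF; rewrite /base_measure /pushforward preimage_bigcup.
have mpre i : measurable (point_of @^-1` F i).
  by rewrite -[X in measurable X]setTI; exact: measurable_point_of.
apply: measure_semi_sigma_additive => //.
- apply/trivIsetP => /= i j _ _ ij; rewrite -preimage_setI.
  by move/trivIsetP : tF => /(_ _ _ _ _ ij) ->//; rewrite preimage_set0.
- by rewrite -preimage_bigcup -[X in measurable X]setTI;
    exact: measurable_point_of.
Qed.

HB.instance Definition _ := isMeasure.Build _ _ _ (base_measure V)
  base0 base_ge0 base_sigma_additive.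

End base_measure_is_measure.

(* Measures on a closed subset A of E * M are encoded as Borel measures on
   E * M giving mass 0 to the complement of A. *)
Definition is_varifold Omega m
    (V : {measure set (borel (E * M)%type) -> \bar R}) : Prop :=
  radon V /\ V (~` plane_bundle m (closure Omega)) = 0%E.

Definition first_variation Omega m
    (V : {measure set (borel (E * M)%type) -> \bar R}) (phi : E -> E) : R :=
  \int[V]_(y in plane_bundle m (closure Omega)) pdiv Omega phi y.2 y.1.

Definition bounded_first_variation Omega m
    (V : {measure set (borel (E * M)%type) -> \bar R}) : Prop :=
  (ereal_sup [set `|first_variation Omega m V phi|%:E | phi in
     [set phi | C1_closure Omega phi /\
                forall x, closure Omega x -> (enorm (phi x) <= 1)%R]] < +oo)%E.

Definition capillary_planes Omega beta m (x : E) : set M :=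
  [set P | let nu := inner_normal Omega x in
    [/\ grassmannian m P, enorm (nu *m P) = sin (beta x)
      & forall v, v *m P = v -> tangent Omega x v -> dot v (nu *m P) = 0]].

Definition capillary_bundle Omega beta m : set (E * M) :=
  [set y | frontier Omega y.1 /\ capillary_planes Omega beta m y.1 y.2].

Definition conormal Omega (x : E) (P : M) : E :=
  (enorm (inner_normal Omega x *m P))^-1 *: (inner_normal Omega x *m P).

Definition L1loc (mu : {measure set (borel E) -> \bar R}) (A : set E)
    (H : E -> E) : Prop :=
  forall K : set E, compact K -> K `<=` A ->
    forall i, mu.-integrable K (fun x : borel E => (H x 0 i)%:E).

(* V belongs to V^m_beta(Omega) with boundary varifold Gamma and generalized
   mean curvature vector H. *)
Definition capillary_varifold Omega beta m
    (V Gamma : {measure set (borel (E * M)%type) -> \bar R})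
    (H : E -> E) : Prop :=
  [/\ is_varifold Omega m V,
      radon Gamma /\ Gamma (~` capillary_bundle Omega beta m) = 0%E,
      L1loc (base_measure V) (closure Omega) H,
      {ae base_measure V, forall x : borel E,
         frontier Omega x -> tangent Omega x (H x)}
    & forall phi, tangential_field Omega phi ->
        compact (closure [set x | closure Omega x /\ phi x != 0]) ->
        first_variation Omega m V phi =
          - (\int[base_measure V]_(x in closure Omega) dot (H x) (phi x))
          - (\int[Gamma]_(y in capillary_bundle Omega beta m)
               dot (conormal Omega y.1 y.2) (phi y.1))].

(* Gamma = sigma_Gamma \otimes Gamma^x.  That Gamma^x is a probability measure
   for every x, rather than almost every x, is a choice of representative. *)
Definition disintegrates Omega beta m
    (Gamma : {measure set (borel (E * M)%type) -> \bar R})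
    (Gx : R.-pker borel E ~> borel M) : Prop :=
  {ae base_measure Gamma, forall x : borel E,
     frontier Omega x -> Gx x (~` capillary_planes Omega beta m x) = 0%E} /\
  forall A : set (borel (E * M)%type), measurable A ->
    Gamma A = (\int[base_measure Gamma]_(x in frontier Omega)
                 Gx x [set P | A (x, P)])%E.

Definition mean_conormal Omega beta m (Gx : R.-pker borel E ~> borel M)
    (x : E) : E :=
  \row_i (\int[Gx x]_(P in capillary_planes Omega beta m x)
            conormal Omega x P 0 i).

(* Solves cos(beta) n_W = T_xS(n_V) for n_W; since 0^-1 = 0, it vanishes where
   cos(beta) = 0. *)
Definition wetting_conormal Omega beta m (Gx : R.-pker borel E ~> borel M)
    (x : E) : E :=
  (cos (beta x))^-1 *: tproj Omega x (mean_conormal Omega beta m Gx x).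

Definition msupport (mu : {measure set (borel E) -> \bar R}) : set E :=
  [set x | forall U : set E, open U -> U x -> (0 < mu U)%E].

(* mu is carried by A, and f is only meaningful on A. *)
Definition approx_continuous_at (mu : {measure set (borel E) -> \bar R})
    (A : set E) (f : E -> E) (x0 : E) : Prop :=
  forall delta : R, 0 < delta ->
    fine (mu [set x | A x /\ eball x0 r x /\ delta < enorm (f x - f x0)]) /
    fine (mu (eball x0 r)) @[r --> 0^'+] --> (0 : R).

End Varifolds.

(* Main.v *)
Require Import Defs.
From HB Require Import structures.
From mathcomp Require Import all_boot all_order all_algebra.
From mathcomp Require Import all_classical all_reals all_analysis.
From mathcomp Require Import measurable_realfun ess_sup_inf ring lra.
Set Implicit Arguments.
Unset Strict Implicit.
Unset Printing Implicit Defensive.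
Import Order.TTheory GRing.Theory Num.Theory.
Import numFieldNormedType.Exports.
Local Open Scope classical_set_scope.
Local Open Scope ring_scope.

(** The identity in the hypothesis accepts tangential fields only, so a normal field has to be made
    to vanish on the frontier; the price is the steep derivative of the damping factor. Choosing [N]
    parallel to [grad g] gives this price a sign, since <N P, grad g> = k |P(grad g)|^2 with k > 0,
    and the sign drives the rest: a bound for f = 1 becomes a bound for every continuous f, limits
    are positive functionals, and the slope 1/h on the frontier leaves no room for planes with
    P(grad g) different from 0. The trace tr (P DN) depends on the plane as well as on the point,
    while the field sought depends on the point alone: the density averages over the planes above a
    point, which preserves a sup bound. The constants come from three sources: a bound of DN on the
    closure, the gradient bound 16/r of the cutoffs, and the diameter d, for rho_S <= d allows a
    constant to be absorbed into c/rho. *)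

(** Let [g] be a C^2 defining function of [Omega] (positive inside, zero on the
frontier [S]) and [N] a C^1 field which extends the inner normal of [S] and is a
positive multiple of [grad g]. The capillary identity, tested with
[f * (1 - h / (g + h)) * N] (which vanishes on [S]), shows that the nonnegative terms
[f * h / (g + h)^2 * <N P, grad g>] have bounded integrals as [h -> 0]; their limit
along an ultrafilter is a positive functional carried by [S], and the Riesz-Markov
theorem turns it into the measure sigma^perp. Moreover [N P = 0] for almost every plane
[P] over [S], so that there [div_P (f N) = f tr (P DN)]: this is bounded by the second
fundamental form, and its Radon-Nikodym density with respect to the base measure gives
the field [Ht]. A general field is the sum of its tangential part, governed by the
capillary identity, and of [<phi, N> N]. The local estimates come from testing with
cutoffs times [N], respectively times the tangential part of a constant vector. *)

(** * Functions continuous on a set *)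

Section WithinAlgebra.
Context {R : realType} {T : topologicalType} {A : set T}.
Local Notation cA f := {within A, continuous (f : T -> R)}.
Implicit Types (f g : T -> R).

Lemma continuous_sum (I : Type) (r : seq I) (h : I -> T -> R) x :
  (forall i, {for x, continuous (h i)}) ->
  {for x, continuous (fun y => \sum_(i <- r) h i y)}.
Proof.
move=> ch; elim: r => [|i r ih].
  rewrite (_ : (fun y => _) = fun=> 0); first exact: cst_continuous.
  by apply/funext => y; rewrite big_nil.
rewrite (_ : (fun y => _) = h i \+ (fun y => \sum_(j <- r) h j y)); last first.
  by apply/funext => y; rewrite big_cons.
exact: (@continuousD R R^o).
Qed.

Lemma within_cst (a : R) : cA (fun=> a).
Proof. by move=> x; exact: cst_continuous. Qed.

Lemma withinD f g : cA f -> cA g -> cA (fun x => f x + g x).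
Proof. by move=> cf cg x; apply: (@continuousD R R^o (subspace A)); [exact: cf|exact: cg]. Qed.

Lemma withinM f g : cA f -> cA g -> cA (fun x => f x * g x).
Proof. by move=> cf cg x; apply: (@continuousM R (subspace A)); [exact: cf|exact: cg]. Qed.

Lemma withinN f : cA f -> cA (fun x => - f x).
Proof. by move=> cf x; apply: (@continuousN R R^o (subspace A)); exact: cf. Qed.

Lemma withinB f g : cA f -> cA g -> cA (fun x => f x - g x).
Proof. by move=> cf cg x; apply: (@continuousB R R^o (subspace A)); [exact: cf|exact: cg]. Qed.

Lemma within_min f g : cA f -> cA g -> cA (fun x => Num.min (f x) (g x)).
Proof. by move=> cf cg x; apply: (@continuous_min R (subspace A)); [exact: cf|exact: cg]. Qed.

Lemma within_max f g : cA f -> cA g -> cA (fun x => Num.max (f x) (g x)).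
Proof. by move=> cf cg x; apply: (@continuous_max R (subspace A)); [exact: cf|exact: cg]. Qed.

End WithinAlgebra.

Arguments within_cst {R T A} a _ _ _.
Arguments withinD {R T A} [f g] _ _ _ _ _.
Arguments withinM {R T A} [f g] _ _ _ _ _.
Arguments withinN {R T A} [f] _ _ _ _.
Arguments withinB {R T A} [f g] _ _ _ _ _.
Arguments within_min {R T A} [f g] _ _ _ _ _.
Arguments within_max {R T A} [f g] _ _ _ _ _.

Lemma within_sum {R : realType} {T : topologicalType} {A : set T} (I : Type) (r : seq I)
  (f : I -> T -> R) : (forall i, {within A, continuous (f i)}) ->
  {within A, continuous (fun x => \sum_(i <- r) f i x)}.
Proof. by move=> cf x; apply: (@continuous_sum R (subspace A)) => i; exact: cf. Qed.

Section WithinContinuous.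
Context {R : realType} {T : ptopologicalType}.
Implicit Types (A : set T) (f g : T -> R).

Lemma within_measurable A f : measurable (A : set (borel T)) ->
  {within A, continuous f} ->
  measurable_fun (A : set (borel T)) (f : borel T -> R).
Proof.
move=> mA /continuousP cf.
apply: (@measurability _ _ (borel T) R _ _ _ (measurable_realfun.RGenOpens.measurableE R)).
move=> _ [_ [a [b ->] <-]].
have /open_subspaceP[V oV VA] := cf _ (@interval_open R (BRight a) (BLeft b) erefl erefl).
rewrite setIC -VA; apply: measurableI => //.
exact: sub_sigma_algebra.
Qed.

Lemma within_bounded A f : compact A -> {within A, continuous f} ->
  exists2 M : R, 0 < M & forall x, A x -> `|f x| <= M.
Proof.
move=> cA cf; have /compact_bounded := continuous_compact cf cA.
move=> /ex_strict_bound_gt0[M M0 fM]; exists M => // x Ax.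
by apply/ltW/fM; exists x.
Qed.

Lemma bounded_integrable d (X : measurableType d) (mu : {measure set X -> \bar R})
  (D : set X) (f : X -> R) (M : R) : measurable D -> (mu D < +oo)%E ->
  measurable_fun D f -> (forall x, D x -> `|f x| <= M) ->
  mu.-integrable D (EFin \o f).
Proof.
move=> mD muD mf fM; apply: measurable_bounded_integrable => //.
exists M; split; first exact: num_real.
by move=> y My x Dx; apply: le_trans (fM x Dx) (ltW My).
Qed.

Lemma within_integrable A f (mu : {measure set (borel T) -> \bar R}) :
  measurable (A : set (borel T)) -> compact A -> (mu A < +oo)%E ->
  {within A, continuous f} -> mu.-integrable A (EFin \o (f : borel T -> R)).
Proof.
move=> mA cA muA cf; have [M _ fM] := within_bounded cA cf.
by apply: (bounded_integrable (M := M)) => //; exact: within_measurable.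
Qed.

Lemma closed_borel A : closed A -> measurable (A : set (borel T)).
Proof.
move=> cA; rewrite -[A]setCK; apply: measurableC.
by apply: sub_sigma_algebra; exact: closed_openC.
Qed.

Lemma open_borel A : open A -> measurable (A : set (borel T)).
Proof. by move=> oA; exact: sub_sigma_algebra. Qed.

End WithinContinuous.

(** * The Riesz-Markov theorem on a compact set *)

Section RieszMarkov.
Context {R : realType} {T : ptopologicalType}.
Variables (K : set T) (Lam : (T -> R) -> R).
Local Notation cK f := {within K, continuous (f : T -> R)}.
Hypothesis cptK : compact K.
(** Every open set is a cozero set; this takes the place of Urysohn's lemma and is supplied by
    [dist_separation]. *)
Hypothesis perfT : forall U : set T, open U -> exists d : T -> R,
  [/\ continuous d, forall x, 0 <= d x & U = [set x | 0 < d x]].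
Hypothesis LamD : forall f g, cK f -> cK g -> Lam (f \+ g) = Lam f + Lam g.
Hypothesis LamZ : forall a f, cK f -> Lam (fun x => a * f x) = a * Lam f.
Hypothesis Lam_ge0 : forall f, cK f -> (forall x, K x -> 0 <= f x) -> 0 <= Lam f.

Let cK_cst (a : R) : cK (fun=> a). Proof. exact: within_cst. Qed.

Let LamB f g : cK f -> cK g -> Lam (f \- g) = Lam f - Lam g.
Proof.
move=> cf cg; rewrite -[X in Lam X - _](_ : ((f \- g) \+ g) = f); last first.
  by apply/funext => x /=; rewrite subrK.
by rewrite (LamD (withinB cf cg) cg) addrK.
Qed.

Let le_Lam f g : cK f -> cK g -> (forall x, K x -> f x <= g x) -> Lam f <= Lam g.
Proof.
move=> cf cg fg; rewrite -subr_ge0 -LamB//; apply: Lam_ge0; first exact: withinB.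
by move=> x Kx /=; rewrite subr_ge0 fg.
Qed.

Let Lam0 : Lam (fun=> 0) = 0.
Proof. by rewrite -[RHS](mul0r (Lam (fun=> 0))) -LamZ//; congr Lam; apply/funext => x;
  rewrite mul0r. Qed.

(** Daniell's upper integral of the indicator of [A]: an increasing sequence [g] plays the role of a
    lower semicontinuous majorant, and the last clause says that sup_k g_k >= 1 on the part of [A]
    in [K]. With sequences in place of open neighbourhoods, countable subadditivity becomes a
    diagonal argument. *)
Definition cover_bound (A : set T) (c : R) := exists g : nat -> T -> R,
  [/\ forall k, cK (g k), forall k x, K x -> 0 <= g k x,
      forall x, K x -> {homo (fun k => g k x) : i j / (i <= j)%N >-> i <= j},
      forall k, Lam (g k) <= c
    & forall x t, A x -> K x -> t < 1 -> exists k, t < g k x].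

Definition riesz_outer (A : set T) : \bar R :=
  ereal_inf [set c%:E | c in cover_bound A].

Lemma riesz_outer_le A c : cover_bound A c -> (riesz_outer A <= c%:E)%E.
Proof. by move=> Ac; apply: ereal_inf_lbound; exists c. Qed.

Lemma cover_bound_ge0 A c : cover_bound A c -> 0 <= c.
Proof.
by move=> [g [cg g0 _ gc _]]; apply: le_trans (gc 0%N); apply: Lam_ge0 => // x; exact: g0.
Qed.

Lemma cover_bound_cst A g : cK g -> (forall x, K x -> 0 <= g x) ->
  (forall x, A x -> K x -> 1 <= g x) -> cover_bound A (Lam g).
Proof.
move=> cg g0 g1; exists (fun=> g); split => //; first by move=> x Kx i j _.
by move=> x t Ax Kx t1; exists 0%N; apply: lt_le_trans t1 (g1 _ Ax Kx).
Qed.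

Lemma riesz_outer_ge0 A : (0 <= riesz_outer A)%E.
Proof. by apply: le_ereal_inf_tmp => _ [c Ac <-]; rewrite lee_fin;
  exact: (cover_bound_ge0 Ac). Qed.

Lemma riesz_outer0 : riesz_outer set0 = 0%E.
Proof.
apply/eqP; rewrite eq_le riesz_outer_ge0 andbT.
have /riesz_outer_le : cover_bound set0 (Lam (fun=> 0)) by exact: cover_bound_cst.
by rewrite Lam0.
Qed.

Lemma le_riesz_outer : {homo riesz_outer : A B / A `<=` B >-> (A <= B)%E}.
Proof.
move=> A B AB; apply: le_ereal_inf => _ [c [g [? ? ? ? gB]] <-]; exists c => //.
by exists g; split => // x t /AB; apply: gB.
Qed.

Lemma riesz_outer_fin A : riesz_outer A \is a fin_num.
Proof.
rewrite ge0_fin_numE ?riesz_outer_ge0//.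
apply: (@le_lt_trans _ _ (Lam (fun=> 1))%:E); last by rewrite ltry.
by apply: riesz_outer_le; exact: cover_bound_cst.
Qed.

Lemma riesz_outer_approx A e : 0 < e ->
  exists2 c, cover_bound A c & (c%:E <= riesz_outer A + e%:E)%E.
Proof.
move=> e0; have [_ [c Ac <-] ce] := lb_ereal_inf_adherent e0 (riesz_outer_fin A).
by exists c => //; exact: ltW.
Qed.

Lemma riesz_outer_sigma_subadditive : sigma_subadditive riesz_outer.
Proof.
move=> F; apply/lee_addgt0Pr => e e0.
rewrite (le_trans _ (epsilon_trick _ _ (ltW e0)))//; last first.
  by move=> k; exact: riesz_outer_ge0.
have eps0 k : 0 < e / (2 ^ k.+1)%:R by rewrite divr_gt0// ltr0n expn_gt0.
have /choice[c cP] k : exists c, cover_bound (F k) c /\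
    (c%:E <= riesz_outer (F k) + (e / (2 ^ k.+1)%:R)%:E)%E.
  by have [c ? ?] := riesz_outer_approx (F k) (eps0 k); exists c.
have /choice[g gP] : forall k, _ := fun k => (cP k).1.
have ps m : ((\sum_(i < m) c i)%R%:E <=
    \sum_(0 <= i <oo) (riesz_outer (F i) + (e / (2 ^ i.+1)%:R)%:E))%E.
  rewrite -sumEFin -(big_mkord xpredT (fun i => (c i)%:E)).
  apply: (le_trans (lee_sum _ _)); last first.
    apply: nneseries_lim_ge => i _ _; rewrite adde_ge0 ?riesz_outer_ge0// lee_fin; exact/ltW.
  by move=> i _; exact: (cP i).2.
move sE : (\sum_(0 <= i <oo) _)%E => s; rewrite sE in ps.
case: s ps {sE} => [s|_|]; last 2 first.
- by rewrite leey.
- by move=> /(_ 0%N); rewrite big_ord0 leeNy_eq.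
move=> ps; apply: riesz_outer_le.
(* Diagonal sum: it increases with [m] because terms are added and each term grows, and it
   eventually dominates every [g i k]. Below, the number [l] of terms and the stage [m] are
   separated so that the induction on [l] runs at a fixed stage. *)
pose G m := \sum_(i < m.+1) g i m.
have GE m x : G m x = \sum_(i < m.+1) g i m x by rewrite /G fct_sumE.
have cG l m : cK (\sum_(i < l) g i m) /\ Lam (\sum_(i < l) g i m) <= \sum_(i < l) c i.
  elim: l => [|l [ih1 ih2]].
    rewrite !big_ord0; split; first exact: (within_cst 0).
    by rewrite -[leLHS]/(Lam (fun=> 0)) Lam0.
  rewrite !big_ord_recr /=; have [cgl _ _ gc _] := gP l.
  by split; [exact: withinD|rewrite LamD// lerD].
exists G; split.
- by move=> m; exact: (cG _ _).1.
- by move=> m x Kx; rewrite GE; apply: sumr_ge0 => i _; have [_ + _ _ _] := gP i; exact.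
- move=> x Kx i j ij; rewrite !GE.
  rewrite -(big_mkord xpredT (fun k => g k i x)) -(big_mkord xpredT (fun k => g k j x)).
  rewrite [leRHS](big_cat_nat (leq0n i.+1) (_ : (i.+1 <= j.+1)%N))//= -[leLHS]addr0 lerD//.
    by apply: ler_sum => k _; have [_ _ + _ _] := gP k; exact.
  by apply: sumr_ge0 => k _; have [_ + _ _ _] := gP k; exact.
- by move=> m; apply: le_trans (cG _ _).2 _; rewrite -lee_fin.
- move=> x t [i _ Fix] Kx t1; have [_ g0 gh _ /(_ x t Fix Kx t1)[k tk]] := gP i.
  exists (maxn i k); apply: (lt_le_trans tk).
  have im : (i < (maxn i k).+1)%N by rewrite ltnS leq_maxl.
  rewrite GE (bigD1 (Ordinal im))//=.
  rewrite -[leLHS]addr0 lerD//; first by apply: gh => //; exact: leq_maxr.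
  by apply: sumr_ge0 => j _; have [_ + _ _ _] := gP j; exact.
Qed.

HB.instance Definition _ := isOuterMeasure.Build R T riesz_outer
  riesz_outer0 riesz_outer_ge0 le_riesz_outer riesz_outer_sigma_subadditive.

(* A cover g_k of A is split as g_k theta_k + g_k (1 - theta_k), where the
   continuous theta_k increase to the indicator function of U. *)
Lemma open_caratheodory U : open U -> riesz_outer.-caratheodory U.
Proof.
move=> /perfT[d [cd d0 UE]]; apply: le_caratheodory_measurable => A.
apply/lee_addgt0Pr => e e0.
have [c [g [cg g0 gh gc gA]] ce] := riesz_outer_approx A e0.
apply: le_trans ce.
pose th k x := Num.min 1 (k%:R * d x).
have cth k : cK (th k).
  apply: within_min => //; apply: withinM; first exact: within_cst.
  exact: continuous_subspaceT.
have th0 k x : 0 <= th k x by rewrite le_min ler01 mulr_ge0.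
have th1 k x : th k x <= 1 by rewrite ge_min lexx.
have thh x i j : (i <= j)%N -> th i x <= th j x.
  move=> ij; rewrite le_min ge_min lexx/= ge_min; apply/orP; right.
  by rewrite ler_wpM2r// ler_nat.
pose a k := Lam (g k \* th k).
have ca k : cK (g k \* th k) by exact: withinM.
have ac k : a k <= c.
  apply: le_trans (gc k); apply: le_Lam => // x Kx /=.
  by rewrite ler_piMr ?g0.
have supa : has_sup (range a).
  by split; [exists (a 0%N); exists 0%N|exists c => _ [k _ <-]].
have H1 : (riesz_outer (A `&` U) <= (sup (range a))%:E)%E.
  apply: riesz_outer_le; exists (fun k => g k \* th k); split => //.
  - by move=> k x Kx; rewrite mulr_ge0// g0.
  - by move=> x Kx i j ij; rewrite ler_pM// ?g0// ?gh// thh.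
  - by move=> k; apply: sup_upper_bound => //; exists k.
  - move=> x t [Ax Ux] Kx t1; have [k tk] := gA x t Ax Kx t1.
    have dx : 0 < d x by move: Ux; rewrite UE.
    exists (maxn k (Num.truncn (d x)^-1).+1); rewrite /=.
    rewrite (_ : th _ _ = 1) ?mulr1.
      by apply: (lt_le_trans tk); apply: gh => //; exact: leq_maxl.
    apply/min_idPl; rewrite -ler_pdivrMr// div1r.
    apply: (@le_trans _ _ (Num.truncn (d x)^-1).+1%:R).
      exact/ltW/truncnS_gt.
    by rewrite ler_nat leq_maxr.
have H2 : (riesz_outer (A `&` ~` U) <= (c - sup (range a))%:E)%E.
  rewrite EFinB leeBrDr// -leeBrDl ?riesz_outer_fin//.
  rewrite -(fineK (riesz_outer_fin (A `&` ~` U))) -EFinB lee_fin.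
  apply: ge_sup; first by case: supa.
  move=> _ [j _ <-]; rewrite lerBrDr -lerBrDl -lee_fin fineK ?riesz_outer_fin//.
  apply: riesz_outer_le; exists (fun k => g k \* (fun x => 1 - th j x)).
  have cj k : cK (g k \* (fun x => 1 - th j x)).
    exact: (withinM (cg k) (withinB (within_cst 1) (cth j))).
  split => //.
  - by move=> k x Kx; rewrite mulr_ge0 ?g0// subr_ge0.
  - by move=> x Kx k l kl /=; rewrite ler_wpM2r ?subr_ge0// gh.
  (* At the common stage [maxn k j] both bounds apply: [Lam (g (maxn k j))] is at most [c], and its
     part under [th j] is at least [a j]. *)
  - move=> k; apply: (@le_trans _ _ (Lam (g (maxn k j) \* (fun x => 1 - th j x)))).
      by apply: le_Lam => // x Kx /=; rewrite ler_wpM2r ?subr_ge0// gh// leq_maxl.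
    rewrite (_ : _ \* _ = g (maxn k j) \- (g (maxn k j) \* th j)); last first.
      by apply/funext => x /=; rewrite mulrBr mulr1.
    rewrite LamB//; last exact: withinM.
    rewrite lerB// /a le_Lam//; first exact: withinM.
    by move=> x Kx /=; rewrite ler_wpM2r// gh// leq_maxr.
  - move=> x t [Ax Ux] Kx t1; have [k tk] := gA x t Ax Kx t1; exists k => /=.
    suff -> : th j x = 0 by rewrite subr0 mulr1.
    have : d x <= 0 by rewrite leNgt; apply/negP => dx; apply: Ux; rewrite UE.
    move=> dx; rewrite /th (_ : d x = 0); last by apply/eqP; rewrite eq_le dx d0.
    by rewrite mulr0; apply/min_idPr.
apply: le_trans (leeD H1 H2) _.
by rewrite -EFinD addrC subrK.
Qed.

Lemma borel_caratheodory (A : set (borel T)) :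
  measurable A -> riesz_outer.-caratheodory A.
Proof.
apply: (@smallest_sub _ (sigma_algebra setT) open riesz_outer.-caratheodory).
  split.
  - exact: caratheodory_measurable_set0.
  - by move=> B mB; rewrite setTD; exact: caratheodory_measurable_setC.
  - by move=> F mF; exact: caratheodory_measurable_bigcup.
by move=> U; exact: open_caratheodory.
Qed.

Definition riesz_measure : set (borel T) -> \bar R := riesz_outer.

Let riesz_measure_sigma_additive : semi_sigma_additive riesz_measure.
Proof.
move=> F mF tF mUF.
apply: (@caratheodory_measure_sigma_additive R T riesz_outer F _ tF).
  by move=> i; exact: borel_caratheodory.
exact: borel_caratheodory.
Qed.

HB.instance Definition _ := isMeasure.Build _ (borel T) R riesz_measure
  riesz_outer0 riesz_outer_ge0 riesz_measure_sigma_additive.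

Local Notation sigma := (riesz_measure : {measure set (borel T) -> \bar R}).

Hypothesis closedK : closed K.
Let mK : measurable (K : set (borel T)). Proof. exact: closed_borel. Qed.

(** Dini's argument. If no [g k] exceeds [t] on the whole of [K], points [u k] with [g k (u k) < t]
    cluster at some [x]; a [g j] exceeds [t] near [x], hence so does every later [g k], at some
    [u k] too. *)
Let cover_bound_top (A : set T) (c : R) (t : R) : K `<=` A -> t < 1 ->
  cover_bound A c -> t * Lam (fun=> 1) <= c.
Proof.
move=> KA t1 [g [cg g0 gh gc gA]].
have [k gkt] : exists k, forall x, K x -> t <= g k x.
  apply: contrapT => /forallNP ngt.
  have /choice[u uP] : forall k, exists x, K x /\ g k x < t.
    move=> k; have /existsNP[x /not_implyP[Kx /negP]] := ngt k.
    by rewrite -ltNge => gx; exists x.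
  have [] := cptK (F := u @ \oo) _.
    by exists 0%N => // k _ /=; have [] := uP k.
  move=> x [Kx clx].
  have [j tj] := gA x t (KA _ Kx) Kx t1.
  have /continuousP/(_ _ (@interval_open R (BRight t) +oo%O erefl erefl)) := cg j.
  move=> /open_subspaceP[V oV VK].
  have Vx : V x.
    have : (V `&` K) x by rewrite VK; split => //=; rewrite in_itv/= tj.
    by case.
  have [] := clx [set y | exists2 k, (j <= k)%N & y = u k] V.
  - by exists j => // k /= jk; exists k.
  - exact: open_nbhs_nbhs.
  move=> y [[k jk ->] Vu].
  have [Ku ukt] := uP k.
  have : (V `&` K) (u k) by [].
  rewrite VK => -[/=]; rewrite in_itv/= andbT => + _.
  by rewrite ltNge (le_trans (gh _ Ku _ _ jk))// ltW.
apply: le_trans (gc k); rewrite -LamZ//; apply: le_Lam => //.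
by move=> x Kx; rewrite mulr1; exact: gkt.
Qed.

Lemma riesz_measure_total (A : set T) : K `<=` A -> sigma A = (Lam (fun=> 1))%:E.
Proof.
move=> KA; apply/eqP; rewrite eq_le; apply/andP; split.
  by apply: riesz_outer_le; apply: cover_bound_cst.
apply: le_ereal_inf_tmp => _ [c cA <-]; rewrite lee_fin.
have c0 := cover_bound_ge0 cA.
have L0 : 0 <= Lam (fun=> 1) by exact: Lam_ge0.
apply/ler_addgt0Pr => e e0.
have t1 : 1 - e / (Lam (fun=> 1) + 1) < 1.
  by rewrite ltrBlDr ltrDl divr_gt0// ltr_wpDl.
have := cover_bound_top KA t1 cA.
rewrite mulrBl mul1r lerBlDr => /le_trans; apply; rewrite lerD2l.
by rewrite -mulrA ler_piMr ?(ltW e0)// mulrC ler_pdivrMr ?mul1r ?lerDl// ltr_wpDl.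
Qed.

Lemma riesz_measureC : sigma (~` K) = 0%E.
Proof.
apply/eqP; rewrite eq_le measure_ge0 andbT.
have /riesz_outer_le : cover_bound (~` K) (Lam (fun=> 0)) by exact: cover_bound_cst.
by rewrite Lam0.
Qed.

(** The multiples k g form a cover of [A] at cost 0. With the defining function as [g], this puts
    sigma^perp on the frontier. *)
Lemma riesz_measure_null (A : set T) g : cK g -> (forall x, K x -> 0 <= g x) ->
  Lam g = 0 -> (forall x, A x -> K x -> 0 < g x) -> sigma A = 0%E.
Proof.
move=> cg g0 Lg gA; apply/eqP; rewrite eq_le measure_ge0 andbT.
apply: (@riesz_outer_le _ 0); exists (fun k x => k%:R * g x); split.
- by move=> k; apply: withinM => //; exact: within_cst.
- by move=> k x Kx; rewrite mulr_ge0 ?g0.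
- by move=> x Kx i j ij; rewrite ler_wpM2r ?g0// ler_nat.
- by move=> k; rewrite LamZ// Lg mulr0.
- move=> x t Ax Kx t1; have gx := gA x Ax Kx.
  exists (Num.truncn (g x)^-1).+1; apply: (lt_trans t1).
  by rewrite -ltr_pdivrMr// div1r truncnS_gt.
Qed.

Lemma riesz_measure_le (A : set T) g : cK g -> (forall x, K x -> 0 <= g x) ->
  (forall x, A x -> K x -> 1 <= g x) -> (sigma A <= (Lam g)%:E)%E.
Proof. by move=> *; apply: riesz_outer_le; exact: cover_bound_cst. Qed.

Let mcK f : cK f -> measurable_fun (K : set (borel T)) (fun x : borel T => (f x)%:E).
Proof. by move=> cf; apply/measurable_EFinP; exact: within_measurable. Qed.

(** Slicing into layers of height [e]: a layer of (f - e)^+ is at most [e] on {f >= e}, and e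
    sigma({f >= e}) <= Lam (min(f, e)), the value of [Lam] on the layer just below. The induction
    peels off one layer at a time. *)
Let integral_pos_part (e : R) (N : nat) (f : T -> R) : 0 < e -> cK f ->
  (forall x, K x -> 0 <= f x) -> (forall x, K x -> f x <= N%:R * e) ->
  (\int[sigma]_(x in K) (Num.max (f x - e) 0)%:E <= (Lam f)%:E)%E.
Proof.
move=> e0; elim: N f => [|N ih] f cf f0 fN.
  rewrite integral0_eq ?lee_fin ?Lam_ge0// => x Kx; congr EFin.
  by apply/max_idPr; rewrite subr_le0 (le_trans (fN x Kx))// mul0r ltW.
pose f1 x := Num.max (f x - e) 0.
have cf1 : cK f1 by apply: within_max; [apply: (withinB cf (within_cst e))|exact: (within_cst 0)].
have f10 x : 0 <= f1 x by rewrite /f1 le_max lexx orbT.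
have cf2 : cK (fun x => Num.min (f x) e) by apply: within_min => //; exact: (within_cst e).
have cf3 : cK (fun x => Num.min (f1 x) e) by apply: within_min => //; exact: (within_cst e).
have cf4 : cK (fun x => Num.max (f1 x - e) 0).
  by apply: within_max; [apply: (withinB cf1 (within_cst e))|exact: (within_cst 0)].
have -> : Lam f = Lam (fun x => Num.min (f x) e) + Lam f1.
  rewrite -LamD//; congr Lam; apply/funext => x /=; rewrite /f1.
  by rewrite /Num.min /Num.max /Order.min /Order.max; case: ifP; case: ifP; lra.
rewrite EFinD.
have -> : (\int[sigma]_(x in K) (Num.max (f x - e) 0)%:E =
    \int[sigma]_(x in K) (Num.min (f1 x) e)%:E +
    \int[sigma]_(x in K) (Num.max (f1 x - e) 0)%:E)%E.
  rewrite -ge0_integralD//=.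
  - apply: eq_integral => x _; rewrite -EFinD; congr EFin; rewrite -/(f1 x).
    by rewrite /Num.min /Num.max /Order.min /Order.max; case: ifP; case: ifP; lra.
  - by move=> x _; rewrite lee_fin le_min f10 ltW.
  - exact: mcK.
  - by move=> x _; rewrite lee_fin le_max lexx orbT.
  - exact: mcK.
apply: leeD; last first.
  apply: ih => // x Kx; rewrite /f1 ge_max mulr_ge0 ?(ltW e0)// andbT.
  by rewrite lerBlDr -[X in _ + X]mul1r -mulrDl natr1 fN.
pose A := K `&` [set x | e <= f x].
have mA : measurable (A : set (borel T)).
  have -> : A = K `&` ((f : borel T -> R) @^-1` `[e, +oo[%classic).
    by apply/seteqP; split => x [Kx /=]; rewrite in_itv/= andbT.
  exact: (within_measurable mK cf mK).
apply: (@le_trans _ _ (\int[sigma]_(x in K) (e%:E * (\1_A x)%:E))%E).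
  apply: ge0_le_integral => //.
  - by move=> x _; rewrite lee_fin le_min f10 ltW.
  - exact: mcK.
  - apply: measurable_funeM; apply/measurable_EFinP.
    exact: measurable_indic.
  - move=> x Kx; rewrite -EFinM lee_fin indicE.
    have [xA|xA] := boolP (x \in A).
      by rewrite mulr1 ge_min lexx orbT.
    rewrite mulr0 ge_min /f1 ge_max lexx andbT; apply/orP; left.
    rewrite subr_le0 leNgt; apply/negP => ef.
    by move/negP : xA; apply; rewrite inE; split => //=; exact: ltW.
rewrite ge0_integralZl//; last 2 first.
- by apply/measurable_EFinP; exact: measurable_indic.
- by rewrite lee_fin ltW.
rewrite integral_indic//.
rewrite (_ : A `&` K = A); last by apply/setIidPl => x [].
rewrite -(@lee_pmul2l _ e^-1%:E) ?fin_numE//; last by rewrite lte_fin invr_gt0.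
rewrite muleA -EFinM mulVf ?gt_eqF// mul1e -EFinM -LamZ//.
apply: riesz_measure_le.
- by apply: withinM => //; exact: (within_cst e^-1).
- by move=> x Kx; rewrite mulr_ge0 ?invr_ge0 ?le_min ?f0// ltW.
- move=> x [_ /= ef] Kx; rewrite mulrC ler_pdivlMr// mul1r.
  by rewrite le_min ef lexx.
Qed.

Let integral_le_Lam (f : T -> R) : cK f -> (forall x, K x -> 0 <= f x) ->
  (\int[sigma]_(x in K) (f x)%:E <= (Lam f)%:E)%E.
Proof.
move=> cf f0; have [M M0 fM] := within_bounded cptK cf.
have L0 : 0 <= Lam (fun=> 1) by exact: Lam_ge0.
apply/lee_addgt0Pr => d d0.
(* The lost bottom layer costs e sigma(K) = e Lam(1) <= d. *)
pose e := d / (Lam (fun=> 1) + 1).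
have e0 : 0 < e by rewrite divr_gt0// ltr_wpDl.
have cf1 : cK (fun x => Num.max (f x - e) 0).
  by apply: within_max; [apply: (withinB cf (within_cst e))|exact: (within_cst 0)].
apply: (@le_trans _ _ (\int[sigma]_(x in K) ((Num.max (f x - e) 0)%:E + (cst e%:E x)))%E).
  apply: ge0_le_integral => //.
  - exact: mcK.
  - apply: emeasurable_funD => //; exact: mcK.
  - by move=> x Kx; rewrite -EFinD lee_fin -lerBlDr le_max lexx.
rewrite ge0_integralD//; last 3 first.
- by move=> x _; rewrite lee_fin le_max lexx orbT.
- exact: mcK.
- by move=> x _; rewrite lee_fin ltW.
rewrite integral_cst// riesz_measure_total// leeD//.
  apply: (@integral_pos_part e (Num.truncn (M / e)).+1) => // x Kx.
  rewrite -ler_pdivrMr//; apply: le_trans (ltW (truncnS_gt _)).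
  by rewrite ler_pM2r ?invr_gt0// (le_trans _ (fM x Kx))// ler_norm.
by rewrite -EFinM lee_fin /e mulrAC ler_pdivrMr ?ltr_wpDl// ler_wpM2l ?(ltW d0)// lerDl.
Qed.

(** The inequality for nonnegative functions, applied to f + M and to M - f, gives both directions,
    because the constant M has the same value under the integral and under [Lam]. *)
Lemma riesz_measure_integral (f : T -> R) : cK f -> \int[sigma]_(x in K) f x = Lam f.
Proof.
move=> cf; have [M M0 fM] := within_bounded cptK cf.
have sK : (sigma K < +oo)%E by rewrite riesz_measure_total ?ltry.
have cM : cK (fun=> M) by exact: within_cst.
have ic g : cK g -> sigma.-integrable K (EFin \o (g : borel T -> R)).
  by move=> cg; exact: within_integrable.
have le_R g : cK g -> (forall x, K x -> 0 <= g x) -> \int[sigma]_(x in K) g x <= Lam g.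
  move=> cg g0; have := integral_le_Lam cg g0.
  by rewrite -lee_fin /Rintegral fineK//; exact: (integrable_fin_num mK (ic _ cg)).
have h1 : \int[sigma]_(x in K) (f x + M) <= Lam (f \+ (fun=> M)).
  apply: le_R => [|x Kx /=]; first exact: withinD.
  by have := fM x Kx; rewrite ler_norml => /andP[h _]; rewrite -lerBlDr sub0r.
have h2 : \int[sigma]_(x in K) (M - f x) <= Lam ((fun=> M) \- f).
  apply: le_R => [|x Kx /=]; first exact: (withinB cM cf).
  by have := fM x Kx; rewrite ler_norml subr_ge0 => /andP[].
have LM : Lam (fun=> M) = M * Lam (fun=> 1).
  by rewrite -LamZ//; congr Lam; apply/funext => x; rewrite mulr1.
rewrite RintegralD// in h1; try exact: ic.
rewrite RintegralB// in h2; try exact: ic.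
rewrite Rintegral_cst// riesz_measure_total//= in h1 h2.
rewrite LamD// LM in h1; rewrite (LamB cM cf) LM in h2.
by apply/eqP; rewrite eq_le; apply/andP; split; lra.
Qed.

Theorem riesz_markov : exists s : {measure set (borel T) -> \bar R},
  [/\ forall A, K `<=` A -> s A = (Lam (fun=> 1))%:E,
      s (~` K) = 0%E,
      forall f, cK f -> \int[s]_(x in K) f x = Lam f,
      forall (A : set T) g, cK g -> (forall x, K x -> 0 <= g x) -> Lam g = 0 ->
        (forall x, A x -> K x -> 0 < g x) -> s A = 0%E
    & forall (A : set T) g, cK g -> (forall x, K x -> 0 <= g x) ->
        (forall x, A x -> K x -> 1 <= g x) -> (s A <= (Lam g)%:E)%E].
Proof.
exists sigma; split.
- exact: riesz_measure_total.
- exact: riesz_measureC.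
- exact: riesz_measure_integral.
- exact: riesz_measure_null.
- exact: riesz_measure_le.
Qed.

End RieszMarkov.

(** * Euclidean geometry and differential calculus *)

Section EuclideanSpace.
Context {R : realType} {n : nat}.
Implicit Types (u v w : 'rV[R]_n) (a : R).

Lemma dotC u v : dot u v = dot v u.
Proof. by apply: eq_bigr => i _; rewrite mulrC. Qed.

Lemma dotDl u v w : dot (u + v) w = dot u w + dot v w.
Proof. by rewrite -big_split; apply: eq_bigr => i _; rewrite mxE mulrDl. Qed.

Lemma dotZl a u v : dot (a *: u) v = a * dot u v.
Proof. by rewrite mulr_sumr; apply: eq_bigr => i _; rewrite mxE mulrA. Qed.

Lemma dotDr u v w : dot u (v + w) = dot u v + dot u w.
Proof. by rewrite dotC dotDl !(dotC u). Qed.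

Lemma dotZr a u v : dot u (a *: v) = a * dot u v.
Proof. by rewrite dotC dotZl dotC. Qed.

Lemma dotNl u v : dot (- u) v = - dot u v.
Proof. by rewrite -scaleN1r dotZl mulN1r. Qed.

Lemma dotNr u v : dot u (- v) = - dot u v.
Proof. by rewrite dotC dotNl dotC. Qed.

Lemma dotBl u v w : dot (u - v) w = dot u w - dot v w.
Proof. by rewrite dotDl dotNl. Qed.

Lemma dotBr u v w : dot u (v - w) = dot u v - dot u w.
Proof. by rewrite dotDr dotNr. Qed.

Lemma dot0l v : dot 0 v = 0.
Proof. by rewrite -(scale0r 0) dotZl mul0r. Qed.

Lemma dot0r v : dot v 0 = 0.
Proof. by rewrite dotC dot0l. Qed.

Lemma dot_delta i v : dot (delta_mx 0 i) v = v 0 i.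
Proof.
rewrite /dot (bigD1 i)//= !mxE !eqxx mul1r big1 ?addr0// => j ji.
by rewrite mxE eqxx (negbTE ji) mul0r.
Qed.

Lemma dot_mulmxE u v : dot u v = (u *m v^T) 0 0.
Proof. by rewrite mxE; apply: eq_bigr => i _; rewrite mxE. Qed.

Lemma dot_mulmx u v (P : 'M[R]_n) : dot (u *m P) v = dot u (v *m P^T).
Proof. by rewrite !dot_mulmxE trmx_mul trmxK mulmxA. Qed.

Lemma dotvv_ge0 v : 0 <= dot v v.
Proof. by apply: sumr_ge0 => i _; exact: sqr_ge0. Qed.

Lemma dotvv_eq0 v : (dot v v == 0) = (v == 0).
Proof.
apply/eqP/eqP => [/eqP|->]; last by rewrite dot0l.
rewrite psumr_eq0 => [/allP v0|i _]; last exact: sqr_ge0.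
apply/rowP => i; rewrite mxE; apply/eqP.
by have := v0 i (mem_index_enum i); rewrite mulf_eq0 orbb.
Qed.

Lemma enorm_ge0 v : 0 <= enorm v. Proof. exact: sqrtr_ge0. Qed.

Lemma enorm_sqr v : enorm v ^+ 2 = dot v v.
Proof. by rewrite sqr_sqrtr ?dotvv_ge0. Qed.

Lemma enorm_eq0 v : (enorm v == 0) = (v == 0).
Proof. by rewrite -dotvv_eq0 -enorm_sqr expf_eq0. Qed.

Lemma enorm_gt0 v : (0 < enorm v) = (v != 0).
Proof. by rewrite lt0r enorm_ge0 andbT enorm_eq0. Qed.

Lemma enorm0 : enorm (0 : 'rV[R]_n) = 0.
Proof. by apply/eqP; rewrite enorm_eq0. Qed.

Lemma enormZ a v : enorm (a *: v) = `|a| * enorm v.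
Proof. by rewrite /enorm dotZl dotZr mulrA -expr2 sqrtrM ?sqr_ge0// sqrtr_sqr. Qed.

Lemma dot_le_enorm u v : `|dot u v| <= enorm u * enorm v.
Proof.
rewrite -sqrtr_sqr -sqrtrM ?dotvv_ge0// ler_wsqrtr//.
have [/eqP|v0] := eqVneq (dot v v) 0.
  by rewrite dotvv_eq0 => /eqP ->; rewrite !dot0r expr0n mulr0.
have vv : 0 < dot v v by rewrite lt0r v0 dotvv_ge0.
have := dotvv_ge0 (dot v v *: u - dot u v *: v).
rewrite dotBl !dotBr !dotZl !dotZr (dotC v u) => h.
rewrite -subr_ge0 -(pmulr_rge0 _ vv); apply: le_trans h _.
by rewrite le_eqVlt; apply/orP; left; apply/eqP; ring.
Qed.

Lemma enormD u v : enorm (u + v) <= enorm u + enorm v.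
Proof.
rewrite -(@ler_pXn2r _ 2)// ?nnegrE ?addr_ge0 ?enorm_ge0//.
rewrite enorm_sqr dotDl !dotDr (dotC v u) sqrrD !enorm_sqr.
have := le_trans (ler_norm _) (dot_le_enorm u v); lra.
Qed.

Lemma coord_le_enorm v i : `|v 0 i| <= enorm v.
Proof.
rewrite -sqrtr_sqr ler_wsqrtr// /dot (bigD1 i)//= -expr2 lerDl.
by apply: sumr_ge0 => j _; exact: sqr_ge0.
Qed.

Lemma enorm_le_sum v : enorm v <= \sum_i `|v 0 i|.
Proof.
rewrite -(@ler_pXn2r _ 2)// ?nnegrE ?enorm_ge0 ?sumr_ge0//.
rewrite enorm_sqr expr2 mulr_suml; apply: ler_sum => i _.
rewrite (le_trans (ler_norm _))// normrM ler_wpM2l//.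
by rewrite (bigD1 i)//= lerDl sumr_ge0.
Qed.

Lemma enorm_le_coord v a : (forall i, `|v 0 i| <= a) -> enorm v <= n%:R * a.
Proof.
move=> va; apply: le_trans (enorm_le_sum v) _.
apply: (@le_trans _ _ (\sum_(i < n) a)); first exact: ler_sum.
by rewrite sumr_const card_ord mulr_natl.
Qed.

End EuclideanSpace.

Section EuclideanTopology.
Context {R : realType} {n : nat}.
Local Notation E := 'rV[R]_n.+1.

Lemma coord_le_norm (v : E) i : `|v 0 i| <= `|v|.
Proof.
rewrite [leRHS]/Num.Def.normr/= mx_normrE.
exact: (le_bigmax _ (fun ij : 'I_1 * 'I_n.+1 => `|v ij.1 ij.2|) (0, i)).
Qed.

Lemma enorm_le_norm (v : E) : enorm v <= n.+1%:R * `|v|.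
Proof. by apply: enorm_le_coord => i; exact: coord_le_norm. Qed.

Lemma norm_le_enorm (v : E) : `|v| <= enorm v.
Proof.
rewrite [leLHS]/Num.Def.normr/= mx_normrE; apply: bigmax_le; first exact: enorm_ge0.
by move=> [i j] _ /=; rewrite ord1; exact: coord_le_enorm.
Qed.

Section into_E.
Context {T : topologicalType}.
Implicit Types (f g : T -> E) (x : T).

Lemma continuous_coord f x i : {for x, continuous f} ->
  {for x, continuous (fun y => f y 0 i)}.
Proof.
move=> cf; apply: (@continuous_comp _ _ _ f (fun v : E => v 0 i)) => //.
exact: coord_continuous.
Qed.

Lemma continuous_coordP f x : (forall i, {for x, continuous (fun y => f y 0 i)}) ->
  {for x, continuous f}.
Proof.
move=> cf; apply/cvgrPdist_le => e e0.
near=> y; rewrite [leLHS]/Num.Def.normr/= mx_normrE; apply: bigmax_le; first exact: ltW.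
move=> [i j] _ /=; rewrite ord1 !mxE.
suff : forall k : 'I_n.+1, `|f x 0 k - f y 0 k| <= e by exact.
near: y; apply: filter_forall => k.
by have /cvgrPdist_le := cf k; exact.
Unshelve. all: by end_near. Qed.

Lemma continuous_dot f g x : {for x, continuous f} -> {for x, continuous g} ->
  {for x, continuous (fun y => dot (f y) (g y))}.
Proof.
move=> cf cg; apply: continuous_sum => i.
by apply: (@continuousM R); exact: continuous_coord.
Qed.

Lemma continuous_enorm f x : {for x, continuous f} ->
  {for x, continuous (fun y => enorm (f y))}.
Proof.
move=> cf; apply: (continuous_comp (f := fun y => dot (f y) (f y)) (g := Num.sqrt)).
  exact: continuous_dot.
exact: sqrt_continuous.
Qed.

End into_E.

Lemma eball_closed (x : E) r : closed (eball x r).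
Proof.
have ce : continuous (fun y : E => enorm (y - x)).
  move=> y; apply: (@continuous_enorm E (fun y => y - x)).
  by apply: (@continuousB R E E id (cst x)) => //; exact: cst_continuous.
rewrite (_ : eball x r = (fun y => enorm (y - x)) @^-1` [set s | s <= r])//.
by apply: closed_comp => // y _; exact: ce.
Qed.

Lemma eball_sub (x : E) r s : r <= s -> eball x r `<=` eball x s.
Proof. by move=> rs y /= /le_trans; exact. Qed.

(** The function is the distance to the complement of [U]. The whole space is set apart, since the
    infimum over an empty complement is a default value. *)
Lemma dist_separation (U : set E) : open U -> exists d : E -> R,
  [/\ continuous d, forall x, 0 <= d x & U = [set x | 0 < d x]].
Proof.
move=> oU; have [->|CU] := eqVneq U setT.
  exists (fun=> 1); split => //; first by move=> x; exact: cst_continuous.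
  by apply/seteqP; split => x //= _; exact: ltr01.
have /set0P[z Uz] : ~` U != set0.
  by apply/eqP => /(congr1 setC); rewrite setCK setC0; exact/eqP.
pose D (x : E) : set R := [set `|x - y| | y in ~` U].
have D0 x : lbound (D x) 0 by move=> _ [y _ <-].
have Dn x : D x !=set0 by exists `|x - z|; exists z.
have infD x : has_inf (D x) by split => //; exists 0.
have lip x y : inf (D x) <= `|x - y| + inf (D y).
  rewrite -lerBlDl; apply: lb_le_inf => // _ [w Uw <-]; rewrite lerBlDl.
  apply: (@le_trans _ _ `|x - w|); first by apply: ge_inf; [exists 0|exists w].
  by rewrite (le_trans _ (ler_normD _ _))// addrA subrK.
exists (fun x : E => inf (D x)); split.
- move=> x; apply: (proj2 (@cvgrPdist_le _ R^o E (nbhs x) _ _ _)) => e e0.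
  apply/nbhs_ballP; exists e => // y.
  rewrite -ball_normE /= => /ltW xy.
  have := lip x y; have := lip y x; rewrite (distrC y x) ler_norml => h1 h2.
  by apply/andP; split; lra.
- by move=> x; apply: lb_le_inf.
- apply/seteqP; split => x /=.
    move=> Ux; have [e /= e0 xe] := (nbhs_ballP x U).1 (open_nbhs_nbhs (conj oU Ux)).
    apply: (lt_le_trans e0); apply: lb_le_inf => // _ [y Uy <-].
    rewrite leNgt; apply/negP => xy; apply: Uy; apply: xe.
    by rewrite -ball_normE.
  move=> d0; apply: contrapT => Ux; move: d0; apply/negP; rewrite -leNgt.
  by apply: ge_inf; [exists 0|exists x => //; rewrite subrr normr0].
Qed.

End EuclideanTopology.

(** * Gradients of scalar functions *)

Section Gradient.
Context {R : realType} {n : nat}.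
Local Notation E := 'rV[R]_n.+1.
Implicit Types (f g : E -> R) (x v : E).

(** Differentiability and the value of the gradient travel together, so the calculus rules below
    produce explicit gradients. *)
Definition has_grad f x (c : E) : Prop := is_diff x f (fun v => dot v c).

Let dot_linear (c : E) : linear (fun v : E => dot v c).
Proof. by move=> a u v; rewrite dotDl dotZl. Qed.

Let dot_continuous (c : E) : continuous (fun v : E => dot v c).
Proof. by move=> v; apply: continuous_dot => //; exact: cst_continuous. Qed.

Lemma has_gradP f x c : has_grad f x c <->
  forall e, 0 < e -> \forall y \near x, `|f y - f x - dot (y - x) c| <= e * `|y - x|.
Proof.
have nearP (P : set E) : nbhs (0 : E) P <-> nbhs x (fun y => P (y - x)).
  have -> : nbhs (0 : E) P = nbhs x (P \o shift (0 - x)) := near_shift x 0 P.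
  by rewrite sub0r.
pose D := HB.pack_for {linear E -> R} (fun v : E => dot v c)
  (GRing.isLinear.Build _ _ _ _ _ (dot_linear c)).
split => [[df dfE] e e0|H].
- have /diff_locallyP[_ /eqaddoP/(_ _ e0)] := df.
  rewrite dfE => /(nearP _).1; apply: filterS => y /=.
  by rewrite !fctE /= subrK opprD addrA.
- have Dc : continuous D := @dot_continuous c.
  have HD : (f \o shift x : E -> R) = cst (f x) + (D : E -> R) +o_ (0 : E) id.
    apply/eqaddoP => e e0; apply/(nearP _).2; have := H _ e0; apply: filterS => y /=.
    by rewrite !fctE /= subrK opprD addrA.
  have dE : 'd f x = D :> (E -> R) by exact: diff_unique.
  by apply: DiffDef => //; apply/diff_locallyP; rewrite dE.
Qed.

Lemma has_grad_near f g x c : (\forall y \near x, f y = g y) ->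
  has_grad f x c -> has_grad g x c.
Proof.
move=> fg /has_gradP fc; apply/has_gradP => e e0.
have fgx := nbhs_singleton fg.
by apply: filterS2 fg (fc e e0) => y <- ; rewrite fgx.
Qed.

Lemma has_grad_differentiable f x c : has_grad f x c -> differentiable f x.
Proof. by move=> []. Qed.

Lemma has_grad_derive f x c v : has_grad f x c -> 'D_v f x = dot v c.
Proof. by move=> [df dfE]; rewrite deriveE// dfE. Qed.

Lemma has_grad_grad f x c : has_grad f x c -> grad f x = c.
Proof.
by move=> fc; apply/rowP => i; rewrite mxE (has_grad_derive _ fc) dot_delta.
Qed.

Lemma has_grad_cvg f x c : has_grad f x c -> {for x, continuous f}.
Proof. by move=> /has_grad_differentiable; exact: differentiable_continuous. Qed.

Lemma differentiable_has_grad f x : differentiable f x -> has_grad f x (grad f x).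
Proof.
move=> df; apply: DiffDef => //; apply/funext => v.
rewrite {1}[v]row_sum_delta linear_sum; apply: eq_bigr => i _.
by rewrite linearZ mxE deriveE.
Qed.

Lemma has_grad_cst (a : R) x : has_grad (fun=> a) x 0.
Proof.
apply: (@is_diff_eq _ _ _ (cst a) _ _ _ (is_diff_cst a x)).
by apply/funext => v; rewrite dot0r.
Qed.

Lemma has_gradD f g x c d : has_grad f x c -> has_grad g x d ->
  has_grad (fun y => f y + g y) x (c + d).
Proof.
move=> fc gd; apply: (is_diff_eq (is_diffD fc gd)).
by apply/funext => v; rewrite dotDr.
Qed.

Lemma has_gradM f g x c d : has_grad f x c -> has_grad g x d ->
  has_grad (fun y => f y * g y) x (f x *: d + g x *: c).
Proof.
move=> fc gd; apply: (is_diff_eq (is_diffM fc gd)).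
by apply/funext => v; rewrite dotDr !dotZr.
Qed.

Lemma has_gradN f x c : has_grad f x c -> has_grad (fun y => - f y) x (- c).
Proof.
move=> fc; apply: (is_diff_eq (is_diffN fc)).
by apply/funext => v; rewrite dotNr.
Qed.

Lemma has_grad_coord i x : has_grad (fun y : E => y 0 i) x (delta_mx 0 i).
Proof.
apply/has_gradP => e e0; near=> y.
by rewrite dotC dot_delta !mxE subrr normr0 mulr_ge0// ltW.
Unshelve. all: by end_near. Qed.

Lemma has_grad_comp (h : R -> R) f x c dh : is_derive (f x) 1 h dh ->
  has_grad f x c -> has_grad (fun y => h (f y)) x (dh *: c).
Proof.
move=> [hf hE] fc.
have dhf : is_diff (f x) h ( *%R^~ dh).
  have /derivable1_diffP dfx := hf.
  apply: DiffDef => //; rewrite deriv1E// derive1E hE.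
  by apply/funext.
apply: (is_diff_eq (is_diff_comp fc dhf)).
by apply/funext => v; rewrite dotZr /= mulrC.
Qed.

Lemma has_grad_sum (I : Type) (r : seq I) (f : I -> E -> R) x (c : I -> E) :
  (forall i, has_grad (f i) x (c i)) ->
  has_grad (fun y => \sum_(i <- r) f i y) x (\sum_(i <- r) c i).
Proof.
move=> fc; elim: r => [|i r ih].
  rewrite big_nil (_ : (fun y => _) = fun=> 0); first exact: has_grad_cst.
  by apply/funext => y; rewrite big_nil.
rewrite big_cons (_ : (fun y => _) = fun y => f i y + \sum_(j <- r) f j y).
  exact: has_gradD.
by apply/funext => y; rewrite big_cons.
Qed.

End Gradient.

(** * Scalar functions of class C^1 and C^2 *)

Section Regularity.
Context {R : realType} {n : nat}.
Local Notation E := 'rV[R]_n.+1.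
Implicit Types (f g : E -> R) (x v : E) (U V : set E).

Lemma line_near (P : set E) x v : nbhs x P ->
  exists2 d, 0 < d & forall t : R, `|t| < d -> P (x + t *: v).
Proof.
move=> /nbhs_ballP[r /= r0 rP]; exists (r / (`|v| + 1)).
  by rewrite divr_gt0// ltr_wpDl.
move=> t; rewrite ltr_pdivlMr ?ltr_wpDl// => tr; apply: rP.
rewrite -ball_normE /= opprD addrA subrr sub0r normrN normrZ.
by apply: le_lt_trans tr; rewrite ler_wpM2l// lerDl.
Qed.

Lemma has_grad_line f x c v (e : R) : has_grad f x c -> 0 < e ->
  exists2 d, 0 < d & forall t : R, `|t| < d ->
    `|f (x + t *: v) - f x - t * dot v c| <= e * `|t|.
Proof.
move=> /has_gradP fc e0.
have e'0 : 0 < e / (`|v| + 1) by rewrite divr_gt0// ltr_wpDl.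
have [d d0 dP] := line_near v (fc _ e'0).
exists d => // t /dP; rewrite [x + _ - x]addrAC subrr add0r dotZl => /le_trans; apply.
rewrite normrZ mulrCA [leRHS]mulrC ler_wpM2l// mulrAC ler_pdivrMr ?ltr_wpDl//.
by rewrite ler_wpM2l ?lerDl// ltW.
Qed.

Lemma has_grad_pos f x c v : has_grad f x c -> 0 < dot v c ->
  exists2 d, 0 < d & forall t : R, 0 < t < d -> f x < f (x + t *: v).
Proof.
move=> fc vc.
have e0 : 0 < dot v c / 2 by rewrite divr_gt0.
have [d d0 dP] := has_grad_line v fc e0.
exists d => // t /andP[t0 td]; have := dP t; rewrite gtr0_norm// => /(_ td).
rewrite ler_norml => /andP[h _]; rewrite -subr_gt0.
have : 0 < t * (dot v c / 2) by rewrite mulr_gt0.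
by lra.
Qed.

(** Coordinate form of [C1_on]: finitely many partial derivatives are easier to carry through
    products and compositions than all directional ones. *)
Definition isC1 U f := forall x, U x -> differentiable f x /\
  forall i, {for x, continuous (fun y => grad f y 0 i)}.

Definition isC2 U f := isC1 U f /\ forall i, isC1 U (fun y => grad f y 0 i).

Lemma C1_on_isC1 U f : C1_on U f -> isC1 U f.
Proof.
move=> Cf x Ux; have [df cf] := Cf x Ux; split => // i.
rewrite (_ : (fun y => _) = (fun y => 'D_(delta_mx 0 i) f y)); first exact: cf.
by apply/funext => y; rewrite /= mxE.
Qed.

Lemma C2_on_isC2 U f : C2_on U f -> isC2 U f.
Proof.
move=> [Cf Df]; split => [|i]; first exact: C1_on_isC1.
rewrite (_ : (fun y => _) = (fun y => 'D_(delta_mx 0 i) f y)).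
  by apply: C1_on_isC1; exact: Df.
by apply/funext => y; rewrite /= mxE.
Qed.

Lemma isC1_has_grad U f x : isC1 U f -> U x -> has_grad f x (grad f x).
Proof. by move=> Cf Ux; apply: differentiable_has_grad; have [] := Cf x Ux. Qed.

Lemma near_continuous (T : topologicalType) (h k : T -> R) (x : T) :
  (\forall y \near x, h y = k y) -> {for x, continuous h} -> {for x, continuous k}.
Proof.
move=> hk ch; rewrite /prop_for /continuous_at -(nbhs_singleton hk).
by apply: cvg_trans ch; apply: near_eq_cvg.
Qed.

Lemma open_near U x (P : E -> Prop) : open U -> U x -> (forall y, U y -> P y) ->
  \forall y \near x, P y.
Proof. by move=> oU Ux UP; apply: filterS UP _; exact: open_nbhs_nbhs. Qed.

Lemma isC1_grad U f (c : E -> E) : open U -> (forall x, U x -> has_grad f x (c x)) ->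
  (forall x i, U x -> {for x, continuous (fun y => c y 0 i)}) -> isC1 U f.
Proof.
move=> oU fc cc x Ux; split; first exact: has_grad_differentiable (fc x Ux).
move=> i; apply: near_continuous (cc x i Ux).
by apply: (open_near oU Ux) => y Uy; rewrite (has_grad_grad (fc y Uy)).
Qed.

Lemma isC1_ext U f g : open U -> (forall x, U x -> f x = g x) -> isC1 U f -> isC1 U g.
Proof.
move=> oU fg Cf; apply: (@isC1_grad U g (grad f)) => // x.
  move=> Ux; apply: has_grad_near (isC1_has_grad Cf Ux).
  by apply: (open_near oU Ux) => y /fg.
by move=> i Ux; have [_] := Cf x Ux; exact.
Qed.

Lemma isC1_continuous U f x : isC1 U f -> U x -> {for x, continuous f}.
Proof. by move=> Cf Ux; apply: has_grad_cvg (isC1_has_grad Cf Ux). Qed.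

Lemma isC1D U f g : open U -> isC1 U f -> isC1 U g -> isC1 U (fun y => f y + g y).
Proof.
move=> oU Cf Cg; apply: (@isC1_grad _ _ (fun x => grad f x + grad g x)) => // x.
  by move=> Ux; apply: has_gradD; apply: isC1_has_grad Ux.
move=> i Ux; rewrite (_ : (fun y => _) = (fun y => grad f y 0 i) \+ (fun y => grad g y 0 i)).
  by apply: (@continuousD R R^o E); [exact: (Cf x Ux).2|exact: (Cg x Ux).2].
by apply/funext => y; rewrite /= mxE.
Qed.

Lemma isC1M U f g : open U -> isC1 U f -> isC1 U g -> isC1 U (fun y => f y * g y).
Proof.
move=> oU Cf Cg.
apply: (@isC1_grad _ _ (fun x => f x *: grad g x + g x *: grad f x)) => // x.
  by move=> Ux; apply: has_gradM; apply: isC1_has_grad Ux.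
move=> i Ux; rewrite (_ : (fun y => _) = (f \* (fun y => grad g y 0 i)) \+
   (g \* (fun y => grad f y 0 i))).
  apply: (@continuousD R R^o E); apply: (@continuousM R E).
  - exact: isC1_continuous Ux.
  - exact: (Cg x Ux).2.
  - exact: isC1_continuous Ux.
  - exact: (Cf x Ux).2.
by apply/funext => y; rewrite /= !mxE.
Qed.

Lemma isC1_cst U (a : R) : open U -> isC1 U (fun=> a).
Proof.
move=> oU; apply: (@isC1_grad _ _ (fun=> 0)) => // x *; first exact: has_grad_cst.
exact: cst_continuous.
Qed.

Lemma isC1_coord U i : open U -> isC1 U (fun y => y 0 i).
Proof.
move=> oU; apply: (@isC1_grad _ _ (fun=> delta_mx 0 i)) => // x *.
  exact: has_grad_coord.
exact: cst_continuous.
Qed.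

Lemma isC1_sum (I : Type) (r : seq I) U (f : I -> E -> R) : open U ->
  (forall i, isC1 U (f i)) -> isC1 U (fun y => \sum_(i <- r) f i y).
Proof.
move=> oU Cf; elim: r => [|i r ih].
  rewrite (_ : (fun y => _) = fun=> 0); first exact: (@isC1_cst U 0).
  by apply/funext => y; rewrite big_nil.
rewrite (_ : (fun y => _) = fun y => f i y + \sum_(j <- r) f j y);
  first exact: (isC1D oU (Cf i) ih).
by apply/funext => y; rewrite big_cons.
Qed.

Lemma isC1_comp U f (h dh : R -> R) : open U -> isC1 U f ->
  (forall x, U x -> is_derive (f x) 1 h (dh (f x)) /\ {for f x, continuous dh}) ->
  isC1 U (fun y => h (f y)).
Proof.
move=> oU Cf hP; apply: (@isC1_grad _ _ (fun x => dh (f x) *: grad f x)) => // x.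
  by move=> Ux; apply: has_grad_comp (isC1_has_grad Cf Ux); exact: (hP x Ux).1.
move=> i Ux; rewrite (_ : (fun y => _) = (dh \o f) \* (fun y => grad f y 0 i)).
  apply: (@continuousM R E); last exact: (Cf x Ux).2.
  by apply: continuous_comp; [exact: isC1_continuous Ux|exact: (hP x Ux).2].
by apply/funext => y; rewrite /= !mxE.
Qed.

Lemma isC2_ext U f g : open U -> (forall x, U x -> f x = g x) -> isC2 U f -> isC2 U g.
Proof.
move=> oU fg [Cf Cdf]; split => [|i]; first exact: isC1_ext Cf.
apply: isC1_ext (Cdf i) => // x Ux; suff -> : grad g x = grad f x by [].
apply: has_grad_grad; apply: has_grad_near (isC1_has_grad Cf Ux).
by apply: (open_near oU Ux) => y /fg.
Qed.

Lemma isC2D U f g : open U -> isC2 U f -> isC2 U g -> isC2 U (fun y => f y + g y).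
Proof.
move=> oU [Cf Cdf] [Cg Cdg]; split => [|i]; first exact: isC1D.
apply: (@isC1_ext _ (fun y => grad f y 0 i + grad g y 0 i)) => //.
  move=> x Ux; rewrite (has_grad_grad (has_gradD (isC1_has_grad Cf Ux) (isC1_has_grad Cg Ux))).
  by rewrite [RHS]mxE.
exact: isC1D.
Qed.

Lemma isC2M U f g : open U -> isC2 U f -> isC2 U g -> isC2 U (fun y => f y * g y).
Proof.
move=> oU [Cf Cdf] [Cg Cdg]; split => [|i]; first exact: isC1M.
apply: (@isC1_ext _ (fun y => f y * grad g y 0 i + g y * grad f y 0 i)) => //.
  move=> x Ux; rewrite (has_grad_grad (has_gradM (isC1_has_grad Cf Ux) (isC1_has_grad Cg Ux))).
  by rewrite !mxE.
by apply: isC1D => //; exact: isC1M.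
Qed.

Lemma isC2_cst U (a : R) : open U -> isC2 U (fun=> a).
Proof.
move=> oU; split => [|i]; first exact: isC1_cst.
apply: (@isC1_ext U (fun=> 0 : R)) => // [x _|]; last exact: (@isC1_cst U 0).
by rewrite (has_grad_grad (has_grad_cst a x)) mxE.
Qed.

Lemma isC2_coord U i : open U -> isC2 U (fun y => y 0 i).
Proof.
move=> oU; split => [|j]; first exact: isC1_coord.
apply: (@isC1_ext U (fun=> (delta_mx 0 i : E) 0 j)) => // [x _|]; last first.
  exact: (@isC1_cst U ((delta_mx 0 i : E) 0 j)).
by rewrite (has_grad_grad (has_grad_coord i x)).
Qed.

Lemma isC2_sum (I : Type) (r : seq I) U (f : I -> E -> R) : open U ->
  (forall i, isC2 U (f i)) -> isC2 U (fun y => \sum_(i <- r) f i y).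
Proof.
move=> oU Cf; elim: r => [|i r ih].
  rewrite (_ : (fun y => _) = fun=> 0); first exact: (@isC2_cst U 0).
  by apply/funext => y; rewrite big_nil.
rewrite (_ : (fun y => _) = fun y => f i y + \sum_(j <- r) f j y);
  first exact: (isC2D oU (Cf i) ih).
by apply/funext => y; rewrite big_cons.
Qed.

Lemma isC2_comp U f (h dh ddh : R -> R) : open U -> isC2 U f ->
  (forall t : R, is_derive t 1 h (dh t)) -> (forall t : R, is_derive t 1 dh (ddh t)) ->
  continuous ddh -> isC2 U (fun y => h (f y)).
Proof.
move=> oU [Cf Cdf] hP dhP cddh.
have cdh t : {for t, continuous dh}.
  by apply: differentiable_continuous; apply/derivable1_diffP; have [] := dhP t.
split => [|i]; first by apply: (@isC1_comp U f h dh).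
apply: (@isC1_ext _ (fun y => dh (f y) * grad f y 0 i)) => //.
  move=> x Ux; rewrite (has_grad_grad (has_grad_comp (hP (f x)) (isC1_has_grad Cf Ux))).
  by rewrite !mxE.
apply: isC1M => //; apply: (@isC1_comp U f dh ddh) => // x Ux; split => //.
exact: cddh.
Qed.

Lemma isC2_union U V f : isC2 U f -> isC2 V f -> isC2 (U `|` V) f.
Proof.
by move=> [U1 U2] [V1 V2]; split => [|i] x [Ux|Vx]; [exact: U1|exact: V1|exact: U2|exact: V2].
Qed.

Lemma isC2_sub U V f : U `<=` V -> isC2 V f -> isC2 U f.
Proof. by move=> UV [V1 V2]; split => [|i] x /UV; [exact: V1|exact: V2]. Qed.

(** The truncated power is of class C^(k-1): exponent 3 gives the C^2 bumps of [bump_product],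
    exponent 2 the C^1 cutoffs of the estimates. *)
Definition pospow (k : nat) (t : R) : R := Num.max t 0 ^+ k.

Lemma pospow_ge0 k t : 0 <= pospow k t.
Proof. by rewrite exprn_ge0// le_max lexx orbT. Qed.

Lemma is_derive_pospow k (t : R) : is_derive t 1 (pospow k.+2) (k.+2%:R * pospow k.+1 t).
Proof.
have [t0|t0|->] := ltgtP t 0.
- rewrite /pospow (max_idPr (ltW t0)) expr0n/= mulr0.
  apply: (@near_eq_is_derive _ _ _ (cst 0)).
    near=> s; rewrite /pospow /= (max_idPr _) ?expr0n//.
    by near: s; exact: lt_le_nbhsl.
- have -> : pospow k.+1 t = t ^+ k.+1 by rewrite /pospow (max_idPl (ltW t0)).
  apply: (@near_eq_is_derive _ R R (fun s : R => s ^+ k.+2)).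
    near=> s; rewrite /pospow /= (max_idPl _)//.
    by near: s; exact: lt_le_nbhsr.
  apply: DeriveDef; first exact: exprn_derivable.
  by rewrite exp_derive [LHS]mulr1.
- rewrite /pospow maxxx expr0n/= mulr0.
  (* At the kink the difference quotient is at most |h|^(k+1), hence at most |h| once |h| <= 1. *)
  have H : h^-1 *: (pospow k.+2 (h *: 1 + 0) - pospow k.+2 0) @[h --> 0^'] --> (0 : R).
    apply/cvgrPdist_le => e e0; near=> h.
    have h0 : h != 0 by near: h; exact: nbhs_dnbhs_neq.
    have h1 : `|h| <= Num.min e 1.
      near: h; apply: (cvg_within _); apply/nbhs_ballP; exists (Num.min e 1).
        by rewrite /= lt_min e0 ltr01.
      by move=> y; rewrite -ball_normE /= sub0r normrN => /ltW.
    have [he h2] : `|h| <= e /\ `|h| <= 1 by move: h1; rewrite le_min => /andP[].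
    rewrite sub0r normrN /pospow maxxx expr0n/= subr0 addr0 normrZ [h *: 1]mulr1.
    rewrite normfV normrX ler_pdivrMl ?normr_gt0//.
    apply: (@le_trans _ _ (`|h| ^+ k.+2)).
      rewrite lerXn2r// ?nnegrE//; have [h3|h3] := leP h 0; last by [].
      by rewrite normr0.
    rewrite exprS ler_wpM2l// exprS; apply: (le_trans _ he).
    by rewrite ler_piMr// exprn_ile1.
  by apply: DeriveDef; [apply/cvg_ex; exists 0|apply/cvg_lim].
Unshelve. all: by end_near. Qed.

Lemma continuous_pospow k : continuous (pospow k.+1).
Proof.
move=> t.
apply: (@continuous_comp R R R (fun t => Num.max t 0) (fun s => s ^+ k.+1)).
  by apply: (@continuous_max R R id (cst 0)) => //; exact: cst_continuous.
exact: exprn_continuous.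
Qed.

End Regularity.

(** * Defining functions, normals and the second fundamental form *)

Section DefiningFunction.
Context {R : realType} {n : nat}.
Local Notation E := 'rV[R]_n.+1.
Implicit Types (Omega U V : set E) (f g : E -> R) (x y : E).

Lemma frontierP Omega x : open Omega ->
  frontier Omega x <-> closure Omega x /\ ~ Omega x.
Proof. by move=> /interior_id oO; rewrite /frontier oO. Qed.

Lemma local_defining_eq0 Omega x U f y : open Omega ->
  local_defining Omega x U f -> U y -> frontier Omega y -> f y = 0.
Proof.
move=> oO [oU Ux Cf _ fO] Uy /(frontierP _ oO)[cy Oy].
apply/eqP; rewrite eq_le; apply/andP; split.
  by rewrite leNgt; apply/negP => /(fO y Uy).2.
rewrite leNgt; apply/negP => fy.
have cf := isC1_continuous (C2_on_isC2 Cf).1 Uy.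
have [z [Oz [Uz fz]]] : Omega `&` (U `&` [set z | f z < 0]) !=set0.
  apply: cy; apply: filterI; first exact: open_nbhs_nbhs.
  exact: (cvgr_lt _ cf 0 fy).
by have := (fO z Uz).1 Oz; rewrite ltNge (ltW fz).
Qed.

(** Here lies the independence of [inner_normal], defined by a choice, from the defining function:
    both gradients are nonnegative on the directions that enter [Omega], and a half-space determines
    its normal up to a positive factor. *)
Lemma local_defining_parallel Omega x U f V g : open Omega -> frontier Omega x ->
  local_defining Omega x U f -> local_defining Omega x V g ->
  exists2 l, 0 < l & grad g x = l *: grad f x.
Proof.
move=> oO Sx lf lg.
have fx := local_defining_eq0 oO lf (let: And5 _ h _ _ _ := lf in h) Sx.
have gx := local_defining_eq0 oO lg (let: And5 _ h _ _ _ := lg in h) Sx.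
case: lf => oU Ux Cf f0 fO; case: lg => oV Vx Cg g0 gO.
have hf := isC1_has_grad (C2_on_isC2 Cf).1 Ux.
have hg := isC1_has_grad (C2_on_isC2 Cg).1 Vx.
set a := grad f x in hf *; set b := grad g x in hg *.
have aa : 0 < dot a a by rewrite lt0r dotvv_ge0 dotvv_eq0 f0.
(* A ray with <v, grad f> > 0 enters [Omega], where g > 0; if <v, grad g> were negative, g would
   fall below g(x) = 0 along the same ray. *)
have half v : 0 < dot v a -> 0 <= dot v b.
  move=> va; rewrite leNgt; apply/negP => vb.
  have [d d0 dP] := has_grad_pos hf va.
  have [e e0 eP] : exists2 d, 0 < d & forall t : R, 0 < t < d -> g (x + t *: v) < g x.
    have [|d' d'0 d'P] := @has_grad_pos _ _ _ _ _ v (has_gradN hg).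
      by rewrite dotNr oppr_gt0.
    by exists d' => // t /d'P; rewrite ltrN2.
  have [r r0 rP] := line_near v (open_nbhs_nbhs (conj oU Ux)).
  have [s s0 sP] := line_near v (open_nbhs_nbhs (conj oV Vx)).
  pose t := Num.min (Num.min d e) (Num.min r s) / 2.
  have m0 : 0 < Num.min (Num.min d e) (Num.min r s) by rewrite !lt_min d0 e0 r0.
  have t0 : 0 < t by rewrite divr_gt0.
  have : t < Num.min (Num.min d e) (Num.min r s) by rewrite ltr_pdivrMr// mulr_natr mulr2n ltrDl.
  rewrite !lt_min => /andP[/andP[td te] /andP[tr ts]].
  have Ut := rP t; rewrite gtr0_norm// in Ut; have {}Ut := Ut tr.
  have Vt := sP t; rewrite gtr0_norm// in Vt; have {}Vt := Vt ts.
  have := dP t; rewrite t0 td fx => /(_ isT)/(fO _ Ut).2/(gO _ Vt).1.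
  by have := eP t; rewrite t0 te gx => /(_ isT) /ltW; rewrite leNgt => /negP.
have ab : 0 <= dot a b by exact: half.
pose l := dot a b / dot a a; pose w := b - l *: a.
have wa : dot w a = 0.
  by rewrite dotBl dotZl (dotC b) /l divfK ?subrr// gt_eqF.
have w0 : w = 0.
  apply/eqP; rewrite -dotvv_eq0 eq_le dotvv_ge0 andbT.
  apply/ler_addgt0Pr => e e0; rewrite add0r.
  pose s := e / (dot a b + 1).
  have s0 : 0 < s by rewrite divr_gt0// ltr_wpDl.
  (* With w the part of [b] orthogonal to [a], the vector -w + s a is admissible for every s > 0 and
     yields |w|^2 <= s <a, b>; now let s tend to 0. *)
  have := half (- w + s *: a); rewrite dotDl dotNl wa oppr0 add0r dotZl mulr_gt0//.
  move=> /(_ isT); rewrite dotDl dotNl dotZl.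
  have -> : dot w b = dot w w by rewrite {3}/w dotBr dotZr wa mulr0 subr0.
  rewrite addrC subr_ge0 => /le_trans; apply.
  by rewrite /s mulrAC ler_pdivrMr ?ltr_wpDl// ler_wpM2l ?lerDl// ltW.
have bE : b = l *: a by apply/eqP; rewrite -subr_eq0 -/w w0.
have l0 : 0 <= l by rewrite divr_ge0// ltW.
exists l => //; rewrite lt0r l0 andbT; apply/eqP => {}l0.
by have := g0 x Vx; rewrite -/b bE l0 scale0r eqxx.
Qed.

Lemma inner_normalE Omega x U f : open Omega -> frontier Omega x ->
  local_defining Omega x U f ->
  inner_normal Omega x = (enorm (grad f x))^-1 *: grad f x.
Proof.
move=> oO Sx lf; rewrite /inner_normal; set P := [set v | _].
have : P (get P).
  by apply: (@getPex _ P); exists ((enorm (grad f x))^-1 *: grad f x), U, f.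
move=> [V [g [lg ->]]].
have [l l0 ->] := local_defining_parallel oO Sx lf lg.
by rewrite enormZ gtr0_norm// invfM scalerA mulrAC mulVf ?mul1r// gt_eqF.
Qed.

Lemma inner_normal_grad Omega x U f : open Omega -> frontier Omega x ->
  local_defining Omega x U f -> 0 < enorm (grad f x) /\
  grad f x = enorm (grad f x) *: inner_normal Omega x.
Proof.
move=> oO Sx lf; rewrite (inner_normalE oO Sx lf).
have e0 : 0 < enorm (grad f x).
  by case: lf => _ Ux _ f0 _; rewrite enorm_gt0 f0.
by rewrite scalerA divff ?scale1r// gt_eqF.
Qed.

Lemma inner_normal_unit Omega x : bounded_C2_domain Omega -> frontier Omega x ->
  enorm (inner_normal Omega x) = 1.
Proof.
move=> [oO _ _ _ ld] Sx; have [U [f lf]] := ld x Sx.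
rewrite (inner_normalE oO Sx lf) enormZ ger0_norm ?invr_ge0 ?enorm_ge0// mulVf//.
by have [/lt0r_neq0] := inner_normal_grad oO Sx lf.
Qed.

Lemma open_eball U x : open U -> U x -> exists2 r, 0 < r & eball x r `<=` U.
Proof.
move=> oU Ux; have /nbhs_ballP[r /= r0 rU] := open_nbhs_nbhs (conj oU Ux).
exists (r / 2); first by rewrite divr_gt0.
move=> y /= yr; apply: rU; rewrite -ball_normE /= distrC.
apply: le_lt_trans (norm_le_enorm _) _; apply: le_lt_trans yr _.
by rewrite ltr_pdivrMr// mulr_natr mulr2n ltrDl.
Qed.

Definition sqdist x y : R := dot (y - x) (y - x).

Lemma has_grad_sqdist x y : has_grad (sqdist x) y (2 *: (y - x)).
Proof.
have h i : has_grad (fun z : E => z 0 i + - x 0 i) y (delta_mx 0 i + 0).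
  by apply: has_gradD; [exact: has_grad_coord|exact: has_grad_cst].
have := has_grad_sum (index_enum 'I_n.+1) (fun i => has_gradM (h i) (h i)).
rewrite (_ : (fun z => _) = sqdist x); last first.
  by apply/funext => z; apply: eq_bigr => i _; rewrite !mxE.
congr has_grad; apply/rowP => j; rewrite summxE (bigD1 j)//= big1 => [|i ij].
  by rewrite !mxE !eqxx !(addr0, mulr1); ring.
by rewrite !mxE eq_sym (negbTE ij) !(addr0, mulr0).
Qed.

Lemma isC2_sqdist x : isC2 setT (sqdist x).
Proof.
have -> : sqdist x = fun y => \sum_(i < n.+1) (y 0 i + - x 0 i) * (y 0 i + - x 0 i).
  by apply/funext => y; apply: eq_bigr => i _; rewrite !mxE.
have h i : isC2 setT (fun y : E => y 0 i + - x 0 i).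
  by apply: isC2D; [exact: openT|apply: isC2_coord; exact: openT|apply: isC2_cst; exact: openT].
by apply: isC2_sum => [|i]; [exact: openT|apply: isC2M => //; exact: openT].
Qed.

(** The bump is (r^2 - |y - x|^2)^+ cubed, supported in a closed ball inside [U]. Nothing is known
    of [f] off [U], but the product vanishes on the open complement of the ball, so it is C^2
    everywhere. *)
Lemma bump_product U x f : open U -> U x -> isC2 U f -> exists b : E -> R,
  [/\ isC2 setT b, forall y, 0 <= b y, 0 < b x, forall y, ~ U y -> b y = 0 &
      isC2 setT (fun y => b y * f y) /\
      forall y, ~ U y -> has_grad (fun y => b y * f y) y 0].
Proof.
move=> oU Ux Cf; have [r r0 rU] := open_eball oU Ux.
pose b y := pospow 3 (r ^+ 2 + - sqdist x y).
have Cb : isC2 setT b.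
  apply: (@isC2_comp R n setT (fun y => r ^+ 2 + - sqdist x y) (pospow 3)
    (fun t => 3 * pospow 2 t) (fun t => 3 * (2 * pospow 1 t))).
  - exact: openT.
  - apply: isC2D; [exact: openT|apply: isC2_cst; exact: openT|].
    rewrite (_ : (fun y => _) = fun y => -1 * sqdist x y).
      apply: isC2M; [exact: openT|apply: isC2_cst; exact: openT|exact: isC2_sqdist].
    by apply/funext => y; rewrite mulN1r.
  - by move=> t; exact: is_derive_pospow.
  - move=> t; exact: (@is_deriveZ R R R (pospow 2) 3 t 1 _ (is_derive_pospow 0 t)).
  - move=> t; apply: (@continuousM R R (cst 3) (fun t => 2 * pospow 1 t) t);
    first exact: cst_continuous.
    apply: (@continuousM R R (cst 2) (pospow 1) t); first exact: cst_continuous.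
    exact: continuous_pospow.
have b0 y : ~ eball x r y -> b y = 0.
  rewrite /eball /= => /negP; rewrite -ltNge => ry.
  rewrite /b /pospow (max_idPr _) ?expr0n// subr_le0 /sqdist -enorm_sqr.
  by rewrite ler_pXn2r ?nnegrE ?enorm_ge0 ?(ltW r0)// ltW.
have bU y : ~ U y -> b y = 0 by move=> Uy; apply: b0 => /rU.
have oB : open (~` eball x r) by apply: closed_openC; exact: eball_closed.
have UB : U `|` ~` eball x r = setT.
  apply/seteqP; split => // y _; have [yr|yr] := pselect (eball x r y); last by right.
  by left; exact: rU.
exists b; split.
- exact: Cb.
- by move=> y; exact: pospow_ge0.
- by rewrite /b /sqdist subrr dot0l subr0 /pospow exprn_gt0// lt_max exprn_gt0.
- exact: bU.
- split.
    rewrite -UB; apply: isC2_union.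
      exact: (isC2M oU (isC2_sub (@subsetT _ U) Cb) Cf).
    apply: (@isC2_ext R n _ (fun=> 0) _ oB) => [y By|]; last exact: (isC2_cst 0 oB).
    by rewrite b0// mul0r.
  move=> y Uy; apply: has_grad_near (has_grad_cst 0 y).
  apply: (open_near oB) => [/rU//|z Bz].
  by rewrite b0// mul0r.
Qed.

(** The non-strict version is stable under sums; strictness is tracked pointwise by [defining_at]
    and survives in a sum as soon as one summand has it. *)
Definition semi_defining Omega g :=
  [/\ isC2 setT g, forall y, Omega y -> 0 <= g y, forall y, frontier Omega y -> g y = 0
    & forall y, frontier Omega y -> exists2 c, 0 <= c & grad g y = c *: inner_normal Omega y].

Definition defining_at Omega g y :=
  (Omega y -> 0 < g y) /\
  (frontier Omega y -> exists2 c, 0 < c & grad g y = c *: inner_normal Omega y).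

Lemma exists_semi_defining Omega x : bounded_C2_domain Omega -> closure Omega x ->
  exists g U, [/\ semi_defining Omega g, open U, U x & forall y, U y -> defining_at Omega g y].
Proof.
move=> [oO _ _ _ ld] cx.
have [U [f [oU Ux Cf [fO fS]]]] : exists U f, [/\ open U, U x, isC2 U f &
    (forall y, U y -> Omega y -> 0 < f y) /\
    forall y, U y -> frontier Omega y ->
      f y = 0 /\ exists2 c, 0 < c & grad f y = c *: inner_normal Omega y].
  have [Ox|Ox] := pselect (Omega x).
    exists Omega, (fun=> 1); split => //; first exact: isC2_cst.
    split=> [y _ _|y Oy]; first exact: ltr01.
    by move=> /(frontierP _ oO)[].
  have Sx : frontier Omega x by apply/frontierP.
  have [U [f lf]] := ld x Sx; exists U, f.
  have [oU Ux Cf f0 fO] := lf; split => //; first exact: C2_on_isC2.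
  split=> y Uy; first by move/(fO y Uy).1.
  move=> Sy; split; first exact: local_defining_eq0 lf Uy Sy.
  have lfy : local_defining Omega y U f by [].
  by have [? ?] := inner_normal_grad oO Sy lfy; exists (enorm (grad f y)).
have [b [Cb b0 bx bU [Cbf bfU]]] := bump_product oU Ux Cf.
have cb : continuous b by move=> y; exact: (isC1_continuous Cb.1).
exists (fun y => b y * f y), [set y | 0 < b y].
have gradS y : U y -> frontier Omega y -> exists2 c, 0 < c &
    grad (fun y => b y * f y) y = b y * c *: inner_normal Omega y.
  move=> Uy Sy; have [fy [c c0 cE]] := fS y Uy Sy; exists c => //.
  have := has_gradM (isC1_has_grad Cb.1 (I : setT y)) (isC1_has_grad Cf.1 Uy).
  by move=> /has_grad_grad ->; rewrite fy scale0r addr0 cE scalerA.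
have bpos y : 0 < b y -> U y.
  by move=> by0; apply: contrapT => /bU by1; rewrite by1 ltxx in by0.
split => //.
- split => // y.
  + move=> Oy; have [Uy|/bU ->] := pselect (U y); last by rewrite mul0r.
    by rewrite mulr_ge0// ltW// fO.
  + move=> Sy; have [Uy|/bU ->] := pselect (U y); last by rewrite mul0r.
    by rewrite (fS y Uy Sy).1 mulr0.
  + move=> Sy; have [Uy|Uy] := pselect (U y).
      by have [c c0 ->] := gradS y Uy Sy; exists (b y * c) => //; rewrite mulr_ge0// ltW.
    by exists 0 => //; rewrite scale0r (has_grad_grad (bfU y Uy)).
- rewrite (_ : [set y | 0 < b y] = b @^-1` [set t | 0 < t])//.
  by apply: open_comp => [y _|]; [exact: cb|exact: open_gt].
- move=> y /= by0; have Uy := bpos y by0; split.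
    by move=> Oy; rewrite mulr_gt0// fO.
  by move=> Sy; have [c c0 ->] := gradS y Uy Sy; exists (b y * c) => //; rewrite mulr_gt0.
Qed.

Lemma closure_bounded_compact Omega : bounded_set Omega -> compact (closure Omega).
Proof.
move=> bO; apply: bounded_closed_compact; last exact: closed_closure.
have [M M0 OM] : exists2 M, 0 < M & Omega `<=` [set x | `|x| <= M].
  have [M M0 MP] := ex_strict_bound_gt0 bO; exists M => // x Ox.
  by apply: ltW; exact: MP.
have cM : closed [set x : E | `|x| <= M].
  rewrite (_ : [set x : E | _] = (fun x : E => `|x|) @^-1` [set t | t <= M])//.
  by apply: closed_comp => // x _; exact: norm_continuous.
exists M; split; first exact: num_real.
move=> y My x cx; apply: le_trans (ltW My).
exact: (cM x (closureS OM cx)).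
Qed.

(** A finite sum of localized defining functions works without normalization: values in [Omega] are
    nonnegative and gradients on the frontier are nonnegative multiples of one vector, so nothing
    can cancel. *)
Lemma exists_defining Omega : bounded_C2_domain Omega -> exists g,
  [/\ isC2 setT g, forall y, Omega y -> 0 < g y, forall y, frontier Omega y -> g y = 0
    & forall y, frontier Omega y -> exists2 c, 0 < c & grad g y = c *: inner_normal Omega y].
Proof.
move=> dO; have [oO _ _ bO _] := dO.
have cK := closure_bounded_compact bO.
have /choice[G GP] : forall x, exists gU : (E -> R) * set E,
    [/\ semi_defining Omega gU.1, open gU.2, closure Omega x -> gU.2 x
      & forall y, gU.2 y -> defining_at Omega gU.1 y].
  move=> x; have [cx|cx] := pselect (closure Omega x).
    by have [g [U [? ? ? ?]]] := exists_semi_defining dO cx; exists (g, U).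
  exists (fun=> 0, set0); split; [|exact: open0|by move=> /cx|by []].
  split => // [|y _]; first by apply: isC2_cst; exact: openT.
  by exists 0 => //; rewrite scale0r (has_grad_grad (has_grad_cst 0 y)).
move: cK; rewrite compact_cover => /(_ E (closure Omega) (fun x => (G x).2)).
case=> [x _|x cx|D DK cov]; first by have [] := GP x.
  by exists x => //; have [_ _ + _] := GP x; exact.
pose s : seq E := finmap.enum_fset D.
pose g y := \sum_(x <- s) (G x).1 y.
have Cg : isC2 setT g by apply: isC2_sum => [|x]; [exact: openT|have [[]] := GP x].
have gradgE y : grad g y = \sum_(x <- s) grad (G x).1 y.
  apply/has_grad_grad/has_grad_sum => x; apply: (@isC1_has_grad _ _ setT) => //.
  by have [[[]]] := GP x.
have covD y : closure Omega y -> exists2 x, x \in s & defining_at Omega (G x).1 y.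
  by move=> /cov[x /= xD Gxy]; exists x => //; have [_ _ _] := GP x; exact.
exists g; split => //.
- move=> y Oy; have [x xD [/(_ Oy) Gx _]] := covD y (subset_closure Oy).
  rewrite /g (big_rem x)//= ltr_pwDl// sumr_ge0// => z _.
  by have [[_ + _ _] _ _ _] := GP z; exact.
- move=> y Sy; rewrite /g big1// => x _.
  by have [[_ _ + _] _ _ _] := GP x; exact.
- move=> y Sy; rewrite gradgE.
  have /choice[c cP] : forall x, exists c, 0 <= c /\ grad (G x).1 y = c *: inner_normal Omega y.
    by move=> x; have [[_ _ _ /(_ y Sy)[c c0 cE]] _ _ _] := GP x; exists c.
  have Ky : closure Omega y by case: Sy.
  have [x xD [_ /(_ Sy)[d d0 dE]]] := covD y Ky.
  exists (d + \sum_(z <- rem x s) c z).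
    by rewrite ltr_pwDl// sumr_ge0// => z _; have [] := cP z.
  rewrite (big_rem x)//= dE scalerDl scaler_suml; congr (_ + _).
  by apply: eq_bigr => z _; have [] := cP z.
Qed.

End DefiningFunction.

Section VectorFields.
Context {R : realType} {n : nat}.
Local Notation E := 'rV[R]_n.+1.
Local Notation M := 'M[R]_n.+1.
Implicit Types (N : E -> E) (x y u v : E).

Definition jac N x : M := \matrix_(i, j) grad (fun y => N y 0 j) x 0 i.

Lemma differentiable_row N x : (forall j, differentiable (fun y => N y 0 j) x) ->
  differentiable N x.
Proof.
move=> dN; rewrite (_ : N = \sum_(j < n.+1) (fun y => N y 0 j *: delta_mx 0 j)).
  by apply: differentiable_sum => j; exact: differentiableZl.
by apply/funext => y; rewrite fct_sumE -row_sum_delta.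
Qed.

Lemma differentiable_row_coord N x j : differentiable N x ->
  differentiable (fun y => N y 0 j) x.
Proof.
move=> dN; apply: (@differentiable_comp _ _ _ _ N (fun v : E => v 0 j)) => //.
exact: differentiable_coord.
Qed.

Lemma derive_row N x u : differentiable N x -> 'D_u N x = u *m jac N x.
Proof.
move=> dN; rewrite derive_mx; last exact: diff_derivable.
apply/matrixP => i j; rewrite !mxE ord1.
rewrite (has_grad_derive _ (differentiable_has_grad (differentiable_row_coord j dN))).
by apply: eq_bigr => k _; rewrite !mxE.
Qed.

End VectorFields.

(** * Derivatives along the frontier *)

Section TangentDerivative.
Context {R : realType} {n : nat}.
Local Notation E := 'rV[R]_n.+1.
Local Notation M := 'M[R]_n.+1.
Implicit Types (Omega U : set E) (f F : E -> R) (x y u v : E).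

(** From a zero of [F], arbitrarily short steps along [grad F] reach {F > 0}, that is [Omega]. *)
Lemma level_frontier Omega x U F y : open Omega -> local_defining Omega x U F ->
  U y -> F y = 0 -> frontier Omega y.
Proof.
move=> oO [oU Ux CF F0 FO] Uy Fy; apply/(frontierP _ oO); split; last first.
  by move/(FO y Uy).1; rewrite Fy ltxx.
move=> B By.
have gy : 0 < dot (grad F y) (grad F y) by rewrite lt0r dotvv_ge0 dotvv_eq0 F0.
have [d d0 dP] := has_grad_pos (isC1_has_grad (C2_on_isC2 CF).1 Uy) gy.
have [r r0 rP] := line_near (grad F y) (filterI By (open_nbhs_nbhs (conj oU Uy))).
pose t := Num.min d r / 2.
have m0 : 0 < Num.min d r by rewrite lt_min d0.
have t0 : 0 < t by rewrite divr_gt0.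
have : t < Num.min d r by rewrite ltr_pdivrMr// mulr_natr mulr2n ltrDl.
rewrite lt_min => /andP[td tr].
have [Bt Ut] : (B `&` U) (y + t *: grad F y) by apply: rP; rewrite gtr0_norm.
exists (y + t *: grad F y); split => //; apply/(FO _ Ut).
by rewrite -Fy; apply: dP; rewrite t0.
Qed.

(* By the intermediate value theorem applied to s |-> F (x + t u + s grad F x),
   the level set {F = 0} contains points x + t u + o(t) for every tangent u. *)
Lemma tangent_point Omega x U F u (e : R) : open Omega -> frontier Omega x ->
  local_defining Omega x U F -> dot u (grad F x) = 0 -> 0 < e ->
  exists2 d, 0 < d & forall t : R, 0 < t < d -> exists2 s : R, `|s| <= e * t &
    frontier Omega (x + t *: u + s *: grad F x).
Proof.
move=> oO Sx lF uF e0; have [oU Ux CF F0 FO] := lF.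
have CF1 := (C2_on_isC2 CF).1.
have Fx := local_defining_eq0 oO lF Ux Sx.
set a := grad F x in uF *.
have aa : 0 < dot a a by rewrite lt0r dotvv_ge0 dotvv_eq0 F0.
have pos (v : E) : 0 < dot v a -> exists2 d, 0 < d & forall t : R, 0 < t < d ->
  0 < F (x + t *: v).
  by move=> /(has_grad_pos (isC1_has_grad CF1 Ux)) [d d0]; rewrite Fx; exists d.
have neg (v : E) : dot v a < 0 -> exists2 d, 0 < d & forall t : R, 0 < t < d ->
  F (x + t *: v) < 0.
  rewrite -oppr_gt0 -dotNr => /(has_grad_pos (has_gradN (isC1_has_grad CF1 Ux))) [d d0].
  by rewrite Fx => dP; exists d => // t /dP; rewrite ltrN2.
have [d1 d10 d1P] : exists2 d, 0 < d & forall t : R, 0 < t < d -> 0 < F (x + t *: (u + e *: a)).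
  by apply: pos; rewrite dotDl uF add0r dotZl mulr_gt0.
have [d2 d20 d2P] : exists2 d, 0 < d & forall t : R, 0 < t < d -> F (x + t *: (u - e *: a)) < 0.
  by apply: neg; rewrite dotBl uF sub0r dotZl oppr_lt0 mulr_gt0.
have [r r0 rU] := open_eball oU Ux.
pose c := enorm u + e * enorm a + 1.
have c0 : 0 < c by rewrite ltr_wpDl// addr_ge0 ?mulr_ge0 ?enorm_ge0// ltW.
exists (Num.min (Num.min d1 d2) (r / c)).
  by rewrite !lt_min d10 d20 divr_gt0.
move=> t /andP[t0]; rewrite !lt_min => /andP[/andP[td1 td2] tr].
have et0 : 0 < e * t by rewrite mulr_gt0.
have inU (s : R) : `|s| <= e * t -> U (x + t *: u + s *: a).
  move=> st; apply: rU; rewrite /eball /= addrC !addrA addNr add0r.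
  apply: le_trans (enormD _ _) _; rewrite !enormZ (gtr0_norm t0).
  apply: (@le_trans _ _ (t * c)); last by rewrite -ler_pdivlMr// ltW.
  rewrite /c !mulrDr mulr1 -[leLHS]addr0 !lerD// ?(ltW t0)//.
  by rewrite mulrA (mulrC t) ler_wpM2r// enorm_ge0.
pose h (s : R) := F (x + t *: u + s *: a).
have [s ins hs] : exists2 s, s \in `[- (e * t), e * t] & h s = 0.
  apply: IVT.
  - by rewrite ge0_cp// ltW.
  - apply: continuous_in_subspaceT => s; rewrite inE /= in_itv/= -ler_norml => st.
    apply: (@continuous_comp R E R (fun s => x + t *: u + s *: a) F).
      apply: (@continuousD R E R (cst (x + t *: u)) (fun s => s *: a)).
        exact: cst_continuous.
      exact: scalel_continuous.
    exact: isC1_continuous CF1 (inU s st).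
  - have h1 : h (- (e * t)) <= 0.
      have := d2P t; rewrite t0 td2 => /(_ isT) /ltW; rewrite /h scalerBr addrA scalerA.
      by rewrite scaleNr (mulrC e).
    have h2 : 0 <= h (e * t).
      have := d1P t; rewrite t0 td1 => /(_ isT) /ltW; rewrite /h scalerDr addrA scalerA.
      by rewrite (mulrC e).
    by rewrite ge_min h1/= le_max h2 orbT.
exists s; first by move: ins; rewrite in_itv/= ler_norml.
apply: (level_frontier oO lF _ hs); apply: inU.
by move: ins; rewrite in_itv/= ler_norml.
Qed.

(** By [tangent_point] the frontier contains x + t u + s a with |s| <= e t. Since [f] vanishes
    there, the first-order expansion gives t |<u, c>| <= e t (|<a, c>| + |u| + |a|). *)
Lemma tangent_derivative Omega x f c u : bounded_C2_domain Omega -> frontier Omega x ->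
  has_grad f x c -> (\forall y \near x, frontier Omega y -> f y = 0) ->
  tangent Omega x u -> dot u c = 0.
Proof.
move=> [oO _ _ _ ld] Sx fc f0 tu; have [U [F lF]] := ld x Sx.
have [_ FN] := inner_normal_grad oO Sx lF.
have uF : dot u (grad F x) = 0 by rewrite FN dotZr tu mulr0.
set a := grad F x in FN uF.
have fx : f x = 0 by exact: (nbhs_singleton f0).
apply/eqP; rewrite -normr_le0; apply/ler_addgt0Pr => e' e'0; rewrite add0r.
pose C := `|dot a c| + `|u| + `|a| + 1.
have C0 : 0 < C by rewrite ltr_wpDl// !addr_ge0.
(* The cap 1 makes |s| <= t, so that the increment is at most t (|u| + |a|); the quotient makes the
   final error e C at most [e']. *)
pose e := Num.min 1 (e' / C).
have e0 : 0 < e by rewrite lt_min ltr01 divr_gt0.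
have e1 : e <= 1 by rewrite ge_min lexx.
have [d d0 dP] := tangent_point oO Sx lF uF e0.
have [r /= r0 rP] := (nbhs_ballP _ _).1 (filterI f0 ((has_gradP _ _ _).1 fc e e0)).
have D0 : 0 < `|u| + `|a| + 1 by rewrite ltr_wpDl// addr_ge0.
have [t t0 [td tr]] : exists2 t, 0 < t & t < d /\ t < r / (`|u| + `|a| + 1).
  have m0 : 0 < Num.min d (r / (`|u| + `|a| + 1)) by rewrite lt_min d0 divr_gt0.
  exists (Num.min d (r / (`|u| + `|a| + 1)) / 2); first by rewrite divr_gt0.
  by apply/andP; rewrite -lt_min ltr_pdivrMr// mulr_natr mulr2n ltrDl.
have [|s st Ss] := dP t.
  by rewrite t0.
pose y := x + t *: u + s *: a.
have yx : y - x = t *: u + s *: a by rewrite /y addrC !addrA addNr add0r.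
have nyx : `|y - x| <= t * (`|u| + `|a|).
  rewrite yx (le_trans (ler_normD _ _))// !normrZ (gtr0_norm t0) mulrDr lerD//.
  by rewrite ler_wpM2r// (le_trans st)// ler_piMl// ltW.
have [|fy0 fyx] := rP y.
  rewrite -ball_normE /= distrC; apply: le_lt_trans nyx _.
  apply: (@lt_trans _ _ (t * (`|u| + `|a| + 1))).
    by rewrite ltr_pM2l// ltrDl.
  by rewrite -ltr_pdivlMr.
move: fyx; rewrite (fy0 Ss) fx subrr sub0r normrN yx dotDl !dotZl => h.
have h2 : t * `|dot u c| <= t * (e * C).
  have : `|t * dot u c| <= `|s * dot a c| + e * (t * (`|u| + `|a|)).
    rewrite -[t * dot u c](addrK (s * dot a c)) (le_trans (ler_normB _ _))// addrC lerD2l.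
    by apply: le_trans h _; rewrite -yx ler_wpM2l// ltW.
  rewrite !normrM (gtr0_norm t0) => /le_trans; apply.
  rewrite (mulrCA e).
  apply: (@le_trans _ _ (e * t * `|dot a c| + t * (e * (`|u| + `|a|)))).
    by rewrite lerD2r ler_wpM2r.
  rewrite (mulrC e t) -mulrA -mulrDr -mulrDr ler_wpM2l ?(ltW t0)// ler_wpM2l ?(ltW e0)//.
  by rewrite /C addrA lerDl.
move: h2; rewrite ler_pM2l// => /le_trans; apply.
by rewrite -ler_pdivlMr// ge_min lexx orbT.
Qed.

End TangentDerivative.

(** * The normal field and the second fundamental form *)

Section NormalField.
Context {R : realType} {n : nat}.
Local Notation E := 'rV[R]_n.+1.
Local Notation M := 'M[R]_n.+1.
Implicit Types (Omega W : set E) (g : E -> R) (N : E -> E).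

Definition isC1_field W N := forall j, isC1 W (fun y => N y 0 j).

Lemma isC1_field_jac W N x i : isC1_field W N -> W x -> forall j,
  {for x, continuous (fun y => jac N y i j)}.
Proof.
move=> CN Wx j; rewrite (_ : (fun y => _) = fun y => grad (fun z => N z 0 j) y 0 i).
  by have [_] := CN j x Wx; exact.
by apply/funext => y; rewrite mxE.
Qed.

Lemma continuous_inv_sqrt (t : R) : 0 < t -> {for t, continuous (fun s : R => (Num.sqrt s)^-1)}.
Proof.
move=> t0; apply: cvgV; first by rewrite gt_eqF// sqrtr_gt0.
exact: sqrt_continuous.
Qed.

Lemma is_derive_inv_sqrt (t : R) : 0 < t ->
  is_derive t 1 (fun s : R => (Num.sqrt s)^-1) (- (Num.sqrt t)^-1 ^+ 2 * (2^-1 * (Num.sqrt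
    t)^-1)).
Proof.
move=> t0; have s0 : Num.sqrt t != 0 by rewrite gt_eqF// sqrtr_gt0.
have := is_deriveV s0 (is_derive1_sqrt t0).
by rewrite exprVn -invfM.
Qed.

(** N = grad g / sqrt(|grad g|^2 + g). The summand g keeps the root positive inside [Omega], where
    [grad g] may vanish, and disappears on the frontier, where N is therefore the unit normal. It
    also gives |N| <= 1 on the closure. *)
Lemma exists_normal_field Omega : bounded_C2_domain Omega ->
  exists (g : E -> R) (N : E -> E) (W : set E),
  [/\ isC2 setT g, forall x, Omega x -> 0 < g x & forall x, frontier Omega x -> g x = 0] /\
  [/\ open W, closure Omega `<=` W, isC1_field W N,
      forall x, closure Omega x -> enorm (N x) <= 1 &
      (forall x, frontier Omega x -> N x = inner_normal Omega x) /\
      forall x, W x -> exists2 k, 0 < k & N x = k *: grad g x].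
Proof.
move=> dO; have [oO _ _ bO _] := dO.
have [g [Cg gO gS gradS]] := exists_defining dO.
pose q x := dot (grad g x) (grad g x) + g x.
have Cq : isC1 setT q.
  apply: isC1D; [exact: openT| |exact: Cg.1].
  apply: isC1_sum => [|i]; first exact: openT.
  by apply: isC1M; [exact: openT|exact: Cg.2|exact: Cg.2].
pose W := [set x | 0 < q x].
have oW : open W.
  rewrite (_ : W = q @^-1` [set t | 0 < t])//.
  by apply: open_comp => [y _|]; [exact: (isC1_continuous Cq)|exact: open_gt].
have q_ge x : closure Omega x -> dot (grad g x) (grad g x) <= q x.
  move=> cx; rewrite lerDl; have [/gO/ltW//|Ox] := pselect (Omega x).
  by rewrite gS//; apply/frontierP.
have OW : closure Omega `<=` W.
  move=> x cx; have [Ox|Ox] := pselect (Omega x).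
    by rewrite /W /= ltr_wpDl ?dotvv_ge0 ?gO.
  have Sx : frontier Omega x by apply/frontierP.
  apply: lt_le_trans (q_ge x cx); have [c c0 ->] := gradS x Sx.
  by rewrite -enorm_sqr enormZ inner_normal_unit// mulr1 exprn_gt0 ?normr_gt0 ?gt_eqF.
pose k x := (Num.sqrt (q x))^-1.
have k0 x : W x -> 0 < k x by move=> Wx; rewrite invr_gt0 sqrtr_gt0.
have Ck : isC1 W k.
  apply: (@isC1_comp R n W q (fun s => (Num.sqrt s)^-1)
    (fun s => - (Num.sqrt s)^-1 ^+ 2 * (2^-1 * (Num.sqrt s)^-1)) oW).
    by move=> x _; exact: Cq.
  move=> x Wx; split; first exact: is_derive_inv_sqrt.
  have ci := continuous_inv_sqrt Wx.
  apply: (@continuousM R R (fun s => - (Num.sqrt s)^-1 ^+ 2) (fun s => 2^-1 * (Num.sqrt s)^-1)).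
    apply: (@continuousN R R R (fun s => (Num.sqrt s)^-1 ^+ 2)).
    exact: (@continuousM R R (fun s => (Num.sqrt s)^-1) (fun s => (Num.sqrt s)^-1)).
  by apply: (@continuousM R R (cst 2^-1) (fun s => (Num.sqrt s)^-1)) => //; exact: cst_continuous.
exists g, (fun x => k x *: grad g x), W; split; first by [].
split => //.
- move=> j; apply: (@isC1_ext R n W (fun y => k y * grad g y 0 j)) => //.
    by move=> y _; rewrite [RHS]mxE.
  by apply: isC1M => // y _; exact: Cg.2.
- move=> x cx; rewrite enormZ gtr0_norm ?k0//; last exact: OW.
  rewrite mulrC ler_pdivrMr ?sqrtr_gt0 ?mul1r; last exact: OW.
  by rewrite ler_wsqrtr// q_ge.
- split=> [x Sx|x Wx]; last by exists (k x) => //; exact: k0.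
  have [c c0 cE] := gradS x Sx.
  have qx : q x = c ^+ 2.
    by rewrite /q gS// addr0 cE -enorm_sqr enormZ inner_normal_unit// mulr1 gtr0_norm.
  by rewrite /k qx sqrtr_sqr gtr0_norm// cE scalerA mulVf ?scale1r// gt_eqF.
Qed.

(** [second_ff] chooses some extension of the normal. Two extensions differ by a field vanishing on
    the frontier near x, and [tangent_derivative] kills its derivative along tangent vectors. *)
Lemma second_ffE Omega N x u v : bounded_C2_domain Omega -> frontier Omega x ->
  differentiable N x -> (forall y, frontier Omega y -> N y = inner_normal Omega y) ->
  tangent Omega x u -> second_ff Omega x u v = - dot ('D_u N x) v.
Proof.
move=> dO Sx dN NS tu; rewrite /second_ff; set P := [set r | _].
have : P (get P).
  apply: (@getPex _ P); exists (- dot ('D_u N x) v); exists N; split => //.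
  by apply: (@open_near R n setT) => [|//|y _]; [exact: openT|exact: NS].
move=> [N' [dN' N'S ->]]; congr (- dot _ v).
rewrite !derive_row//; apply/rowP => j.
pose f y := N' y 0 j - N y 0 j.
have fc : has_grad f x (grad (fun y => N' y 0 j) x - grad (fun y => N y 0 j) x).
  apply: has_gradD; last apply: has_gradN.
    exact/differentiable_has_grad/differentiable_row_coord.
  exact/differentiable_has_grad/differentiable_row_coord.
have := tangent_derivative dO Sx fc.
have near0 : \forall y \near x, frontier Omega y -> f y = 0.
  by apply: filterS N'S => y N'y Sy; rewrite /f N'y// NS// subrr.
move=> /(_ u near0 tu); rewrite dotBr => /eqP; rewrite subr_eq0 => /eqP duE.
by rewrite !mxE; move: duE; rewrite /dot => duE; under eq_bigr do rewrite mxE;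
  under [RHS]eq_bigr do rewrite mxE.
Qed.

Lemma second_ff_norm_bound Omega N W : bounded_C2_domain Omega ->
  open W -> closure Omega `<=` W -> isC1_field W N ->
  (forall y, frontier Omega y -> N y = inner_normal Omega y) ->
  forall x u, frontier Omega x -> tangent Omega x u ->
  `|dot (u *m jac N x) u| <= second_ff_norm Omega * dot u u.
Proof.
move=> dO oW OW CN NS x u Sx tu; have [oO _ _ bO _] := dO.
have cK := closure_bounded_compact bO.
have SK y : frontier Omega y -> closure Omega y by case.
have dN y : frontier Omega y -> differentiable N y.
  move=> Sy; apply: differentiable_row => j.
  by have [] := CN j y (OW _ (SK _ Sy)).
have ffE y a b : frontier Omega y -> tangent Omega y a ->
    second_ff Omega y a b = - dot (a *m jac N y) b.
  by move=> Sy ta; rewrite (@second_ffE Omega N)// ?derive_row//; exact: dN.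
have bnd i j : exists2 B, 0 < B & forall y, closure Omega y -> `|jac N y i j| <= B.
  apply: (@within_bounded R _ (closure Omega) (fun y => jac N y i j)) => //.
  apply: continuous_in_subspaceT => y; rewrite inE => /OW Wy.
  exact: isC1_field_jac CN Wy j.
have /choice[B BP] : forall ij : 'I_n.+1 * 'I_n.+1, exists B, 0 < B /\ forall y,
  closure Omega y -> `|jac N y ij.1 ij.2| <= B.
  by move=> [i j]; have [B] := bnd i j; exists B.
(* Needed before [sup] can be used: the supremum of an unbounded set would be the default 0. The
   bound comes from the continuity of [jac N] on the compact closure. *)
have ubB : has_ubound [set r | exists x u v,
    [/\ frontier Omega x, tangent Omega x u /\ enorm u = 1,
        tangent Omega x v /\ enorm v = 1 & r = `|second_ff Omega x u v|]].
  exists (\sum_j \sum_i B (i, j)) => _ [y [a [b [Sy [ta a1] [tb b1] ->]]]].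
  rewrite ffE// normrN (le_trans (dot_le_enorm _ _))// b1 mulr1.
  apply: le_trans (enorm_le_sum _) _; apply: ler_sum => j _.
  rewrite mxE (le_trans (ler_norm_sum _ _ _))//; apply: ler_sum => i _.
  rewrite normrM; have := (BP (i, j)).2 y (SK _ Sy) => /= h.
  apply: le_trans h; rewrite ler_piMl//; apply: le_trans (coord_le_enorm _ _) _.
  by rewrite a1.
have [->|u0] := eqVneq u 0; first by rewrite mul0mx !dot0l normr0 mulr0.
have eu : 0 < enorm u by rewrite enorm_gt0.
pose w := (enorm u)^-1 *: u.
have uw : u = enorm u *: w by rewrite /w scalerA divff ?scale1r// gt_eqF.
have w1 : enorm w = 1 by rewrite enormZ gtr0_norm ?invr_gt0// mulVf// gt_eqF.
have tw : tangent Omega x w by rewrite /tangent /= /w dotZl tu mulr0.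
rewrite -enorm_sqr {1 2}uw -scalemxAl dotZl dotZr mulrA -expr2 normrM.
rewrite (ger0_norm (sqr_ge0 _)) mulrC ler_wpM2r ?sqr_ge0//.
apply: (ub_le_sup ubB); exists x, w, w; split => //.
by rewrite ffE// normrN.
Qed.

(* tr (P J) = sum_i (e_i P) J (e_i P)^T for an orthogonal projection P, and the
   vectors e_i P are tangent as soon as P annihilates the normal. *)
Lemma trace_second_ff_bound Omega N W P x : bounded_C2_domain Omega ->
  open W -> closure Omega `<=` W -> isC1_field W N ->
  (forall y, frontier Omega y -> N y = inner_normal Omega y) ->
  frontier Omega x -> P^T = P -> P *m P = P -> inner_normal Omega x *m P = 0 ->
  `|\tr (P *m jac N x)| <= n.+1%:R * second_ff_norm Omega.
Proof.
move=> dO oW OW CN NS Sx PT PP nP.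
pose u (i : 'I_n.+1) : E := row i P.
have tu i : tangent Omega x (u i).
  by rewrite /tangent /= /u rowE dot_mulmx PT nP dot0r.
have uu i : dot (u i) (u i) = P i i.
  by rewrite {1}/u rowE dot_mulmx PT /u -row_mul PP dot_delta mxE.
have P1 i : 0 <= P i i <= 1.
  rewrite -{1}uu dotvv_ge0/=.
  have h : P i i ^+ 2 <= P i i.
    rewrite -{2}uu /dot (bigD1 i)//= !mxE -expr2 lerDl.
    by apply: sumr_ge0 => j _; exact: sqr_ge0.
  rewrite leNgt; apply/negP => h1; move: h; apply/negP; rewrite -ltNge.
  by rewrite expr2 ltr_pMr// (lt_trans _ h1).
(* Either the supremum is over a nonempty bounded set of absolute values, or it is the default 0. *)
have II0 : 0 <= second_ff_norm Omega.
  rewrite /second_ff_norm; set A := [set r | _].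
  have [sA|/sup_out ->//] := pselect (has_sup A).
  have [[r rA] _] := sA; apply: le_trans (sup_upper_bound sA rA).
  by case: rA => [y [a [b [_ _ _ ->]]]].
have -> : \tr (P *m jac N x) = \sum_i dot (u i *m jac N x) (u i).
  rewrite -{1}PP -mulmxA mxtrace_mulC /mxtrace; apply: eq_bigr => i _.
  rewrite /u -!row_mul /dot mxE; apply: eq_bigr => j _; rewrite !mxE.
  by congr (_ * _); rewrite -{1}PT mxE.
apply: le_trans (ler_norm_sum _ _ _) _.
apply: (@le_trans _ _ (\sum_(i < n.+1) second_ff_norm Omega)).
  apply: ler_sum => i _; apply: le_trans (second_ff_norm_bound dO oW OW CN NS Sx (tu i)) _.
  by rewrite uu ler_piMr//; have /andP[] := P1 i.
by rewrite sumr_const card_ord mulr_natl.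
Qed.

End NormalField.

Lemma within_comp (T U V : topologicalType) (h : T -> U) (f : U -> V) (A : set T) (B : set U) :
  continuous h -> (forall x, A x -> B (h x)) -> {within B, continuous f} ->
  {within A, continuous (f \o h)}.
Proof.
move=> ch AB /continuousP cf; apply/continuousP => O oO.
have /open_subspaceP[W oW WB] := cf O oO; apply/open_subspaceP.
exists (h @^-1` W).
  by apply: open_comp => // x _; exact: ch.
apply/seteqP; split => x [/= H Ax]; split => //.
  have : (W `&` B) (h x) by split => //; exact: AB.
  by rewrite WB => -[].
have : ((f @^-1` O) `&` B) (h x) by split => //; exact: AB.
by rewrite -WB => -[].
Qed.

(** * Fields of class C^1 up to the boundary *)

Section UpToBoundary.
Context {R : realType} {n : nat}.
Local Notation E := 'rV[R]_n.+1.
Local Notation M := 'M[R]_n.+1.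
Variable Omega : set E.
Hypothesis oO : open Omega.
Local Notation K := (closure Omega).
Local Notation cK f := {within K, continuous (f : E -> R)}.
Implicit Types (f g : E -> R) (c d : E -> E).

Lemma cK_continuous f : (forall x, K x -> {for x, continuous f}) -> cK f.
Proof. by move=> cf; apply: continuous_in_subspaceT => x; rewrite inE; exact: cf. Qed.

Lemma cK_comp f (h : R -> R) : cK f -> (forall x, K x -> {for f x, continuous h}) ->
  cK (fun x => h (f x)).
Proof.
move=> cf ch; rewrite continuous_subspace_in => x xK.
apply: (@continuous_comp (subspace K) R R f h); first exact: cf.
by apply: ch; rewrite inE in xK.
Qed.

(** [c] is the gradient together with its continuous extension to the frontier; naming it spares any
    manipulation of the limits in [ext_jacobian]. *)
Definition up1 f c := [/\ cK f, forall x, Omega x -> has_grad f x (c x)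
  & forall i, cK (fun x => c x 0 i)].

Lemma up1_cst (a : R) : up1 (fun=> a) (fun=> 0).
Proof. by split => [|x _|i]; [exact: within_cst|exact: has_grad_cst|exact: within_cst]. Qed.

Lemma up1D f g c d : up1 f c -> up1 g d -> up1 (fun x => f x + g x) (fun x => c x + d x).
Proof.
move=> [f1 f2 f3] [g1 g2 g3]; split => [|x Ox|i]; first exact: withinD.
  by apply: has_gradD; [exact: f2|exact: g2].
rewrite (_ : (fun x => _) = fun x => c x 0 i + d x 0 i); first exact: withinD.
by apply/funext => x; rewrite mxE.
Qed.

Lemma up1M f g c d : up1 f c -> up1 g d ->
  up1 (fun x => f x * g x) (fun x => f x *: d x + g x *: c x).
Proof.
move=> [f1 f2 f3] [g1 g2 g3]; split => [|x Ox|i]; first exact: withinM.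
  by apply: has_gradM; [exact: f2|exact: g2].
rewrite (_ : (fun x => _) = fun x => f x * d x 0 i + g x * c x 0 i).
  by apply: withinD; exact: withinM.
by apply/funext => x; rewrite !mxE.
Qed.

Lemma up1_sum (I : Type) (r : seq I) (f : I -> E -> R) (c : I -> E -> E) :
  (forall i, up1 (f i) (c i)) ->
  up1 (fun x => \sum_(i <- r) f i x) (fun x => \sum_(i <- r) c i x).
Proof.
move=> fc; split => [|x Ox|j]; first by apply: within_sum => i; have [] := fc i.
  by apply: has_grad_sum => i; have [_ + _] := fc i; exact.
rewrite (_ : (fun x => _) = fun x => \sum_(i <- r) c i x 0 j).
  by apply: within_sum => i; have [_ _] := fc i.
by apply/funext => x; rewrite summxE.
Qed.

Lemma up1_comp f c (h dh : R -> R) : up1 f c ->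
  (forall x, K x -> is_derive (f x) 1 h (dh (f x))) ->
  (forall x, K x -> {for f x, continuous dh}) ->
  up1 (fun x => h (f x)) (fun x => dh (f x) *: c x).
Proof.
move=> [f1 f2 f3] hP ch.
have OK : Omega `<=` K by exact: subset_closure.
split => [|x Ox|i].
- apply: cK_comp => // x Kx; apply: differentiable_continuous.
  by apply/derivable1_diffP; have [] := hP x Kx.
- by apply: has_grad_comp; [exact: hP (OK _ Ox)|exact: f2].
- rewrite (_ : (fun x => _) = fun x => dh (f x) * c x 0 i).
    by apply: withinM => //; exact: cK_comp.
  by apply/funext => x; rewrite !mxE.
Qed.

Lemma isC1_up1 W f : K `<=` W -> isC1 W f -> up1 f (grad f).
Proof.
move=> KW Cf; split => [|x /subset_closure/KW Wx|i].
- by apply: cK_continuous => x /KW Wx; exact: isC1_continuous Cf Wx.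
- exact: isC1_has_grad Wx.
- by apply: cK_continuous => x /KW Wx; have [_] := Cf x Wx; exact.
Qed.

(** Row i of [J] is the derivative in direction e_i, so 'D_v phi = v *m J, the convention of
    [ext_jacobian]. *)
Definition upV (phi : E -> E) (J : E -> M) :=
  forall j, up1 (fun x => phi x 0 j) (fun x => \row_i J x i j).

Lemma upV_jac_continuous phi J i j : upV phi J -> cK (fun x => J x i j).
Proof.
move=> /(_ j)[_ _ /(_ i)]; rewrite (_ : (fun x => _) = fun x => J x i j)//.
by apply/funext => x; rewrite mxE.
Qed.

Lemma upV_derive phi J x v : upV phi J -> Omega x -> 'D_v phi x = v *m J x.
Proof.
move=> pJ Ox.
have dp : differentiable phi x.
  apply: differentiable_row => j; have [_ /(_ x Ox) h _] := pJ j.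
  exact: has_grad_differentiable h.
rewrite derive_row//; congr (v *m _); apply/matrixP => i j; rewrite mxE.
by have [_ /(_ x Ox)/has_grad_grad -> _] := pJ j; rewrite mxE.
Qed.

Lemma upV_C1_closure phi J : upV phi J -> C1_closure Omega phi.
Proof.
move=> pJ; split.
- by move=> x; apply: (@continuous_coordP R n (subspace K)) => j; have [+ _ _] := pJ j; exact.
- move=> x Ox; apply: differentiable_row => j; have [_ /(_ x Ox) h _] := pJ j.
  exact: has_grad_differentiable h.
- move=> v; exists (fun x => v *m J x); last by move=> x Ox; rewrite (upV_derive _ pJ Ox).
  move=> x; apply: (@continuous_coordP R n (subspace K)) => j; move: x.
  rewrite (_ : (fun y => _) = fun y => \sum_i v 0 i * J y i j); last first.
    by apply/funext => y; rewrite mxE.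
  apply: within_sum => i; apply: withinM; first exact: within_cst.
  exact: upV_jac_continuous.
Qed.

(** At a point of the closure the filter [within Omega (nbhs x)] is proper, so the limit is unique
    and equals the value of any continuous extension of the derivative. *)
Lemma ext_jacobianE phi (J : E -> M) x : K x ->
  (forall i j, cK (fun x => J x i j)) ->
  (forall y i, Omega y -> 'D_(delta_mx 0 i) phi y = row i (J y)) ->
  ext_jacobian Omega phi x = J x.
Proof.
move=> Kx cJ DJ; apply/row_matrixP => i; rewrite rowK.
have PF : ProperFilter (within Omega (nbhs x)).
  by apply: within_nbhs_proper.
apply: cvg_lim; first exact: norm_hausdorff.
have cr : {within K, continuous (fun y => row i (J y))}.
  move=> y; apply: (@continuous_coordP R n (subspace K)) => j; move: y.
  rewrite (_ : (fun y => _) = fun y => J y i j); first exact: cJ.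
  by apply/funext => y; rewrite mxE.
have H : row i (J y) @[y --> within K (nbhs x)] --> row i (J x).
  by rewrite (nbhs_subspace_in Kx); exact: cr.
have H2 : row i (J y) @[y --> within Omega (nbhs x)] --> row i (J x).
  apply: cvg_trans H; apply: cvg_app; apply: within_subset; exact: subset_closure.
apply: cvg_trans H2; apply: near_eq_cvg.
rewrite near_withinE; apply: (open_near openT) => // y _ Oy; exact/esym/DJ.
Qed.

Lemma upV_ext_jacobian phi J x : upV phi J -> K x -> ext_jacobian Omega phi x = J x.
Proof.
move=> pJ Kx; apply: ext_jacobianE => //.
  by move=> i j; exact: upV_jac_continuous.
by move=> y i Oy; rewrite (upV_derive _ pJ Oy) rowE.
Qed.

Lemma C1_closure_upV phi : C1_closure Omega phi -> upV phi (ext_jacobian Omega phi).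
Proof.
move=> [cp dp gp].
have /choice[G GP] : forall v, exists g : E -> E, {within K, continuous g} /\
   forall x, Omega x -> g x = 'D_v phi x by move=> v; have [g ? ?] := gp v; exists g.
pose J x : M := \matrix_i G (delta_mx 0 i) x.
have cJ i j : cK (fun x => J x i j).
  rewrite (_ : (fun x => _) = fun x => G (delta_mx 0 i) x 0 j).
    by move=> x; apply: (@continuous_coord R n (subspace K)); exact: (GP _).1.
  by apply/funext => x; rewrite mxE.
have JE x : K x -> ext_jacobian Omega phi x = J x.
  move=> Kx; apply: ext_jacobianE => // y i Oy.
  by rewrite -(GP _).2// rowK.
have JO x : Omega x -> jac phi x = J x.
  move=> Ox; apply/row_matrixP => i; rewrite rowK (GP _).2//.
  by rewrite derive_row ?rowE//; exact: dp.
move=> j; split => [x|x Ox|i].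
- by apply: (@continuous_coord R n (subspace K)); exact: cp.
- have := differentiable_has_grad (differentiable_row_coord j (dp x Ox)).
  congr has_grad; apply/rowP => i; rewrite [RHS]mxE JE; last exact: subset_closure.
  by rewrite -JO// [RHS]mxE.
- move=> x; apply: (@subspace_eq_continuous E K R (fun x => J x i j)); last exact: cJ.
  by move=> y; rewrite inE => Ky; rewrite /from_subspace mxE JE.
Qed.

Lemma upV_scale f c phi J : up1 f c -> upV phi J ->
  upV (fun x => f x *: phi x) (fun x => f x *: J x + (c x)^T *m phi x).
Proof.
move=> fc pJ j; have := up1M fc (pJ j); congr up1.
  by apply/funext => x; rewrite mxE.
apply/funext => x; apply/rowP => i; rewrite !mxE big_ord1 !mxE; congr (_ + _).
by rewrite mulrC.
Qed.

Lemma upVD phi psi J J' : upV phi J -> upV psi J' ->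
  upV (fun x => phi x + psi x) (fun x => J x + J' x).
Proof.
move=> pJ pJ' j; have := up1D (pJ j) (pJ' j); congr up1.
  by apply/funext => x; rewrite mxE.
by apply/funext => x; apply/rowP => i; rewrite !mxE.
Qed.

Lemma up1_dot phi psi J J' : upV phi J -> upV psi J' ->
  exists c, up1 (fun x => dot (phi x) (psi x)) c.
Proof.
move=> pJ pJ'; eexists; apply: up1_sum => i; exact: up1M (pJ i) (pJ' i).
Qed.

Lemma isC1_field_upV W N : K `<=` W -> isC1_field W N -> upV N (jac N).
Proof.
move=> KW CN j; have := isC1_up1 KW (CN j); congr up1.
by apply/funext => x; apply/rowP => i; rewrite !mxE.
Qed.

Lemma upV_cst (v : E) : upV (fun=> v) (fun=> 0).
Proof.
move=> j; have := up1_cst (v 0 j); congr up1.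
by apply/funext => x; apply/rowP => i; rewrite !mxE.
Qed.

End UpToBoundary.

(** * Plane bundles *)

Section Grassmannian.
Context {R : realType} {n : nat}.
Local Notation E := 'rV[R]_n.+1.
Local Notation M := 'M[R]_n.+1.
Implicit Types (P : M) (m : nat).

(** In the rank factorization P = C R, idempotence forces R C = 1, whence tr P = tr (R C). The point
    is to trade the rank for the trace, which is continuous, so that the Grassmannian is closed. *)
Lemma idempotent_trace P : P *m P = P -> \tr P = (\rank P)%:R.
Proof.
move=> PP.
have H : row_base P *m col_base P = 1%:M.
  apply: (row_free_inj (row_base_free P)); apply: (row_full_inj (col_base_full P)).
  by rewrite /= mul1mx mulmxA mulmxA -mulmxA mulmx_base PP.
by rewrite -{1}(mulmx_base P) mxtrace_mulC H mxtrace1.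
Qed.

Lemma grassmannianE m : @grassmannian R n m =
  [set P | [/\ P^T = P, P *m P = P & \tr P = m%:R]].
Proof.
apply/seteqP; split => P [PT PP Pm]; split => //; first by rewrite idempotent_trace// Pm.
by apply/eqP; rewrite -(eqr_nat R) -idempotent_trace// Pm.
Qed.

Lemma proj_diag P i : P^T = P -> P *m P = P -> \sum_j P i j ^+ 2 = P i i.
Proof.
move=> PT PP; rewrite -{2}PP mxE; apply: eq_bigr => j _.
by rewrite expr2 -{2}PT mxE.
Qed.

Lemma proj_entry P i j : P^T = P -> P *m P = P -> `|P i j| <= 1.
Proof.
move=> PT PP.
have sq k l : P k l ^+ 2 <= P k k.
  rewrite -(proj_diag k PT PP) (bigD1 l)//= lerDl.
  by apply: sumr_ge0 => ? _; exact: sqr_ge0.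
have P1 : P i i <= 1.
  rewrite leNgt; apply/negP => h1; have := sq i i; apply/negP; rewrite -ltNge.
  by rewrite expr2 ltr_pMr// (lt_trans _ h1).
rewrite -(@expr_le1 _ 2)// -normrX ger0_norm ?sqr_ge0//.
exact: le_trans (sq i j) P1.
Qed.

Lemma enorm_proj P (v : E) : P^T = P -> P *m P = P -> enorm (v *m P) <= enorm v.
Proof.
move=> PT PP.
have h : enorm (v *m P) ^+ 2 <= enorm v * enorm (v *m P).
  rewrite enorm_sqr dot_mulmx PT -mulmxA PP.
  exact: le_trans (ler_norm _) (dot_le_enorm _ _).
have [->|v0] := eqVneq (enorm (v *m P)) 0; first exact: enorm_ge0.
move: h; rewrite expr2 ler_pM2r//.
by rewrite lt0r v0 enorm_ge0.
Qed.

Lemma closed_eq_fun (T : topologicalType) (f g : T -> R) :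
  continuous f -> continuous g -> closed [set x | f x = g x].
Proof.
move=> cf cg; rewrite (_ : [set x | _] = (fun x => f x - g x) @^-1` [set 0]).
  apply: closed_comp => [x _|]; last exact: closed_eq.
  by apply: (@continuousB R R^o T); [exact: cf|exact: cg].
by apply/seteqP; split => x /=; [move=> ->; rewrite subrr|move/eqP; rewrite subr_eq0 => /eqP].
Qed.

Lemma entry_continuous i j : continuous (fun P : M => P i j).
Proof. exact: coord_continuous. Qed.

Lemma grassmannian_closed m : closed (@grassmannian R n m).
Proof.
have cM i j : continuous (fun P : M => (P *m P) i j).
  move=> P; rewrite (_ : (fun P : M => _) = fun P => \sum_k P i k * P k j).
    apply: (@continuous_sum R M _ _ (fun k (P : M) => P i k * P k j)) => k.
    by apply: (@continuousM R M (fun P => P i k) (fun P => P k j)); exact: entry_continuous.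
  by apply/funext => Q; rewrite mxE.
have cT : continuous (fun P : M => \tr P).
  by move=> P; apply: (@continuous_sum R M _ _ (fun k (P : M) => P k k)) => k;
    exact: entry_continuous.
rewrite grassmannianE (_ : [set P | _] =
  (\bigcap_i \bigcap_j [set P : M | P j i = P i j]) `&`
  (\bigcap_i \bigcap_j [set P : M | (P *m P) i j = P i j]) `&` [set P | \tr P = m%:R]).
  apply: closedI; first apply: closedI.
  - apply: closed_bigI => i _; apply: closed_bigI => j _.
    by apply: closed_eq_fun; exact: entry_continuous.
  - apply: closed_bigI => i _; apply: closed_bigI => j _.
    by apply: closed_eq_fun => //; exact: entry_continuous.
  - by apply: closed_eq_fun => // P; exact: cst_continuous.
apply/seteqP; split => P /= [].
  move=> PT PP Pm; split => //; split=> i _ j _ /=; last by rewrite PP.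
  by rewrite -{1}PT mxE.
move=> [PT PP] Pm; split => //; apply/matrixP => i j; last exact: PP.
by rewrite mxE; exact: PT.
Qed.

Lemma grassmannian_compact m : compact (@grassmannian R n m).
Proof.
(* The cube [-1, 1]^((n+1)^2) is compact as a set of row vectors, and [vec_mx] carries it to
   matrices; the entries of a projection lie in [-1, 1]. *)
pose B : set 'rV[R]_(n.+1 * n.+1) := [set v | forall i, `[-1, 1]%classic (v ord0 i)].
have cB : compact B.
  exact: (@rV_compact R (n.+1 * n.+1)%N (fun=> `[-1,
    1]%classic) (fun=> @segment_compact R (-1) 1)).
have cv : continuous (vec_mx : 'rV[R]_(n.+1 * n.+1) -> M).
  move=> v C [A nA AC].
  suff nAv : nbhs v [set w | forall i j, A i j (vec_mx w i j)] by apply: filterS nAv => w;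
    exact: AC.
  have H i j : nbhs v [set w | A i j (vec_mx w i j)].
    have := nA i j; rewrite mxE => /(@coord_continuous R 1 (n.+1 * n.+1) 0 (mxvec_index i j) v).
    by apply: (@filterS _ (nbhs v) (nbhs_filter v)) => w /=; rewrite mxE.
  have Hi i : nbhs v [set w | forall j, A i j (vec_mx w i j)].
    exact: (@filter_forall _ _ _ (nbhs v) (nbhs_filter v) (H i)).
  exact: (@filter_forall _ _ _ (nbhs v) (nbhs_filter v) Hi).
apply: (subclosed_compact (@grassmannian_closed m) (continuous_compact (continuous_subspaceT cv)
  cB)).
move=> P [PT PP _]; exists (mxvec P); last by rewrite mxvecK.
move=> k /=; case/mxvec_indexP: k => i j; rewrite mxvecE in_itv/= -ler_norml.
exact: proj_entry.
Qed.

Lemma plane_bundleE m (A : set E) : plane_bundle m A = A `*` grassmannian m.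
Proof. by []. Qed.

Lemma plane_bundle_compact m (A : set E) : compact A -> compact (plane_bundle m A).
Proof. by move=> cA; rewrite plane_bundleE; apply: compact_setX => //;
  exact: grassmannian_compact. Qed.

Lemma fst_continuous : continuous (fst : E * M -> E).
Proof. by move=> y; exact: cvg_fst. Qed.

Lemma snd_continuous : continuous (snd : E * M -> M).
Proof. by move=> y; exact: cvg_snd. Qed.

Lemma plane_bundle_closed m (A : set E) : closed A -> closed (plane_bundle m A).
Proof.
move=> cA; rewrite (_ : plane_bundle m A = fst @^-1` A `&` snd @^-1` grassmannian m)//.
apply: closedI; apply: closed_comp => //.
- by move=> y _; exact: fst_continuous.
- by move=> y _; exact: snd_continuous.
- exact: grassmannian_closed.
Qed.

Lemma plane_bundle_measurable m (A : set E) : closed A ->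
  measurable (plane_bundle m A : set (borel (E * M)%type)).
Proof. by move=> cA; apply: closed_borel; exact: plane_bundle_closed. Qed.

(* Condition (iii) in the definition of a capillary plane is automatic: if v P = v and
   <v, nu> = 0, then <v, nu P> = <v P, nu> = 0. *)
Lemma capillary_bundleE (Omega : set E) (beta : E -> R) m :
  capillary_bundle Omega beta m = plane_bundle m (frontier Omega) `&`
    [set y | enorm (inner_normal Omega y.1 *m y.2) = sin (beta y.1)].
Proof.
apply/seteqP; split => -[x P] /=.
  by move=> [Sx [GP nuP _]].
move=> [[Sx GP] nuP]; split => //; split => // v vP tv.
by case: GP => PT _ _; rewrite dotC dot_mulmx PT vP dotC.
Qed.

Lemma frontier_closed (Omega : set E) : closed (frontier Omega).
Proof.
rewrite /frontier setDE; apply: closedI; first exact: closed_closure.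
by apply: open_closedC; exact: open_interior.
Qed.

Lemma within_closed (T : topologicalType) (A : set T) (f : T -> R) (C : set R) :
  closed A -> {within A, continuous f} -> closed C -> closed (A `&` f @^-1` C).
Proof.
move=> cA /continuous_closedP cf cC.
have /closed_subspaceP[V cV VA] := cf C cC.
by rewrite setIC -VA; exact: closedI.
Qed.

Lemma capillary_bundle_closed (Omega : set E) (beta : E -> R) m :
  {within frontier Omega, continuous beta} ->
  (forall i, {within frontier Omega, continuous (fun x => inner_normal Omega x 0 i)}) ->
  closed (capillary_bundle Omega beta m).
Proof.
move=> cbeta cnu; set S := frontier Omega in cbeta cnu *.
have cD : closed (plane_bundle m S) by apply: plane_bundle_closed; exact: frontier_closed.
pose F (y : E * M) := enorm (inner_normal Omega y.1 *m y.2) - sin (beta y.1).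
rewrite capillary_bundleE -/S (_ : _ `&` _ = plane_bundle m S `&` F @^-1` [set 0]); last first.
  apply/seteqP; split => y [Dy /= Fy]; split => //=; first by rewrite /F Fy subrr.
  by apply/eqP; rewrite -subr_eq0; apply/eqP.
apply: within_closed; [exact: cD| |exact: closed_eq].
have cfst (f : E -> R) : {within S, continuous f} ->
    {within plane_bundle m S, continuous (fun y => f y.1)}.
  by move=> cf; apply: (within_comp fst_continuous _ cf) => y [].
have csnd i j : {within plane_bundle m S, continuous (fun y : E * M => y.2 i j)}.
  apply: continuous_subspaceT => y; apply: (@continuous_comp _ _ _ snd (fun P : M => P i j)).
    exact: snd_continuous.
  exact: entry_continuous.
move=> y; apply: (@continuousB R R^o (subspace (plane_bundle m S))
  (fun y => enorm (inner_normal Omega y.1 *m y.2)) (fun y => sin (beta y.1))); last first.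
  apply: (@cfst (fun x => sin (beta x))) => x.
  apply: (@continuous_comp (subspace S) R R beta sin); first exact: cbeta.
  exact: continuous_sin.
apply: (@continuous_enorm R n (subspace (plane_bundle m S))).
apply: (@continuous_coordP R n (subspace (plane_bundle m S))) => j; move: y.
have -> : (fun y : E * M => (inner_normal Omega y.1 *m y.2) 0 j) =
    fun y => \sum_k inner_normal Omega y.1 0 k * y.2 k j.
  by apply/funext => y; rewrite mxE.
move=> y; apply: (@continuous_sum R (subspace (plane_bundle m S))) => k.
apply: (@continuousM R (subspace (plane_bundle m S))); last exact: csnd.
exact: (cfst _ (cnu k)).
Qed.

End Grassmannian.

(** * Integration lemmas and densities of fibre integrals *)

Lemma indic_norm_le1 (R : realType) (T : Type) (A : set T) x : `|\1_A x| <= 1 :> R.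
Proof. by rewrite indicE; case: (_ \in _); rewrite ?normr1 ?normr0. Qed.

Section RealIntegrals.
Context d (T : measurableType d) (R : realType).
Variable mu : {measure set T -> \bar R}.
Implicit Types (D A B : set T) (f h : T -> R).

Lemma integrable_mul D f h (C : R) : measurable D -> mu.-integrable D (EFin \o f) ->
  measurable_fun D h -> (forall x, D x -> `|h x| <= C) ->
  mu.-integrable D (EFin \o (fun x => h x * f x)).
Proof.
move=> mD fi mh hC.
have hb : [bounded h x | x in D].
  exists C; split; first exact: num_real.
  by move=> y Cy x Dx; apply: le_trans (hC x Dx) (ltW Cy).
have := integrableMr mD mh hb fi.
by apply: eq_integrable => // x _; rewrite /= EFinM.
Qed.

Lemma integrable_add D f h : measurable D -> mu.-integrable D (EFin \o f) ->
  mu.-integrable D (EFin \o h) -> mu.-integrable D (EFin \o (fun x => f x + h x)).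
Proof.
by move=> mD fi hi; have := integrableD mD fi hi; apply: eq_integrable => // x _;
  rewrite /= EFinD.
Qed.

Lemma integrable_big (I : Type) (s : seq I) (F : I -> T -> R) D : measurable D ->
  (forall i, mu.-integrable D (EFin \o F i)) ->
  mu.-integrable D (EFin \o (fun x => \sum_(i <- s) F i x)).
Proof.
move=> mD Fi.
have := @integrable_sum _ _ _ mu D mD I s xpredT (fun i => EFin \o F i) (fun i _ => Fi i).
by apply: eq_integrable => // x _; rewrite /= sumEFin.
Qed.

Lemma RintegralN D f : measurable D -> mu.-integrable D (EFin \o f) ->
  \int[mu]_(x in D) (- f x) = - \int[mu]_(x in D) f x.
Proof.
move=> mD fi; rewrite -mulN1r -RintegralZl//; apply: eq_Rintegral => x _.
by rewrite mulN1r.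
Qed.

Lemma le_Rintegral_norm D f h : measurable D -> mu.-integrable D (EFin \o f) ->
  mu.-integrable D (EFin \o h) -> (forall x, D x -> `|f x| <= h x) ->
  `|\int[mu]_(x in D) f x| <= \int[mu]_(x in D) h x.
Proof.
move=> mD fi hi fh; apply: le_trans (le_normr_Rintegral mD fi) _.
by apply: le_Rintegral => //; exact: integrable_norm.
Qed.

Lemma Rintegral_EFin D f : measurable D -> mu.-integrable D (EFin \o f) ->
  (\int[mu]_(x in D) f x)%:E = (\int[mu]_(x in D) (f x)%:E)%E.
Proof. by move=> mD fi; rewrite /Rintegral fineK//; exact: integrable_fin_num. Qed.

Lemma Rintegral_cvg_mul D f (a_ : nat -> T -> R) (a : T -> R) : measurable D ->
  mu.-integrable D (EFin \o f) -> (forall k, measurable_fun D (a_ k)) ->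
  measurable_fun D a -> (forall k x, D x -> `|a_ k x| <= 1) ->
  (forall x, D x -> a_ k x @[k --> \oo] --> a x) ->
  \int[mu]_(x in D) (a_ k x * f x) @[k --> \oo] --> \int[mu]_(x in D) (a x * f x).
Proof.
move=> mD fi ma_ ma a1 aa.
have mf : measurable_fun D f by apply/measurable_EFinP; exact: measurable_int fi.
have [] := @dominated_convergence _ _ _ mu D mD
  (fun k x => (a_ k x * f x)%:E) (fun x => (a x * f x)%:E) (fun x => `|f x|%:E).
- by move=> k; apply/measurable_EFinP; exact: measurable_funM.
- by apply/measurable_EFinP; exact: measurable_funM.
- apply/aeW => x Dx; apply: cvg_EFin; first exact: nearW.
  by apply: (@cvgM R nat \oo _ (a_ ^~ x) (fun=> f x)); [exact: aa|exact: cvg_cst].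
- exact: integrable_norm.
- apply/aeW => x k Dx /=; rewrite lee_fin normrM ler_piMl//; exact: a1.
move=> ai _ H; apply: fine_cvg; rewrite fineK//.
exact: (integrable_fin_num mD ai).
Qed.

Lemma Rintegral_setI_indic D A f : measurable D -> measurable A ->
  \int[mu]_(x in D `&` A) f x = \int[mu]_(x in D) (\1_A x * f x).
Proof.
move=> mD mA; rewrite Rintegral_mkcond [RHS]Rintegral_mkcond.
apply: eq_Rintegral => x _; rewrite /patch in_setI indicE.
by case: (x \in D) => //=; case: (x \in A); rewrite ?mul1r ?mul0r.
Qed.

End RealIntegrals.

Section BundleIntegrals.
Context {R : realType} {n : nat}.
Local Notation E := 'rV[R]_n.+1.
Local Notation M := 'M[R]_n.+1.
Variables (K : set E) (m : nat).
Local Notation D := (plane_bundle m K).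
Local Notation cK f := {within K, continuous (f : E -> R)}.
Local Notation cD f := {within D, continuous (f : (E * M)%type -> R)}.

Lemma within_fst (f : E -> R) : cK f -> cD (fun y => f y.1).
Proof. by move=> cf; apply: (within_comp fst_continuous _ cf) => y []. Qed.

Lemma within_snd i j : cD (fun y => y.2 i j).
Proof.
apply: continuous_subspaceT => y; apply: (@continuous_comp _ _ _ snd (fun P : M => P i j)).
  exact: snd_continuous.
exact: entry_continuous.
Qed.

Lemma within_trace (J : E -> M) : (forall i j, cK (fun x => J x i j)) ->
  cD (fun y => \tr (y.2 *m J y.1)).
Proof.
move=> cJ; have -> : (fun y : E * M => \tr (y.2 *m J y.1)) =
    fun y => \sum_i \sum_k y.2 i k * J y.1 k i.
  by apply/funext => y; apply: eq_bigr => i _; rewrite mxE.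
apply: within_sum => i; apply: within_sum => k; apply: withinM; first exact: within_snd.
exact: (within_fst (cJ k i)).
Qed.

Lemma within_dot_proj (c d : E -> E) : (forall i, cK (fun x => c x 0 i)) ->
  (forall i, cK (fun x => d x 0 i)) -> cD (fun y => dot (c y.1 *m y.2) (d y.1)).
Proof.
move=> cc cd; have -> : (fun y : E * M => dot (c y.1 *m y.2) (d y.1)) =
    fun y => \sum_i (\sum_k c y.1 0 k * y.2 k i) * d y.1 0 i.
  by apply/funext => y; apply: eq_bigr => i _; rewrite mxE.
apply: within_sum => i; apply: withinM; last exact: (within_fst (cd i)).
apply: within_sum => k; apply: withinM; last exact: within_snd.
exact: (within_fst (cc k)).
Qed.

Section measure_on_bundle.
Variable V : {measure set (borel (E * M)%type) -> \bar R}.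
Hypothesis cptK : compact K.
Hypothesis rV : radon V.
Hypothesis nullV : V (~` D) = 0%E.
Local Notation mu := (base_measure V : {measure set (borel E) -> \bar R}).

Let closedK : closed K.
Proof. by apply: compact_closed => //; exact: norm_hausdorff. Qed.

Lemma bundle_measurable : measurable (D : set (borel (E * M)%type)).
Proof. exact: plane_bundle_measurable. Qed.

Lemma base_measurable : measurable (K : set (borel E)).
Proof. exact: closed_borel. Qed.

Lemma bundle_finite : (V D < +oo)%E.
Proof. exact/rV/plane_bundle_compact. Qed.

Lemma bundle_integrable (f : E * M -> R) : cD f ->
  V.-integrable (D : set (borel (E * M)%type)) (EFin \o (f : borel (E * M)%type -> R)).
Proof.
move=> cf; apply: within_integrable => //; first exact: bundle_measurable.
  exact: plane_bundle_compact.
exact: bundle_finite.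
Qed.

Lemma measurable_pre_point (A : set (borel E)) : measurable A ->
  measurable (point_of @^-1` A : set (borel (E * M)%type)).
Proof. by move=> mA; rewrite -[X in measurable X]setTI; exact: measurable_point_of. Qed.

Lemma measurable_indic_base (A : set (borel E)) (C : set (borel (E * M)%type)) : measurable A ->
  measurable_fun C (fun y => \1_A y.1 : R).
Proof.
move=> mA; rewrite (_ : (fun y => _) = \1_(point_of @^-1` A)).
  by apply: measurable_indic; exact: measurable_pre_point.
by apply/funext => y; rewrite !indicE; congr (_%:R); congr nat_of_bool; apply/idP/idP;
  rewrite !inE.
Qed.

Lemma measure_bundle (A : set (borel (E * M)%type)) : measurable A -> V A = V (D `&` A).
Proof.
move=> mA; have mD := bundle_measurable.
have h : V (A `&` ~` D) = 0%E.
  apply/eqP; rewrite eq_le measure_ge0 andbT -nullV le_measure ?inE//.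
  - by apply: measurableI => //; exact: measurableC.
  - exact: measurableC.
have -> : V A = (V (A `&` D) + V (A `&` ~` D))%E.
  rewrite -measureU.
  - by rewrite -setIUr setUv setIT.
  - exact: measurableI.
  - by apply: measurableI => //; exact: measurableC.
  - by rewrite setIACA setICr setI0.
by rewrite h adde0 setIC.
Qed.

Lemma base_measure_bundle (A : set (borel E)) : measurable A ->
  mu A = V (D `&` point_of @^-1` A).
Proof. by move=> mA; rewrite -measure_bundle//; exact: measurable_pre_point. Qed.

Lemma base_finite (A : set (borel E)) : measurable A -> (mu A < +oo)%E.
Proof.
move=> mA; rewrite base_measure_bundle//; apply: le_lt_trans bundle_finite.
have mp := measurable_pre_point mA; have mD := bundle_measurable.
by rewrite le_measure ?inE//; exact: measurableI.
Qed.

Lemma base_measureI (A : set (borel E)) : measurable A -> mu A = mu (A `&` K).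
Proof.
move=> mA; have mK := base_measurable.
rewrite !base_measure_bundle//; last exact: measurableI.
congr (V _); apply/seteqP; split => y [Dy Ay]; split => //; last by case: Ay.
by split => //; case: Dy.
Qed.

End measure_on_bundle.
End BundleIntegrals.

Section MonotoneClass.
Import HBNNSimple.
Context d (T : measurableType d) (R : realType).
Variable P : (T -> \bar R) -> Prop.
Hypothesis P_indic : forall (r : R) A, 0 <= r -> measurable A -> P (fun x => (r * \1_A x)%:E).
Hypothesis P_add : forall f h : T -> \bar R, measurable_fun setT f -> measurable_fun setT h ->
  (forall x, 0 <= f x)%E -> (forall x, 0 <= h x)%E -> P f -> P h -> P (fun x => f x + h x)%E.
Hypothesis P_lim : forall f_ : nat -> T -> \bar R, (forall k, measurable_fun setT (f_ k)) ->
  (forall k x, 0 <= f_ k x)%E -> (forall x, nondecreasing_seq (f_ ^~ x)) ->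
  (forall k, P (f_ k)) -> P (fun x => limn (f_ ^~ x)).

(** The standard machine: indicators, sums, increasing limits. It serves both the push-forward
    densities and the disintegration. *)
Lemma ge0_measurable_ind (f : T -> \bar R) :
  measurable_fun setT f -> (forall x, 0 <= f x)%E -> P f.
Proof.
move=> mf f0.
pose a k : {nnsfun T >-> R} := nnsfun_approx measurableT mf k.
have Pa k : P (EFin \o a k).
  have -> : EFin \o a k = fun x : T => (\sum_(i <- finmap.enum_fset (fset_set (range (a k)))) (i
    * \1_(a k @^-1` [set i]) x))%:E.
    apply/funext => x /=; rewrite fimfunE; congr EFin.
    by rewrite fsbig_finite//; exact: fimfunP.
  have : forall i, i \in finmap.enum_fset (fset_set (range (a k))) -> 0 <= i.
    move=> i; rewrite in_fset_set; last exact: fimfunP.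
    by rewrite inE => -[x _ <-].
  elim: (finmap.enum_fset _) => [_|i s IH si].
    have := P_indic (lexx 0) (@measurable0 _ T).
    by congr P; apply/funext => x; rewrite big_nil mul0r.
  have i0 : 0 <= i by apply: si; rewrite mem_head.
  have si' j : j \in s -> 0 <= j by move=> js; apply: si; rewrite in_cons js orbT.
  have mi j : measurable (a k @^-1` [set j]) by [].
  have := P_add _ _ _ _ (P_indic i0 (mi i)) (IH si').
  rewrite (_ : (fun x => _ + _)%E = fun x => (\sum_(j <- i :: s) j * \1_(a k @^-1` [set j])
    x)%:E); last first.
    by apply/funext => x; rewrite big_cons EFinD.
  apply.
  - by apply/measurable_EFinP; apply: measurable_funM => //; exact: measurable_indic.
  - apply/measurable_EFinP; apply: measurable_sum => j.
    by apply: measurable_funM => //; exact: measurable_indic.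
  - by move=> x; rewrite lee_fin mulr_ge0.
  - by move=> x; rewrite lee_fin big_seq sumr_ge0// => j /si' j0; rewrite mulr_ge0.
have -> : f = fun x => limn (fun k => (EFin \o a k) x).
  apply/funext => x; apply/esym/cvg_lim => //.
  by apply: cvg_nnsfun_approx => // y _; exact: f0.
apply: P_lim => //.
- by move=> k; apply/measurable_EFinP.
- by move=> k x; rewrite lee_fin.
- move=> x k l kl; rewrite lee_fin.
  by have /lefP := nd_nnsfun_approx measurableT mf kl; exact.
Qed.

End MonotoneClass.

Lemma integral_restrict d (T : measurableType d) (R : realType) (mu : {measure set T -> \bar R})
    (A : set T) (f : T -> \bar R) :
  (\int[mu]_(x in A) f x = \int[mu]_x (f x * (\1_A x)%:E))%E.
Proof.
rewrite integral_mkcond; apply: eq_integral => x _; rewrite /patch indicE.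
by case: (x \in A); rewrite ?mule1 ?mule0.
Qed.

(** * Densities of fibre integrals *)

Section BaseDensity.
Context d1 d2 (X : measurableType d1) (Y : measurableType d2) (R : realType).
Variables (V : {measure set X -> \bar R}) (mu : {measure set Y -> \bar R}) (phi : X -> Y).
Hypothesis mphi : measurable_fun setT phi.
Hypothesis muE : forall A, measurable A -> mu A = V (phi @^-1` A).
Hypothesis Vfin : (V setT < +oo)%E.

Let mpre A : measurable A -> measurable (phi @^-1` A).
Proof. by move=> mA; rewrite -[X in measurable X]setTI; exact: mphi. Qed.

Lemma density_extend (F : X -> R) (w : Y -> R) : measurable_fun setT F -> measurable_fun setT w ->
  (forall x, 0 <= F x) -> (forall y, 0 <= w y) ->
  (forall A, measurable A -> \int[V]_(x in phi @^-1` A) (F x)%:E = \int[mu]_(y in A) (w y)%:E)%E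
    ->
  forall f : Y -> \bar R, measurable_fun setT f -> (forall y, 0 <= f y)%E ->
  (\int[V]_x (f (phi x) * (F x)%:E) = \int[mu]_y (f y * (w y)%:E))%E.
Proof.
move=> mF mw F0 w0 Fw; apply: ge0_measurable_ind => [r A r0 mA|f h mf mh f0 h0 fE hE|f_ mf f0 nf
  fE].
- have -> : (\int[V]_x ((r * \1_A (phi x))%:E * (F x)%:E) = r%:E * \int[V]_x ((F x)%:E * (\1_(phi
  @^-1` A) x)%:E))%E.
    rewrite -ge0_integralZl//; last 2 first.
    + apply: emeasurable_funM; apply/measurable_EFinP => //.
      by apply: measurable_indic; exact: mpre.
    + by move=> x _; rewrite -EFinM lee_fin mulr_ge0.
    by apply: eq_integral => x _; rewrite -!EFinM; congr EFin;
      rewrite !indicE -mulrA [X in _ * X]mulrC; congr (_ * (_ * _)).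
  have -> : (\int[mu]_x ((r * \1_A x)%:E * (w x)%:E) = r%:E * \int[mu]_x ((w x)%:E * (\1_A
    x)%:E))%E.
    rewrite -ge0_integralZl//; last 2 first.
    + by apply: emeasurable_funM; apply/measurable_EFinP.
    + by move=> x _; rewrite -EFinM lee_fin mulr_ge0.
    by apply: eq_integral => x _; rewrite -!EFinM -mulrA [X in (_ * X)%:E]mulrC.
  by rewrite -!integral_restrict ?Fw//; exact: mpre.
- have mfp : measurable_fun setT (fun x => f (phi x)) by exact: measurableT_comp.
  have mhp : measurable_fun setT (fun x => h (phi x)) by exact: measurableT_comp.
  under eq_integral do rewrite ge0_muleDl//.
  rewrite ge0_integralD//; first last.
  + by apply: emeasurable_funM => //; exact/measurable_EFinP.
  + by move=> x _; rewrite mule_ge0 ?lee_fin.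
  + by apply: emeasurable_funM => //; exact/measurable_EFinP.
  + by move=> x _; rewrite mule_ge0 ?lee_fin.
  under [RHS]eq_integral do rewrite ge0_muleDl//.
  rewrite [RHS]ge0_integralD//; first last.
  + by apply: emeasurable_funM => //; exact/measurable_EFinP.
  + by move=> x _; rewrite mule_ge0 ?lee_fin.
  + by apply: emeasurable_funM => //; exact/measurable_EFinP.
  + by move=> x _; rewrite mule_ge0 ?lee_fin.
  by rewrite fE hE.
- have lM (u : nat -> \bar R) (a : R) : nondecreasing_seq u -> 0 <= a ->
      (limn u * a%:E = limn (fun k => u k * a%:E))%E.
    move=> nu a0; apply/esym/cvg_lim => //; apply: cvgeZr => //.
    exact: ereal_nondecreasing_is_cvgn.
  under eq_integral do rewrite (lM (fun k => f_ k _) _ (nf _) (F0 _)).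
  under [RHS]eq_integral do rewrite (lM (fun k => f_ k _) _ (nf _) (w0 _)).
  rewrite !monotone_convergence//; last 6 first.
  + move=> k; apply: emeasurable_funM => //; exact/measurable_EFinP.
  + by move=> k x _; rewrite mule_ge0 ?lee_fin.
  + by move=> x _ k l kl; rewrite lee_wpmul2r ?lee_fin//; exact: nf.
  + move=> k; apply: emeasurable_funM; last exact/measurable_EFinP.
    exact: measurableT_comp.
  + by move=> k x _; rewrite mule_ge0 ?lee_fin.
  + by move=> x _ k l kl; rewrite lee_wpmul2r ?lee_fin//; exact: nf.
  by congr (limn _); apply/funext => k; exact: fE.
Qed.

Lemma fiber_density_ae_ge0 (w : Y -> \bar R) : mu.-integrable setT w ->
  (forall A, measurable A -> 0 <= \int[mu]_(y in A) w y)%E -> {ae mu, forall y, (0 <= w y)%E}.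
Proof.
move=> iw w0; have mw := measurable_int _ iw.
pose A := [set y | (w y < 0)%E].
have mA : measurable A by rewrite -[A]setTI; exact: emeasurable_fun_infty_o.
have iwA : mu.-integrable A w by exact: integrableS iw.
have : (\int[mu]_(y in A) `|w y| = 0)%E.
  apply/eqP; rewrite eq_le integral_ge0 ?andbT//.
  have -> : (\int[mu]_(y in A) `|w y| = \int[mu]_(y in A) - w y)%E.
    by apply: eq_integral => y; rewrite inE => wy; rewrite lte0_abs.
  by rewrite integralN ?oppe_le0 ?w0//; exact: integrable_add_def.
move=> /ae_eq_integral_abs => /(_ mA (measurable_int _ iwA)).
apply: filterS => y /= wy; rewrite leNgt; apply/negP => wy0.
by move: (wy0); rewrite (wy wy0) ltxx.
Qed.

(** [w] is the conditional expectation of [F] along [phi]: the measure A -> int_{phi^-1 A} F dV is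
    at most B mu(A), so it has a density with respect to [mu]. *)
Lemma exists_fiber_density (F : X -> R) (B : R) : measurable_fun setT F -> 
  0 <= B -> (forall x, 0 <= F x <= B) ->
  exists w : Y -> R, [/\ measurable_fun setT w, forall y, 0 <= w y <= B &
    forall f : Y -> \bar R, measurable_fun setT f -> (forall y, 0 <= f y)%E ->
      (\int[V]_x (f (phi x) * (F x)%:E) = \int[mu]_y (f y * (w y)%:E))%E].
Proof.
move=> mF B0 FB.
have iF : V.-integrable setT (EFin \o F).
  apply: (bounded_integrable (M := B)) => //.
  by move=> x _; have /andP[F0 FB'] := FB x; rewrite ger0_norm.
have mufin : fin_num_fun mu.
  move=> A mA; rewrite ge0_fin_numE// muE//; apply: le_lt_trans Vfin.
  by rewrite le_measure ?inE//; exact: mpre.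
have sfin := fin_num_fun_sigma_finite (mu := mu) ltac:(by rewrite measure0) mufin.
pose mu' := HB.pack_for {sigma_finite_measure set Y ->
  \bar R} (Measure.sort mu) (isSFinite.Build _ _ _ _ (sfinite_measure_sigma_finite sfin))
  (isSigmaFinite.Build _ _ _ _ sfin).
pose nu (A : set Y) := (\int[V]_(x in phi @^-1` A) (F x)%:E)%E.
have nu0 : nu set0 = 0%E by rewrite /nu preimage_set0 integral_set0.
have nufin A : measurable A -> nu A \is a fin_num.
  by move=> mA; apply: integrable_fin_num; [exact: mpre|apply: integrableS iF => //; exact: mpre].
have nusig : semi_sigma_additive nu.
  move=> G mG tG mUG; rewrite /nu preimage_bigcup.
  apply: (@semi_sigma_additive_nng_induced _ _ _ V (EFin \o F)).
  - exact/measurable_EFinP.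
  - by move=> x; rewrite lee_fin; case/andP: (FB x).
  - by move=> k; exact: mpre.
  - apply/trivIsetP => /= i j _ _ ij; rewrite -preimage_setI.
    by move/trivIsetP : tG => /(_ _ _ _ _ ij) ->//; rewrite preimage_set0.
  - by rewrite -preimage_bigcup; exact: mpre.
pose nu' := HB.pack_for (charge Y R) nu (isCharge.Build _ _ _ nu nu0 nufin nusig).
have nuB A : measurable A -> (0 <= nu A <= B%:E * mu A)%E.
  move=> mA; rewrite /nu integral_ge0/=; last first.
    by move=> x _; rewrite lee_fin; case/andP: (FB x).
  rewrite muE// -integral_cst; last exact: mpre.
  apply: ge0_le_integral => //.
  - exact: mpre.
  - by move=> x _; rewrite lee_fin; case/andP: (FB x).
  - by apply: measurable_funTS; exact/measurable_EFinP.
  - by move=> x _; rewrite lee_fin; case/andP: (FB x).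
have dom : nu' `<< mu'.
  apply/null_content_dominatesP => A mA muA; apply/eqP.
  have /andP[h0 h1] := nuB A mA; rewrite eq_le h0 andbT.
  by move: h1; rewrite [mu A]muA mule0.
have iw := Radon_Nikodym_integrable dom.
have wE A : measurable A -> nu A = (\int[mu]_(y in A) Radon_Nikodym nu' mu' y)%E.
  by move=> mA; exact: (Radon_Nikodym_integral dom mA).
have wfin y := Radon_Nikodym_fin_num y dom.
pose w y := fine (Radon_Nikodym nu' mu' y).
have mw0 : measurable_fun setT w.
  by apply: measurableT_comp => //; exact: measurable_int iw.
have iw' : mu.-integrable setT (EFin \o w).
  by apply: eq_integrable iw => // y _; rewrite /= fineK.
have w0 : {ae mu, forall y, (0 <= (w y)%:E)%E}.
  apply: fiber_density_ae_ge0 iw' _ => A mA.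
  have /andP[+ _] := nuB A mA; rewrite wE//; congr (_ <= _)%E.
  by apply: eq_integral => y _; rewrite /= fineK.
have icB : mu.-integrable setT (EFin \o cst B).
  by apply: (bounded_integrable (M := B)) => //; [rewrite -ge0_fin_numE ?mufin|move=> y _;
    rewrite ger0_norm].
have w1 : {ae mu, forall y, (0 <= (B - w y)%:E)%E}.
  apply: (@fiber_density_ae_ge0 (fun y => (B - w y)%:E)).
    by have := integrableB measurableT icB iw'; apply: eq_integrable => // y _.
  move=> A mA.
  rewrite (_ : (\int[mu]_(y in A) _)%E = (\int[mu]_(y in A) (B%:E - (w y)%:E))%E);
    last exact: eq_integral.
  rewrite integralB//; last 2 first.
  - by apply: integrableS icB.
  - by apply: integrableS iw'.
  rewrite integral_cst// sube_ge0; last by rewrite fin_numM ?mufin// orbT.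
  have /andP[_] := nuB A mA; rewrite wE//; apply: le_trans.
  by rewrite le_eqVlt; apply/orP; left; apply/eqP; apply: eq_integral => y _; rewrite /= fineK.
(* The Radon-Nikodym density lies in [0, B] only almost everywhere; clamping makes the bound
   pointwise without changing integrals. *)
exists (fun y => Num.max 0 (Num.min B (w y))); split.
- by apply: measurable_maxr => //; exact: measurable_minr.
- by move=> y; rewrite le_max lexx/= ge_max B0 ge_min lexx.
- apply: density_extend => //.
  + by apply: measurable_maxr => //; exact: measurable_minr.
  + by move=> x; case/andP: (FB x).
  + by move=> y; rewrite le_max lexx.
  + move=> A mA; rewrite [LHS](wE A mA); apply: ae_eq_integral => //.
    * by apply: measurable_funTS; exact: measurable_int iw.
    * by apply: measurable_funTS; apply/measurable_EFinP; apply: measurable_maxr => //;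
      exact: measurable_minr.
    * apply: filterS2 w0 w1 => y; rewrite !lee_fin subr_ge0 => w0 w1 _.
      by rewrite (min_idPr w1) (max_idPr w0) fineK.
Qed.

Lemma Rintegral_fiber (f : Y -> R) (C : R) : measurable_fun setT f -> (forall y, `|f y| <= C) ->
  \int[V]_x f (phi x) = \int[mu]_y f y.
Proof.
move=> mf fC; have mfp : measurable_fun setT (fun x => f (phi x)) by exact: measurableT_comp.
have muT : (mu setT < +oo)%E by rewrite muE.
have iV (h : X -> R) c : measurable_fun setT h -> (forall x, `|h x| <= c) ->
    V.-integrable setT (EFin \o h) by move=> mh hc; apply: (bounded_integrable (M := c)).
have imu (h : Y -> R) c : measurable_fun setT h -> (forall x, `|h x| <= c) ->
    mu.-integrable setT (EFin \o h) by move=> mh hc; apply: (bounded_integrable (M := c)).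
have key (h : Y -> R) c : measurable_fun setT h -> (forall y, 0 <= h y <= c) ->
    \int[V]_x h (phi x) = \int[mu]_y h y.
  move=> mh h0; rewrite /Rintegral; congr fine.
  rewrite (eq_integral (fun x => (h (phi x))%:E * 1%:E)%E); last by move=> x _; rewrite mule1.
  rewrite [RHS](eq_integral (fun x => (h x)%:E * 1%:E)%E); last by move=> x _; rewrite mule1.
  apply: (@density_extend (fun=> 1) (fun=> 1) _ _ _ _ _ (EFin \o h)) => //.
  - by move=> A mA; rewrite !integral_cst ?mul1e -?muE//; exact: mpre.
  - exact/measurable_EFinP.
  - by move=> y; rewrite lee_fin; case/andP: (h0 y).
have fC' y : 0 <= f y + C <= 2 * C.
  by have := fC y; rewrite ler_norml => /andP[]; move: (f y) => a; lra.
have ifp := iV _ _ mfp (fun x => fC (phi x)).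
have icV := iV (cst C) `|C| (measurable_cst _) (fun=> lexx _).
have icmu := imu (cst C) `|C| (measurable_cst _) (fun=> lexx _).
have := key _ _ (measurable_funD mf (measurable_cst C)) fC'.
rewrite (RintegralD measurableT ifp icV) (RintegralD measurableT (imu _ _ mf fC) icmu).
by rewrite !Rintegral_cst// muE// preimage_setT => /addIr.
Qed.

(** F + B is nonnegative with values at most 2B; subtracting B from its density brings the bound
    back to |w| <= B. Test functions are shifted by their own bound in the same way. *)
Lemma exists_signed_fiber_density (F : X -> R) (B : R) : measurable_fun setT F ->
  0 <= B -> (forall x, `|F x| <= B) ->
  exists w : Y -> R, [/\ measurable_fun setT w, forall y, `|w y| <= B &
    forall (f : Y -> R) (C : R), measurable_fun setT f -> (forall y, `|f y| <= C) ->
      \int[V]_x (f (phi x) * F x) = \int[mu]_y (f y * w y)].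
Proof.
move=> mF B0 FB.
have FB' x : 0 <= F x + B <= 2 * B.
  by have := FB x; rewrite ler_norml => /andP[]; move: (F x) => a; lra.
have [w [mw wB wE]] := exists_fiber_density (measurable_funD mF (measurable_cst B)) (mulr_ge0
  (ler0n R 2) B0) FB'.
exists (fun y => w y - B); split.
- exact: measurable_funB.
- by move=> y; have := wB y; rewrite ler_norml => /andP[]; move: (w y) => a; lra.
move=> f C mf fC.
have muT : (mu setT < +oo)%E by rewrite muE.
have mfp : measurable_fun setT (fun x => f (phi x)) by exact: measurableT_comp.
have iV (h : X -> R) c : measurable_fun setT h -> (forall x, `|h x| <= c) ->
    V.-integrable setT (EFin \o h) by move=> mh hc; apply: (bounded_integrable (M := c)).
have imu (h : Y -> R) c : measurable_fun setT h -> (forall x, `|h x| <= c) ->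
    mu.-integrable setT (EFin \o h) by move=> mh hc; apply: (bounded_integrable (M := c)).
have fC' y : 0 <= f y + C <= 2 * C.
  by have := fC y; rewrite ler_norml => /andP[]; move: (f y) => a; lra.
have iF := iV F B mF FB.
have iw : mu.-integrable setT (EFin \o w).
  by apply: (imu _ (2 * B)) => // y; rewrite ger0_norm; case/andP: (wB y).
have ifF : V.-integrable setT (EFin \o (fun x => f (phi x) * F x)).
  by apply: (integrable_mul (C := C)).
have ifw : mu.-integrable setT (EFin \o (fun x => f x * w x)).
  by apply: (integrable_mul (C := C)).
have ifp := iV _ _ mfp (fun x => fC (phi x)).
have iff := imu _ _ mf fC.
have key (h : Y -> R) : measurable_fun setT h -> (forall y, 0 <= h y) ->
    \int[V]_x (h (phi x) * (F x + B)) = \int[mu]_y (h y * w y).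
  move=> mh h0; rewrite /Rintegral; congr fine.
  by apply: (wE (EFin \o h)) => //; exact/measurable_EFinP.
have e1 := key _ (measurable_cst C) (fun y => le_trans (normr_ge0 _) (fC y)).
have e2 := key _ (measurable_funD mf (measurable_cst C)) (fun y => proj1 (andP (fC' y))).
have e3 := Rintegral_fiber mf fC.
have iFB : V.-integrable setT (EFin \o (fun x => F x + B)).
  by apply: (iV _ (2 * B)); [exact: measurable_funD|move=> x; rewrite ger0_norm;
    case/andP: (FB' x)].
have ifFB : V.-integrable setT (EFin \o (fun x => f (phi x) * (F x + B))).
  by apply: (integrable_mul (C := C)).
have e4 : \int[V]_x (f (phi x) * (F x + B)) = \int[mu]_y (f y * w y).
  move: e2; rewrite (eq_Rintegral V (g := fun x => f (phi x) * (F x + B) + C * (F x + B)));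
    last first.
    by move=> x _; rewrite mulrDl.
  rewrite (eq_Rintegral mu (g := fun x => f x * w x + C * w x)); last by move=> x _;
    rewrite mulrDl.
  rewrite RintegralD//; last first.
    by apply: (integrable_mul (C := `|C|)).
  rewrite RintegralD//; last by apply: (integrable_mul (C := `|C|)).
  by rewrite [X in _ + X = _]e1 => /addIr.
have -> : \int[V]_x (f (phi x) * F x) = \int[V]_x (f (phi x) * (F x + B) - B * f (phi x)).
  by apply: eq_Rintegral => x _; rewrite mulrDr mulrC [B * _]mulrC addrK.
rewrite RintegralB//; last by apply: (integrable_mul (C := `|B|)).
have -> : \int[mu]_y (f y * (w y - B)) = \int[mu]_y (f y * w y - B * f y).
  by apply: eq_Rintegral => x _; rewrite mulrBr [B * _]mulrC.
rewrite RintegralB//; last by apply: (integrable_mul (C := `|B|)).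
by rewrite e4 !RintegralZl// e3.
Qed.

End BaseDensity.

(** * The normal part of the first variation *)

(** The image of an ultrafilter is an ultrafilter on a compact interval. All bounded sequences get a
    limit at once, additively and monotonically, with no extraction of subsequences. *)
Lemma ultra_bounded_cvg {R : realType} {I : Type} (U : set_system I) (u : I -> R) (C : R) :
  UltraFilter U -> (forall i, `|u i| <= C) -> cvg (u i @[i --> U]).
Proof.
move=> UU uC; have PU : ProperFilter U by exact: ultra_proper.
have := @segment_compact R (- C) C; rewrite compact_ultra => /(_ (u @ U)).
case.
- split; first exact: fmap_proper_filter.
  move=> G PG UG; rewrite eqEsubset; split => A GA; last exact: UG GA.
  have [//|UA] := in_ultra_setVsetC (u @^-1` A) UU.
  have GCA : G (~` A) by exact: UG UA.
  have G0 : G (A `&` ~` A) by exact: filterI.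
  by rewrite setICr in G0; have := @filter_not_empty _ G PG G0.
- apply: (@filterS _ U _ setT) => [i _|]; last exact: filterT.
  by rewrite /= in_itv/= -ler_norml.
- by move=> l [_ ul]; apply/cvg_ex; exists l.
Qed.

Section NormalPart.
Context {R : realType} {n : nat}.
Local Notation E := 'rV[R]_n.+1.
Local Notation M := 'M[R]_n.+1.
Variables (Omega : set E) (m : nat) (V : {measure set (borel (E * M)%type) -> \bar R}).
Hypothesis dO : bounded_C2_domain Omega.
Hypothesis isV : is_varifold Omega m V.
Variables (g : E -> R) (N : E -> E) (W : set E) (H : E -> E).
Hypothesis Cg : isC2 setT g.
Hypothesis g_gt0 : forall x, Omega x -> 0 < g x.
Hypothesis g_eq0 : forall x, frontier Omega x -> g x = 0.
Hypothesis KW : closure Omega `<=` W.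
Hypothesis CN : isC1_field W N.
Hypothesis N_grad : forall x, W x -> exists2 k, 0 < k & N x = k *: grad g x.
Local Notation K := (closure Omega).
Local Notation S := (frontier Omega).
Local Notation D := (plane_bundle m K : set (borel (E * M)%type)).
Local Notation mu := (base_measure V : {measure set (borel E) -> \bar R}).
Local Notation cK f := {within K, continuous (f : E -> R)}.
Local Notation cD f := {within plane_bundle m K, continuous (f : (E * M)%type -> R)}.
Hypothesis iH : forall i, mu.-integrable (K : set (borel E)) (fun x : borel E => (H x 0 i)%:E).
Hypothesis Hvar : forall phi, C1_closure Omega phi -> (forall x, S x -> phi x = 0) ->
  first_variation Omega m V phi = - (\int[mu]_(x in K) dot (H x) (phi x)).

Let oO : open Omega. Proof. by case: dO. Qed.
Let cptK : compact K. Proof. by case: dO => _ _ _ bO _; exact: closure_bounded_compact. Qed.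
Let rV : radon V. Proof. by case: isV. Qed.
Let nullV : V (~` D) = 0%E. Proof. by case: isV. Qed.
Let mK : measurable (K : set (borel E)). Proof. exact: base_measurable. Qed.
Let mD : measurable D. Proof. exact: bundle_measurable. Qed.
Let OK : Omega `<=` K. Proof. exact: subset_closure. Qed.
Let SK x : S x -> K x. Proof. by case. Qed.
Let iD f : cD f -> V.-integrable D (EFin \o (f : borel (E * M)%type -> R)).
Proof. exact: bundle_integrable. Qed.

Let g_ge0 x : K x -> 0 <= g x.
Proof.
move=> Kx; have [/g_gt0/ltW//|Ox] := pselect (Omega x).
by rewrite g_eq0//; apply/frontierP.
Qed.

Let g_up1 : up1 Omega g (grad g).
Proof. by apply: (isC1_up1 (@subsetT _ _) Cg.1). Qed.

Let N_upV : upV Omega N (jac N).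
Proof. exact: isC1_field_upV KW CN. Qed.

Let cN i : cK (fun x => N x 0 i). Proof. by have [] := N_upV i. Qed.
Let cJ i j : cK (fun x => jac N x i j). Proof. exact: upV_jac_continuous N_upV. Qed.
Let cgrad i : cK (fun x => grad g x 0 i). Proof. by have [_ _] := g_up1. Qed.

(** This is div_P (f N) for [c] the gradient of [f], in a form that is continuous up to the
    frontier. *)
Definition normal_div (f : E -> R) (c : E -> E) (y : E * M) : R :=
  f y.1 * \tr (y.2 *m jac N y.1) + dot (N y.1 *m y.2) (c y.1).

Lemma normal_div_continuous f c : up1 Omega f c -> cD (normal_div f c).
Proof.
move=> [cf _ cc]; apply: withinD; last exact: within_dot_proj.
by apply: withinM; [exact: (within_fst cf)|exact: within_trace].
Qed.

Lemma trace_outer (P : M) (u v : E) : \tr (P *m (u^T *m v)) = dot (v *m P) u.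
Proof. by rewrite mulmxA mxtrace_mulC mulmxA dot_mulmxE [LHS]/mxtrace big_ord1. Qed.

Lemma pdiv_normal f c y : up1 Omega f c -> D y ->
  Defs.pdiv Omega (fun x => f x *: N x) y.2 y.1 = normal_div f c y.
Proof.
move=> fc [Ky _]; rewrite /Defs.pdiv (upV_ext_jacobian (upV_scale fc N_upV) Ky).
by rewrite mulmxDr -scalemxAr mxtraceD mxtraceZ trace_outer.
Qed.

Lemma first_variation_normal f c : up1 Omega f c ->
  first_variation Omega m V (fun x => f x *: N x) = \int[V]_(y in D) normal_div f c y.
Proof.
by move=> fc; apply: eq_Rintegral => y; rewrite inE => Dy; exact: pdiv_normal.
Qed.

(** By [normal_defectE] it is k |P(grad g)|^2 with k > 0: it measures how far the plane is from
    being tangent to the level sets of [g]. *)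
Definition normal_defect (y : E * M) : R := dot (N y.1 *m y.2) (grad g y.1).

Lemma normal_defect_continuous : cD normal_defect.
Proof. exact: within_dot_proj. Qed.

Lemma normal_defectE y : D y -> exists2 k, 0 < k &
  normal_defect y = k * enorm (grad g y.1 *m y.2) ^+ 2.
Proof.
move=> [Ky [PT PP _]]; have [k k0 Nk] := N_grad (KW Ky); exists k => //.
rewrite /normal_defect Nk -scalemxAl dotZl enorm_sqr; congr (_ * _).
by rewrite [RHS]dot_mulmx PT -mulmxA PP dotC [RHS]dotC -[in LHS]PT -dot_mulmx.
Qed.

Lemma normal_defect_ge0 y : D y -> 0 <= normal_defect y.
Proof. by move=> /normal_defectE[k k0 ->]; rewrite mulr_ge0 ?sqr_ge0// ltW. Qed.

(* [ramp h] vanishes on [S] and increases to the indicator of [Omega] as [h] decreases to 0. *)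
Definition ramp (h : R) (x : E) : R := 1 - h * (g x + h)^-1.
Definition ramp_slope (h : R) (x : E) : R := h * (g x + h)^-1 ^+ 2.

Lemma ramp_bound h x : 0 < h -> K x -> 0 <= ramp h x <= 1.
Proof.
move=> h0 Kx; have gh : 0 < g x + h by rewrite ltr_wpDl// g_ge0.
rewrite /ramp subr_ge0 ler_pdivrMr// mul1r lerDr g_ge0//=.
by rewrite lerBlDr lerDl mulr_ge0 ?invr_ge0 ?ltW.
Qed.

Lemma ramp_frontier h x : 0 < h -> S x -> ramp h x = 0.
Proof. by move=> h0 Sx; rewrite /ramp g_eq0// add0r mulfV ?subrr// gt_eqF. Qed.

Lemma ramp_up1 h : 0 < h -> up1 Omega (ramp h) (fun x => ramp_slope h x *: grad g x).
Proof.
move=> h0; have gh x : K x -> g x + h != 0 by move=> Kx; rewrite gt_eqF// ltr_wpDl// g_ge0.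
apply: (up1_comp (h := fun t => 1 - h * (t + h)^-1) (dh := fun t => h * (t + h)^-1 ^+ 2) g_up1).
- move=> x Kx.
  have d1 : is_derive (g x) 1 (fun t : R => t + h) 1.
    have := is_deriveD (is_derive_id (g x) (1 : R)) (is_derive_cst h (g x) (1 : R)).
    by rewrite addr0.
  have := @is_deriveV R (fun t => t + h) (g x) 1 1 (gh x Kx) d1;
    rewrite [_ *: 1]mulr1 -exprVn => d2.
  have := is_deriveB (is_derive_cst (1 : R) (g x) (1 : R)) (is_deriveZ h d2).
  by rewrite sub0r scalerN opprK.
- move=> x Kx; have ci : {for g x, continuous (fun t : R => (t + h)^-1)}.
    apply: cvgV; first exact: gh.
    by apply: cvgD; [exact: cvg_id|exact: cvg_cst].
  apply: (@continuousM R R (cst h) (fun t => (t + h)^-1 ^+ 2)); first exact: cst_continuous.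
  exact: (@continuousM R R (fun t => (t + h)^-1) (fun t => (t + h)^-1)).
Qed.

Lemma ramp_slope_continuous h : 0 < h -> cK (ramp_slope h).
Proof.
move=> h0; have [cg _ _] := g_up1.
have gh x : K x -> g x + h != 0 by move=> Kx; rewrite gt_eqF// ltr_wpDl// g_ge0.
apply: (cK_comp (h := fun t => h * (t + h)^-1 ^+ 2) cg) => x Kx.
have ci : {for g x, continuous (fun t : R => (t + h)^-1)}.
  apply: cvgV; first exact: gh.
  by apply: cvgD; [exact: cvg_id|exact: cvg_cst].
apply: (@continuousM R R (cst h) (fun t => (t + h)^-1 ^+ 2)); first exact: cst_continuous.
exact: (@continuousM R R (fun t => (t + h)^-1) (fun t => (t + h)^-1)).
Qed.

Let ramp_continuous h : 0 < h -> cK (ramp h).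
Proof. by move=> h0; have [] := ramp_up1 h0. Qed.

Let ramp_norm h x : 0 < h -> K x -> `|ramp h x| <= 1.
Proof. by move=> h0 Kx; have /andP[r0 r1] := ramp_bound h0 Kx; rewrite ger0_norm. Qed.

Lemma dot_H_integrable (c : E -> E) : (forall i, cK (fun x => c x 0 i)) ->
  mu.-integrable (K : set (borel E)) (EFin \o (fun x : borel E => dot (H x) (c x))).
Proof.
move=> cc; apply: integrable_big => // i.
have [B _ cB] := within_bounded cptK (cc i).
have := integrable_mul mK (iH i) (within_measurable mK (cc i)) cB.
by apply: eq_integrable => // x _; rewrite /= mulrC.
Qed.

Let iHN : mu.-integrable (K : set (borel E)) (EFin \o (fun x : borel E => dot (H x) (N x))).
Proof. exact: dot_H_integrable. Qed.

Let imul f (F : borel E -> R) : cK f -> mu.-integrable (K : set (borel E)) (EFin \o F) ->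
  mu.-integrable (K : set (borel E)) (EFin \o (fun x : borel E => f x * F x)).
Proof.
move=> cf iF; have [B _ fB] := within_bounded cptK cf.
exact: integrable_mul mK iF (within_measurable mK cf) fB.
Qed.

(** The part of the first variation of [ramp h * f * N] in which the derivative falls on [ramp h];
    as h tends to 0 it concentrates on the frontier. *)
Definition slope_mass (h : R) (f : E -> R) : R :=
  \int[V]_(y in D) (f y.1 * (ramp_slope h y.1 * normal_defect y)).

Let slope_continuous h f : 0 < h -> cK f ->
  cD (fun y => f y.1 * (ramp_slope h y.1 * normal_defect y)).
Proof.
move=> h0 cf; apply: withinM; first exact: (within_fst cf).
by apply: withinM; [exact: (within_fst (ramp_slope_continuous h0))|exact:
  normal_defect_continuous].
Qed.

(** The field [ramp h * f * N] vanishes on [S], so the identity has no boundary term. On the right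
    only [ramp h] itself occurs, with values in [0, 1], and this gives bounds uniform in [h] as well
    as convergence. *)
Lemma slope_massE h f c : 0 < h -> up1 Omega f c ->
  slope_mass h f = - (\int[mu]_(x in K) (ramp h x * (f x * dot (H x) (N x)))) -
    \int[V]_(y in D) (ramp h y.1 * normal_div f c y).
Proof.
move=> h0 fc; have fac := up1M (ramp_up1 h0) fc.
have cf : cK f by case: fc.
have := Hvar (upV_C1_closure (upV_scale fac N_upV)).
rewrite (first_variation_normal fac) => HV.
rewrite (_ : \int[mu]_(x in K) _ = \int[mu]_(x in K) dot (H x) ((ramp h x * f x) *: N x)).
  rewrite -HV => [|x Sx]; last by rewrite ramp_frontier// mul0r scale0r.
  apply/eqP; rewrite eq_sym subr_eq /slope_mass -RintegralD//; last 2 first.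
  - by apply: iD; exact: slope_continuous.
  - apply: iD; apply: withinM; last exact: normal_div_continuous.
    exact: (within_fst (ramp_continuous h0)).
  apply/eqP; apply: eq_Rintegral => y _; rewrite /normal_div /normal_defect dotDr !dotZr.
  by ring.
by apply: eq_Rintegral => x _; rewrite dotZr mulrA.
Qed.

Let one_up1 : up1 Omega (fun=> 1) (fun=> 0).
Proof. exact: up1_cst. Qed.

Definition slope_bound : R := \int[mu]_(x in K) `|dot (H x) (N x)| +
  \int[V]_(y in D) `|normal_div (fun=> 1) (fun=> 0) y|.

Lemma slope_mass1_bound h : 0 < h -> `|slope_mass h (fun=> 1)| <= slope_bound.
Proof.
move=> h0; rewrite (slope_massE h0 one_up1) -opprD normrN.
apply: le_trans (ler_normD _ _) _; apply: lerD.
- apply: le_Rintegral_norm => //.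
  + by apply: imul; [exact: ramp_continuous|apply: imul => //; exact: within_cst].
  + exact: integrable_norm.
  + by move=> x Kx; rewrite mul1r normrM ler_piMl// ramp_norm.
- have iq : V.-integrable D (EFin \o normal_div (fun=> 1) (fun=> 0)).
    by apply: iD; exact: normal_div_continuous.
  apply: le_Rintegral_norm => //.
  + apply: iD; apply: withinM; last exact: normal_div_continuous.
    exact: (within_fst (ramp_continuous h0)).
  + exact: integrable_norm.
  + by move=> y [Ky _]; rewrite normrM ler_piMl// ramp_norm.
Qed.

Let slope_ge0 h y : 0 < h -> D y -> 0 <= ramp_slope h y.1 * normal_defect y.
Proof.
move=> h0 Dy; rewrite mulr_ge0 ?normal_defect_ge0// /ramp_slope mulr_ge0 ?sqr_ge0//.
exact: ltW.
Qed.

(** Because the slope term is nonnegative, the case f = 1 controls every [f], with no derivative of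
    [f] involved. *)
Lemma slope_mass_bound h f (B : R) : 0 < h -> cK f -> (forall x, K x -> `|f x| <= B) ->
  `|slope_mass h f| <= B * slope_bound.
Proof.
move=> h0 cf fB.
have c1 := slope_continuous h0 (@within_cst R E K 1).
(* A negative bound of an absolute value is possible only if [K] is empty. *)
have [B0|B0] := leP 0 B; last first.
  have D0 : D = set0.
    apply/seteqP; split => // y [Ky _].
    by have := le_lt_trans (fB _ Ky) B0; rewrite ltNge normr_ge0.
  rewrite /slope_mass D0 Rintegral_set0 normr0 /slope_bound D0 Rintegral_set0 addr0.
  have K0 : K = set0.
    by apply/seteqP; split => // x Kx; have := le_lt_trans (fB _ Kx) B0; rewrite ltNge normr_ge0.
  by rewrite K0 Rintegral_set0 mulr0.
apply: (@le_trans _ _ (\int[V]_(y in D) (B * (1 * (ramp_slope h y.1 * normal_defect y))))).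
  apply: le_Rintegral_norm => //.
  - by apply: iD; exact: slope_continuous.
  - apply: iD; apply: withinM c1; exact: within_cst.
  - move=> y Dy; rewrite normrM mul1r (ger0_norm (slope_ge0 h0 Dy)) ler_wpM2r ?slope_ge0//.
    by apply: fB; case: Dy.
rewrite RintegralZl//; last exact: iD.
rewrite ler_wpM2l//; apply: le_trans (ler_norm _) _; exact: slope_mass1_bound.
Qed.

Let mS : measurable (S : set (borel E)). Proof. by apply: closed_borel;
  exact: frontier_closed. Qed.
Let mO : measurable (Omega : set (borel E)). Proof. exact: open_borel. Qed.
Let mDS : measurable (plane_bundle m S : set (borel (E * M)%type)).
Proof. by apply: plane_bundle_measurable; exact: frontier_closed. Qed.

Lemma normal_defect_frontier : \int[V]_(y in plane_bundle m S) normal_defect y = 0.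
Proof.
have idef : V.-integrable D (EFin \o (normal_defect : borel (E * M)%type -> R)).
  by apply: iD; exact: normal_defect_continuous.
have SD : plane_bundle m S `<=` plane_bundle m K by move=> y [/SK].
have idefS := integrableS mD mDS SD idef.
apply/eqP; rewrite eq_le; apply/andP; split; last first.
  by apply: Rintegral_ge0 => y /SD; exact: normal_defect_ge0.
apply/ler_addgt0Pr => e e0; rewrite add0r.
have b0 : 0 <= slope_bound by apply: le_trans (slope_mass1_bound ltr01); exact: normr_ge0.
pose h := e / (slope_bound + 1).
have h0 : 0 < h by rewrite divr_gt0// ltr_wpDl.
have := le_trans (ler_norm _) (slope_mass1_bound h0).
have is1 := iD (slope_continuous h0 (@within_cst R E K 1)).
(* On [S], g = 0 and the slope is h / h^2 = 1/h, so the integral of the defect is at most h times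
   [slope_bound]; the choice of [h] makes this at most [e]. *)
have : \int[V]_(y in plane_bundle m S) (h^-1 * normal_defect y) <= slope_mass h (fun=> 1).
  have -> : \int[V]_(y in plane_bundle m S) (h^-1 * normal_defect y) =
      \int[V]_(y in plane_bundle m S) (1 * (ramp_slope h y.1 * normal_defect y)).
    apply: eq_Rintegral => y; rewrite inE => -[Sy _]; rewrite mul1r /ramp_slope g_eq0//.
    by rewrite add0r expr2 mulrA mulfV ?mul1r// gt_eqF.
  rewrite /slope_mass -[in leLHS](setIidr SD).
  rewrite Rintegral_setI_indic//; apply: le_Rintegral => //.
    apply: (integrable_mul (C := 1) mD is1); first exact: measurable_indic.
    by move=> y _; exact: indic_norm_le1.
  move=> y Dy; apply: ler_piMl; first by rewrite mul1r slope_ge0.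
  by rewrite indicE; case: (_ \in _).
rewrite RintegralZl// => h1 h2; have := le_trans h1 h2.
rewrite ler_pdivrMl// => /le_trans; apply.
by rewrite /h mulrAC ler_pdivrMr ?ltr_wpDl// ler_wpM2l ?lerDl// ltW.
Qed.

(* On [S] the slope of [ramp h] is 1/h, so the bound on [slope_mass] forces
   <N P, grad g> = k |P (grad g)|^2 to have zero integral over [S]. *)
Lemma frontier_plane_tangent :
  {ae V, forall y : borel (E * M)%type, plane_bundle m S y -> N y.1 *m y.2 = 0}.
Proof.
have SD : plane_bundle m S `<=` plane_bundle m K by move=> y [/SK].
have idef : V.-integrable D (EFin \o (normal_defect : borel (E * M)%type -> R)).
  by apply: iD; exact: normal_defect_continuous.
have idefS := integrableS mD mDS SD idef.
have /ae_eq_integral_abs : (\int[V]_(y in plane_bundle m S) `|(normal_defect y)%:E| = 0)%E.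
  have <- : (\int[V]_(y in plane_bundle m S) (normal_defect y)%:E = 0)%E.
    by rewrite -Rintegral_EFin// normal_defect_frontier.
  by apply: eq_integral => y; rewrite inE => /SD/normal_defect_ge0 ?; rewrite gee0_abs.
move=> /(_ mDS (measurable_int _ idefS)); apply: filterS => y /= def0 Sy.
have [k k0 kE] := normal_defectE (SD _ Sy).
have := def0 Sy; rewrite kE => -[/eqP];
  rewrite mulf_eq0 gt_eqF//= expf_eq0/= enorm_eq0 => /eqP gP.
have [k' _ ->] := N_grad (KW (SK Sy.1)).
by rewrite -scalemxAl gP scaler0.
Qed.

Let hk (k : nat) : R := k.+1%:R^-1.
Let hk0 k : 0 < hk k. Proof. by rewrite invr_gt0. Qed.
Let hk_cvg : hk k @[k --> \oo] --> 0. Proof. exact: cvg_harmonic. Qed.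

Let ramp_cvg x : K x -> ramp (hk k) x @[k --> \oo] --> (\1_Omega x : R).
Proof.
move=> Kx; rewrite indicE; have [/set_mem Ox|/negP Ox] := boolP (x \in Omega).
  rewrite -[X in _ --> X](_ : 1 - 0 * (g x + 0)^-1 = 1); last by rewrite mul0r subr0.
  apply: cvgB; first exact: cvg_cst.
  apply: cvgM => //; apply: cvgV; first by rewrite addr0 gt_eqF ?g_gt0.
  by apply: cvgD => //; exact: cvg_cst.
have Sx : S x by apply/frontierP => //; split => // Ox'; apply: Ox; rewrite inE.
rewrite (_ : (fun k => _) = fun=> 0); first exact: cvg_cst.
by apply/funext => k; rewrite ramp_frontier.
Qed.

Let slope_g_cvg x : K x -> g x * ramp_slope (hk k) x @[k --> \oo] --> (0 : R).
Proof.
move=> Kx; have [Ox|Ox] := pselect (Omega x).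
  rewrite -[X in _ --> X](_ : g x * (0 * (g x + 0)^-1 ^+ 2) = 0); last by rewrite mul0r mulr0.
  apply: cvgM; first exact: cvg_cst.
  apply: cvgM => //.
  have ci : (g x + hk k)^-1 @[k --> \oo] --> (g x + 0)^-1.
    apply: cvgV; first by rewrite addr0 gt_eqF ?g_gt0.
    by apply: cvgD => //; exact: cvg_cst.
  exact: (@cvgM R nat \oo _ _ _ _ _ ci ci).
have Sx : S x by apply/frontierP.
rewrite (_ : (fun k => _) = fun=> 0); first exact: cvg_cst.
by apply/funext => k; rewrite g_eq0// mul0r.
Qed.

(** The limit of [slope_massE] as h tends to 0: [ramp h] becomes the indicator of [Omega]. *)
Definition normal_mass (f : E -> R) (c : E -> E) : R :=
  - (\int[mu]_(x in K) (\1_Omega x * (f x * dot (H x) (N x)))) -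
    \int[V]_(y in D) (\1_Omega y.1 * normal_div f c y).

Let m1O : measurable_fun D (fun y : borel (E * M)%type => \1_Omega y.1 : R).
Proof. exact: measurable_indic_base. Qed.

Lemma slope_mass_cvg f c : up1 Omega f c ->
  slope_mass (hk k) f @[k --> \oo] --> normal_mass f c.
Proof.
move=> fc; have cf : cK f by case: fc.
under eq_fun do rewrite (slope_massE (hk0 _) fc).
apply: cvgB; first apply: cvgN.
- apply: (@Rintegral_cvg_mul _ (borel E) R mu K (fun x => f x * dot (H x) (N x))
    (fun k => ramp (hk k)) \1_Omega mK).
  + exact: imul.
  + by move=> k; apply: within_measurable => //; exact: ramp_continuous.
  + exact: measurable_indic.
  + by move=> k x Kx; exact: ramp_norm.
  + exact: ramp_cvg.
- apply: (@Rintegral_cvg_mul _ (borel (E * M)%type) R V D (normal_div f c)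
    (fun k y => ramp (hk k) y.1) (fun y => \1_Omega y.1) mD).
  + by apply: iD; exact: normal_div_continuous.
  + by move=> k; apply: within_measurable => //; apply: within_fst; exact: ramp_continuous.
  + exact: m1O.
  + by move=> k y [Ky _]; exact: ramp_norm.
  + by move=> y [Ky _]; exact: ramp_cvg.
Qed.

(** The weight g h / (g + h)^2 is at most 1 and tends to 0 everywhere: inside because h does, on [S]
    because g = 0. Hence the limit functional annihilates [g], which is positive off the
    frontier. *)
Let slope_mass_g_cvg : slope_mass (hk k) g @[k --> \oo] --> (0 : R).
Proof.
have cg : cK g by case: g_up1.
have idef : V.-integrable D (EFin \o (normal_defect : borel (E * M)%type -> R)).
  by apply: iD; exact: normal_defect_continuous.
have := @Rintegral_cvg_mul _ _ _ V D normal_defect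
  (fun k y => g y.1 * ramp_slope (hk k) y.1) (fun=> 0) mD idef.
rewrite -[X in _ --> X](_ : \int[V]_(y in D) (0 * normal_defect y) = 0); last first.
  by rewrite (eq_Rintegral V (g := fun=> 0)) ?Rintegral_cst ?mul0r// => y _; rewrite mul0r.
rewrite (_ : (fun k => slope_mass _ _) = (fun k => \int[V]_(y in D) (g y.1 * ramp_slope (hk k)
  y.1 * normal_defect y))).
  apply.
  - move=> k; apply: within_measurable => //; apply: withinM; first exact: (within_fst cg).
    exact: (within_fst (ramp_slope_continuous (hk0 k))).
  - exact: measurable_cst.
  - move=> k y [Ky _]; have gy := g_ge0 Ky; have gh : 0 < g y.1 + hk k by rewrite ltr_wpDl.
    rewrite ger0_norm; last by rewrite mulr_ge0// mulr_ge0 ?sqr_ge0// ltW.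
    rewrite /ramp_slope mulrA exprVn ler_pdivrMr ?exprn_gt0// mul1r sqrrD.
    have := mulr_ge0 gy (ltW (hk0 k)); have := sqr_ge0 (g y.1); have := sqr_ge0 (hk k).
    by move: (g y.1) (hk k) => a b; lra.
  - by move=> y [Ky _]; exact: slope_g_cvg.
by apply/funext => k; apply: eq_Rintegral => y _; rewrite mulrA.
Qed.

(** For [f] of class C^1 up to the boundary the limit of [slope_mass] exists; for merely continuous
    [f] only boundedness is known, hence the ultrafilter. Being finer than [\oo], it returns the
    true limit whenever there is one. *)
Lemma exists_normal_measure : exists s : {measure set (borel E) -> \bar R},
  [/\ (s setT < +oo)%E, s (~` S) = 0%E,
      forall f c, up1 Omega f c -> \int[s]_(x in S) f x = normal_mass f c
    & forall (A : set E) f c, up1 Omega f c -> (forall x, K x -> 0 <= f x) ->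
        (forall x, A x -> K x -> 1 <= f x) -> (s A <= (normal_mass f c)%:E)%E].
Proof.
have [U [UU ooU]] := ultraFilterLemma (eventually_filter : ProperFilter \oo).
have PU : ProperFilter U by exact: ultra_proper.
have Lcvg f : cK f -> cvg (slope_mass (hk k) f @[k --> U]).
  move=> cf; have [B _ fB] := within_bounded cptK cf.
  by apply: (ultra_bounded_cvg UU) => k; exact: slope_mass_bound (hk0 k) cf fB.
pose L f := lim (slope_mass (hk k) f @[k --> U]).
have LP f l : slope_mass (hk k) f @[k --> \oo] --> l -> L f = l.
  move=> fl; apply: cvg_lim => //.
  by move=> B /fl; exact: ooU.
have LD f f' : cK f -> cK f' -> L (f \+ f') = L f + L f'.
  move=> cf cf'; apply: cvg_lim => //.
  rewrite (_ : (fun k => _) = fun k => slope_mass (hk k) f + slope_mass (hk k) f').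
    by apply: cvgD; exact: Lcvg.
  apply/funext => k; rewrite /slope_mass -RintegralD//; last 2 first.
  - by apply: iD; exact: slope_continuous.
  - by apply: iD; exact: slope_continuous.
  by apply: eq_Rintegral => y _; rewrite mulrDl.
have LZ a f : cK f -> L (fun x => a * f x) = a * L f.
  move=> cf; apply: cvg_lim => //.
  rewrite (_ : (fun k => _) = fun k => a * slope_mass (hk k) f).
    by apply: (@cvgM R nat U _ (fun=> a) (fun k => slope_mass (hk k) f));
      [exact: cvg_cst|exact: Lcvg].
  apply/funext => k; rewrite /slope_mass -RintegralZl//.
    by apply: eq_Rintegral => y _; rewrite -mulrA.
  by apply: iD; exact: slope_continuous.
have L0 f : cK f -> (forall x, K x -> 0 <= f x) -> 0 <= L f.
  move=> cf f0; apply: limr_ge; first exact: Lcvg.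
  apply: (@filterS _ U _ setT) => [k _|]; last exact: filterT.
  apply: Rintegral_ge0 => y Dy; rewrite mulr_ge0 ?slope_ge0//.
  by apply: f0; case: Dy.
have sep := @dist_separation R n.
have cK' : closed K by exact: closed_closure.
have [s [stot _ sint snull sle]] := riesz_markov cptK sep LD LZ L0 cK'.
have sS : s (~` S) = 0%E.
  apply: (snull _ g).
  - by case: g_up1.
  - exact: g_ge0.
  - exact: LP slope_mass_g_cvg.
  - move=> x Sx Kx; apply: g_gt0; apply: contrapT => Ox; apply: Sx.
    by apply/frontierP.
have sT : (s setT < +oo)%E by rewrite stot// ltry.
exists s; split => //.
- move=> f c fc; have cf : cK f by case: fc.
  rewrite -(LP _ _ (slope_mass_cvg fc)) -(sint _ cf).
  have sK : (s K < +oo)%E by apply: le_lt_trans sT; rewrite le_measure ?inE.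
  have ifs := within_integrable mK cptK sK cf.
  (* The representation is over [K]; since [s] gives no mass to [Omega], the integral reduces to one
     over [S]. *)
  have sO : s Omega = 0%E.
    apply/eqP; rewrite eq_le measure_ge0 andbT -sS le_measure ?inE//; first exact: measurableC.
    by move=> x Ox /(frontierP _ oO)[].
  rewrite /Rintegral (negligible_integral mO mK ifs sO); congr (fine (integral _ _ _)).
  by rewrite /frontier ((interior_id _).1 oO).
- move=> A f c fc f0 f1; have cf : cK f by case: fc.
  rewrite -(LP _ _ (slope_mass_cvg fc)).
  exact: sle.
Qed.

Hypothesis oW : open W.
Hypothesis N_normal : forall x, S x -> N x = inner_normal Omega x.
Local Notation B := (n.+1%:R * `|second_ff_norm Omega|).

Lemma wall_trace_bound : {ae V, forall y : borel (E * M)%type, plane_bundle m S y ->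
  `|\tr (y.2 *m jac N y.1)| <= B}.
Proof.
apply: filterS frontier_plane_tangent => y NP Sy; case: (Sy) => Sy1 [PT PP _].

apply: le_trans (trace_second_ff_bound dO oW KW CN N_normal Sy1 PT PP _) _.
  by rewrite -N_normal// NP.
by rewrite ler_wpM2l// ler_norm.
Qed.

(** The trace is a function of point and plane; [w] is its average over the planes above a point, so
    that its integrals against functions of the point can be taken with respect to the base
    measure. *)
Lemma exists_wall_curvature : exists w : borel E -> R,
  [/\ measurable_fun setT w, forall x, `|w x| <= B &
    forall f, cK f -> \int[V]_(y in plane_bundle m S) (f y.1 * \tr (y.2 *m jac N y.1)) =
      \int[mu]_(x in S) (f x * w x)].
Proof.
pose T y := \tr (y.2 *m jac N y.1) : R.
have SD : plane_bundle m S `<=` plane_bundle m K by move=> y [/SK].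
have mT : measurable_fun (plane_bundle m S : set (borel (E * M)%type)) T.
  apply: (measurable_funS mD SD); apply: within_measurable => //; exact: within_trace.
(* The trace is bounded by [B] only for almost every plane, whereas the density lemma asks for a
   bound everywhere. *)
pose cl (t : R) := Num.max (- B) (Num.min B t).
have B0 : 0 <= B by rewrite mulr_ge0.
have clB t : `|cl t| <= B.
  by rewrite ler_norml /cl le_max lexx/= ge_max ge_min lexx/= andbT ge0_cp.
have mclT : measurable_fun (plane_bundle m S : set (borel (E * M)%type)) (cl \o T).
  apply: measurable_maxr; first exact: measurable_cst.
  by apply: measurable_minr; [exact: measurable_cst|exact: mT].
pose F : borel (E * M)%type -> R := (cl \o T) \_ (plane_bundle m S).
have mF : measurable_fun setT F by apply/(measurable_restrictT _ mDS).
have FB y : `|F y| <= B by rewrite /F /patch; case: ifP => _; rewrite ?clB ?normr0.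
have VT : (V setT < +oo)%E.
  by rewrite (measure_bundle cptK nullV)// setIT; exact: bundle_finite.
have [w [mw wB wE]] := exists_signed_fiber_density (mu := mu) measurable_point_of (fun A _ =>
  erefl) VT mF B0 FB.
exists w; split => // f cf.
have [C /ltW C0 fC] := within_bounded cptK cf.
have mf : measurable_fun (S : set (borel E)) (f : borel E -> R).
  by apply: (measurable_funS mK) (within_measurable mK cf).
pose f' : borel E -> R := f \_ S.
have mf' : measurable_fun setT f' by apply/(measurable_restrictT _ mS).
have f'C x : `|f' x| <= C.
  by rewrite /f' /patch; case: ifPn => [/set_mem/SK/fC//|_]; rewrite normr0.
have := wE f' C mf' f'C.
rewrite [X in _ = X -> _](_ : _ = \int[mu]_(x in S) (f x * w x)); last first.
  rewrite [RHS]Rintegral_mkcond; apply: eq_Rintegral => x _.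
  by rewrite /f' /patch; case: ifP => // _; rewrite mul0r.
move=> <-.
rewrite /Rintegral; congr fine.
rewrite [LHS]integral_mkcond; apply: ae_eq_integral => //.
- apply/(measurable_restrictT _ mDS)/measurable_EFinP; apply: measurable_funM => //.
  by apply: (measurable_funS mD SD); apply: within_measurable => //; exact: within_fst.
- apply/measurable_EFinP; apply: measurable_funM => //.
  exact: measurableT_comp mf' measurable_point_of.
apply: filterS wall_trace_bound => y yB _.
rewrite /F /f' /patch /=; case: ifPn => [/set_mem Sy|_]; last by rewrite mulr0.
rewrite mem_set; last by case: Sy.
have := yB Sy; rewrite -/(T y) ler_norml => /andP[TB1 TB2].
by rewrite /cl (min_idPr TB2) (max_idPr TB1).
Qed.

Hypothesis H_tangent : {ae mu, forall x : borel E, S x -> tangent Omega x (H x)}.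

Lemma normal_div_frontier f c : up1 Omega f c ->
  \int[V]_(y in plane_bundle m S) normal_div f c y =
  \int[V]_(y in plane_bundle m S) (f y.1 * \tr (y.2 *m jac N y.1)).
Proof.
move=> fc; have SD : plane_bundle m S `<=` plane_bundle m K by move=> y [/SK].
have cf : cK f by case: fc.
rewrite /Rintegral; congr fine; apply: ae_eq_integral => //.
- apply/measurable_EFinP; apply: (measurable_funS mD SD); apply: within_measurable => //.
  exact: normal_div_continuous.
- apply/measurable_EFinP; apply: (measurable_funS mD SD); apply: within_measurable => //.
  by apply: withinM; [exact: (within_fst cf)|exact: within_trace].
apply: filterS frontier_plane_tangent => y NP Sy; rewrite /normal_div NP//.
by rewrite dot0l addr0.
Qed.

Lemma dot_H_normal_frontier f : cK f ->
  \int[mu]_(x in K) (\1_Omega x * (f x * dot (H x) (N x))) =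
  \int[mu]_(x in K) dot (H x) (f x *: N x).
Proof.
move=> cf.
rewrite /Rintegral; congr fine.
have mHN : measurable_fun (K : set (borel E)) (fun x => f x * dot (H x) (N x)).
  apply: measurable_funM; first exact: within_measurable.
  by apply/measurable_EFinP; exact: (measurable_int _ iHN).
apply: ae_eq_integral => //.
- by apply/measurable_EFinP; apply: measurable_funM => //; exact: measurable_indic.
- by apply/measurable_EFinP; apply: (eq_measurable_fun _ _ mHN) => x _; rewrite dotZr.
apply: filterS H_tangent => x Hx Kx; rewrite dotZr indicE; congr EFin.
have [|/negP Ox] := boolP (x \in Omega); first by rewrite mul1r.
have Sx : S x by apply/frontierP => //; split => // ?; apply: Ox; rewrite inE.
by rewrite N_normal// Hx// mulr0 mul0r.
Qed.

(** [normal_mass] contains the divergence over [Omega] only. What is missing is the divergence over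
    [S], where N P = 0 leaves just the trace, already rewritten with [w]. *)
Lemma first_variation_normalE f c (w : borel E -> R) (s : {measure set (borel E) -> \bar R}) :
  up1 Omega f c ->
  (\int[V]_(y in plane_bundle m S) (f y.1 * \tr (y.2 *m jac N y.1)) =
      \int[mu]_(x in S) (f x * w x)) ->
  \int[s]_(x in S) f x = normal_mass f c ->
  first_variation Omega m V (fun x => f x *: N x) =
    - (\int[mu]_(x in K) dot (H x) (f x *: N x)) + \int[mu]_(x in S) (f x * w x) -
    \int[s]_(x in S) f x.
Proof.
move=> fc wE sE; have cf : cK f by case: fc.
rewrite (first_variation_normal fc) sE /normal_mass dot_H_normal_frontier// -wE
  -(normal_div_frontier fc).
have ind : V.-integrable D (EFin \o (normal_div f c : borel (E * M)%type -> R)).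
  by apply: iD; exact: (normal_div_continuous fc).
have SD : plane_bundle m S `<=` plane_bundle m K by move=> y [/SK].
have -> : \int[V]_(y in D) normal_div f c y = 
    \int[V]_(y in D) (\1_(plane_bundle m S) y * normal_div f c y + \1_Omega y.1 * normal_div f c
      y).
  apply: eq_Rintegral => y; rewrite inE => -[Ky Py]; rewrite !indicE -mulrDl.
  have [/set_mem Oy|/negP Oy] := boolP (y.1 \in Omega).
    rewrite memNset ?add0r ?mul1r// => -[/(frontierP _ oO)[]//].
  rewrite mem_set ?addr0 ?mul1r//; split => //; apply/frontierP => //.
  by split => // Oy'; apply: Oy; rewrite inE.
rewrite RintegralD//.
- rewrite -Rintegral_setI_indic// (setIidr SD).
  by rewrite opprB opprK; ring.
- apply: (integrable_mul (C := 1) mD ind); first exact: measurable_indic.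
  by move=> y _; exact: indic_norm_le1.
- apply: (integrable_mul (C := 1) mD ind).
    exact: m1O.
  by move=> y _; exact: indic_norm_le1.
Qed.
End NormalPart.

(** * Disintegration and the boundary term *)

Section Disintegration.
Context d d1 d2 (T : measurableType d) (X : measurableType d1) (Y : measurableType d2) (R :
  realType).
Variables (G : {measure set T -> \bar R}) (sG : {measure set X -> \bar R}) (A0 : set X).
Variables (Gx : R.-pker X ~> Y) (proj : T -> X * Y).
Hypothesis mA0 : measurable A0.
Hypothesis mproj : measurable_fun setT proj.
Hypothesis disint : forall A, measurable A ->
  G (proj @^-1` A) = (\int[sG]_(x in A0) Gx x (xsection A x))%E.

Let mpre A : measurable A -> measurable (proj @^-1` A).
Proof. by move=> mA; rewrite -[X in measurable X]setTI; exact: mproj. Qed.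

Lemma ge0_disintegration (f : X * Y -> \bar R) : measurable_fun setT f ->
  (forall z, 0 <= f z)%E ->
  (\int[G]_y f (proj y) = \int[sG]_(x in A0) \int[Gx x]_z f (x, z))%E.
Proof.
have mint (h : X * Y -> \bar R) : measurable_fun setT h -> (forall z, 0 <= h z)%E ->
    measurable_fun A0 (fun x => \int[Gx x]_z h (x, z))%E.
  move=> mh h0; apply: measurable_funTS.
  by apply: measurable_fun_integral_sfinite_kernel.
move: f; apply: (@ge0_measurable_ind _ _ _ (fun f => \int[G]_y f (proj y) =
  \int[sG]_(x in A0) \int[Gx x]_z f (x,
    z))%E) => [r A r0 mA|f h mf mh f0 h0 fE hE|f_ mf f0 nf fE].
- have -> : (\int[G]_y (r * \1_A (proj y))%:E = r%:E * G (proj @^-1` A))%E.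
    rewrite -[in RHS](setIT (proj @^-1` A)) -integral_indic//; last exact: mpre.
    rewrite -ge0_integralZl//.
    by apply/measurable_EFinP; apply: measurable_indic; exact: mpre.
  rewrite disint// -ge0_integralZl//; last first.
    by apply: measurable_funTS; by apply: measurable_fun_xsection_finite_kernel; rewrite inE.
  apply: eq_integral => x _.
  rewrite -[in LHS](setIT (xsection A x)) -integral_indic//; last exact: measurable_xsection.
  rewrite -ge0_integralZl//; last first.
    by apply/measurable_EFinP; apply: measurable_indic; exact: measurable_xsection.
  apply: eq_integral => z _; rewrite -EFinM !indicE; congr (_ * _)%:E; congr (_%:R);
    congr nat_of_bool.
  by rewrite mem_xsection.
- rewrite ge0_integralD//; last 2 first.
  + exact: measurableT_comp mf mproj.
  + exact: measurableT_comp mh mproj.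
  rewrite fE hE -ge0_integralD//; last 4 first.
  + by move=> x _; exact: integral_ge0.
  + exact: mint.
  + by move=> x _; exact: integral_ge0.
  + exact: mint.
  apply: eq_integral => x _; rewrite ge0_integralD//.
  + exact: measurable_fun_pair2.
  + exact: measurable_fun_pair2.
- rewrite monotone_convergence//; last first.
    by move=> k; exact: measurableT_comp (mf k) mproj.
  rewrite (_ : (fun k => _) = fun k => \int[sG]_(x in A0) \int[Gx x]_z f_ k (x, z))%E; last first.
    by apply/funext => k; exact: fE.
  rewrite -monotone_convergence//; last 3 first.
  + by move=> k; exact: mint.
  + by move=> k x _; exact: integral_ge0.
  + move=> x _ k l kl; apply: ge0_le_integral => //.
    * exact: measurable_fun_pair2.
    * exact: measurable_fun_pair2.
    * by move=> z _; exact: nf.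
  apply: eq_integral => x _; rewrite monotone_convergence// => k.
  exact: measurable_fun_pair2.
Qed.

Hypothesis Gfin : (G setT < +oo)%E.

Let fiber_integrable (F : X * Y -> R) (C : R) x : measurable_fun setT F ->
  (forall z, `|F z| <= C) -> (Gx x).-integrable setT (EFin \o (fun z => F (x, z))).
Proof.
move=> mF FC; apply: (bounded_integrable (M := C)) => //.
- by rewrite prob_kernel ltry.
- exact: measurable_fun_pair2.
Qed.

Lemma fiber_mean_bound (F : X * Y -> R) (C : R) x : measurable_fun setT F ->
  (forall z, `|F z| <= C) -> `|\int[Gx x]_z F (x, z)| <= C.
Proof.
move=> mF FC; have iF := fiber_integrable x mF FC.
have C0 : 0 <= C.
  apply: contrapT => /negP; rewrite -ltNge => C0.
  have /eqP : Gx x setT = 1%E by exact: prob_kernel.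
  rewrite (_ : setT = set0) ?measure0 ?eqe ?(eq_sym 0) ?oner_eq0//.
  by apply/seteqP; split => // z _; have := le_lt_trans (FC (x, z)) C0; rewrite ltNge normr_ge0.
apply: le_trans (le_Rintegral_norm (h := fun=> C) _ iF _ _) _ => //.
  apply: (bounded_integrable (M := C)) => //; first by rewrite prob_kernel ltry.
  by move=> z _; rewrite ger0_norm.
by rewrite Rintegral_cst// prob_kernel mulr1.
Qed.

(** Measurability and disintegration are available for nonnegative integrands; as each [Gx x] is a
    probability, adding [C] shifts the mean by exactly [C]. *)
Lemma fiber_mean_shift (F : X * Y -> R) (C : R) x : measurable_fun setT F ->
  (forall z, `|F z| <= C) ->
  \int[Gx x]_z F (x, z) = \int[Gx x]_z (F (x, z) + C) - C.
Proof.
move=> mF FC; rewrite RintegralD//.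
- by rewrite Rintegral_cst// prob_kernel mulr1 addrK.
- exact: fiber_integrable FC.
- apply: (bounded_integrable (M := `|C|)) => //; first by rewrite prob_kernel ltry.
Qed.

Lemma fiber_mean_ge0E (F : X * Y -> R) (C : R) x : measurable_fun setT F ->
  (forall z, `|F z| <= C) ->
  (\int[Gx x]_z (F (x, z) + C))%:E = (\int[Gx x]_z (F (x, z) + C)%:E)%E.
Proof.
move=> mF FC; apply: Rintegral_EFin => //; apply: integrable_add => //.
- exact: fiber_integrable FC.
- apply: (bounded_integrable (M := `|C|)) => //; first by rewrite prob_kernel ltry.
Qed.

Let shift_ge0 (F : X * Y -> R) (C : R) z : (forall z, `|F z| <= C) -> 0 <= F z + C.
Proof. by move=> /(_ z); rewrite ler_norml => /andP[+ _]; rewrite -lerBlDr sub0r. Qed.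

Lemma measurable_fiber_mean (F : X * Y -> R) (C : R) : measurable_fun setT F ->
  (forall z, `|F z| <= C) -> measurable_fun setT (fun x => \int[Gx x]_z F (x, z)).
Proof.
move=> mF FC.
rewrite (_ : (fun x => _) = fun x => \int[Gx x]_z (F (x, z) + C) - C); last first.
  by apply/funext => x; exact: fiber_mean_shift.
apply: measurable_funB => //; apply/measurable_EFinP.
apply: (eq_measurable_fun (fun x => \int[Gx x]_z (F (x, z) + C)%:E)%E).
  by move=> x _ /=; rewrite fiber_mean_ge0E.
apply: (measurable_fun_integral_sfinite_kernel (fun z => (F z + C)%:E)).
- by move=> z; rewrite lee_fin shift_ge0.
- by apply/measurable_EFinP; exact: measurable_funD.
Qed.

Lemma Rintegral_disintegration (F : X * Y -> R) (C : R) : measurable_fun setT F ->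
  (forall z, `|F z| <= C) ->
  \int[G]_y F (proj y) = \int[sG]_(x in A0) \int[Gx x]_z F (x, z).
Proof.
move=> mF FC; have mFp := measurableT_comp mF mproj.
have GsG : G setT = sG A0.
  rewrite -(preimage_setT proj) disint//.
  rewrite (eq_integral (cst 1%E)) ?integral_cst ?mul1e// => x _.
  by rewrite xsectionE preimage_setT prob_kernel.
have sfin : (sG A0 < +oo)%E by rewrite -GsG.
have mm := measurable_funTS (D := A0) (measurable_fiber_mean mF FC).
have bm x := fiber_mean_bound x mF FC.
have im : sG.-integrable A0 (EFin \o (fun x => \int[Gx x]_z F (x, z))).
  by apply: (bounded_integrable (M := C)).
have iC : sG.-integrable A0 (EFin \o cst C).
  by apply: (bounded_integrable (M := `|C|)).
have iF : G.-integrable setT (EFin \o (F \o proj)).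
  by apply: (bounded_integrable (M := C)) => // y _; exact: FC.
have iGC : G.-integrable setT (EFin \o cst C).
  by apply: (bounded_integrable (M := `|C|)).
have : \int[G]_y (F (proj y) + C) = \int[sG]_(x in A0) (\int[Gx x]_z F (x, z) + C).
  rewrite {1}/Rintegral (@ge0_disintegration (fun z => (F z + C)%:E)).
  - apply: (congr1 fine); apply: eq_integral => x _.
    by rewrite -(fiber_mean_ge0E x mF FC) (fiber_mean_shift x mF FC) subrK.
  - by apply/measurable_EFinP; exact: measurable_funD.
  - by move=> z; rewrite lee_fin shift_ge0.
rewrite RintegralD// RintegralD//.
by rewrite !Rintegral_cst// GsG => /addIr.
Qed.
End Disintegration.

(** * The capillary bundle and the boundary term *)

Section CapillaryBoundary.
Context {R : realType} {n : nat}.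
Local Notation E := 'rV[R]_n.+1.
Local Notation M := 'M[R]_n.+1.
Variables (Omega : set E) (m : nat) (beta : E -> R).
Variable Gamma : {measure set (borel (E * M)%type) -> \bar R}.
Local Notation K := (closure Omega).
Local Notation S := (frontier Omega).
Local Notation nu := (inner_normal Omega).
Local Notation bundle := (capillary_bundle Omega beta m).
Local Notation sG := (base_measure Gamma : {measure set (borel E) -> \bar R}).
Hypothesis dO : bounded_C2_domain Omega.
Hypothesis cbeta : {within S, continuous beta}.
Hypothesis beta_pi : forall x, S x -> 0 < beta x < pi.
Hypothesis cnu : forall i, {within S, continuous (fun x => nu x 0 i)}.
Hypothesis rG : radon Gamma.
Hypothesis nullG : Gamma (~` bundle) = 0%E.

Let mS : measurable (S : set (borel E)). Proof. by apply: closed_borel;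
  exact: frontier_closed. Qed.
Let sin_gt0 x : S x -> 0 < sin (beta x).
Proof. by move=> /beta_pi/andP[b0 bpi]; apply: sin_gt0_pi; rewrite ?b0 ?bpi. Qed.

Lemma sin_beta_continuous : {within S, continuous (fun x => sin (beta x))}.
Proof.
rewrite continuous_subspace_in => x xS.
apply: (@continuous_comp (subspace S) R R beta sin); first exact: cbeta.
exact: continuous_sin.
Qed.

Lemma inv_sin_beta_continuous : {within S, continuous (fun x => (sin (beta x))^-1)}.
Proof.
rewrite continuous_subspace_in => x /set_mem Sx.
apply: (@continuousV R (subspace S) (fun x => sin (beta x)) x).
  by rewrite gt_eqF// sin_gt0.
exact: sin_beta_continuous.
Qed.

(** The kernel lives on the product sigma-algebra of [borel E] and [borel M], not on the Borel
    sigma-algebra of the product space. Measurability is therefore rebuilt from coordinates, with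
    functions on [S] extended by 0. *)
Let nuS i : borel E -> R := (fun x : borel E => nu x 0 i) \_ S.
Let sinS : borel E -> R := (fun x : borel E => sin (beta x)) \_ S.
Let isinS : borel E -> R := (fun x : borel E => (sin (beta x))^-1) \_ S.

Let patch_measurable (f : E -> R) : {within S, continuous f} ->
  measurable_fun setT ((f : borel E -> R) \_ S : borel E -> R).
Proof. by move=> cf; apply/(measurable_restrictT _ mS); exact: within_measurable. Qed.

Let q i (z : borel E * borel M) : R := \sum_k nuS k z.1 * (z.2 : M) k i.

Let mq i : measurable_fun setT (q i).
Proof.
apply: measurable_sum => k; apply: measurable_funM.
  by apply: measurableT_comp; [exact: patch_measurable|exact: measurable_fst].
apply: (measurableT_comp (f := fun P : borel M => (P : M) k i)); last exact: measurable_snd.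
have mT : measurable (setT : set (borel M)) by [].
by apply: (within_measurable (A := setT) mT); apply: continuous_subspaceT;
  exact: entry_continuous.
Qed.

Let qE x P i : S x -> q i (x, P) = (nu x *m P) 0 i.
Proof.
move=> Sx; rewrite /q mxE; apply: eq_bigr => k _.
by rewrite /nuS /patch mem_set.
Qed.

Let bundleP (z : borel E * borel M) : bundle z =
  (S z.1 /\ grassmannian m z.2 /\ \sum_i q i z ^+ 2 - sinS z.1 ^+ 2 = 0).
Proof.
case: z => x P; rewrite capillary_bundleE; apply/propext; split.
  move=> [[Sx GP] /= nuP]; split => //; split => //.
  apply/eqP; rewrite subr_eq0 /sinS /patch mem_set// -nuP enorm_sqr; apply/eqP.
  by apply: eq_bigr => i _; rewrite qE// expr2.
move=> [Sx [GP /eqP]]; rewrite subr_eq0 /sinS /patch mem_set//= => /eqP qs; split => //=.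
apply/eqP; rewrite -(@eqrXn2 _ 2) ?enorm_ge0//; last by rewrite ltW// sin_gt0.
rewrite -qs enorm_sqr; apply/eqP.
by apply: eq_bigr => i _; rewrite qE// expr2.
Qed.

Let mbundle : measurable (bundle : set (borel E * borel M)).
Proof.
rewrite (_ : (bundle : set _) = (fst @^-1` (S : set (borel E))) `&` (snd @^-1` (grassmannian m :
  set (borel M))) `&`
   ((fun z => \sum_i q i z ^+ 2 - sinS z.1 ^+ 2) @^-1` [set 0])); last first.
  apply/seteqP; split => z; first by rewrite bundleP => -[? []].
  by move=> [[? ?] ?]; rewrite bundleP.
apply: measurableI; first apply: measurableI.
- by rewrite -[X in measurable X]setTI; apply: measurable_fst.
- rewrite -[X in measurable X]setTI; apply: measurable_snd => //.
  by apply: closed_borel; exact: grassmannian_closed.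
- have mF : measurable_fun setT (fun z : borel E * borel M => \sum_i q i z ^+ 2 - sinS z.1 ^+ 2).
    apply: measurable_funB.
      by apply: measurable_sum => i; exact: measurable_funX.
    apply: measurable_funX; apply: measurableT_comp;
      [exact: patch_measurable sin_beta_continuous|exact: measurable_fst].
  by rewrite -[X in measurable X]setTI; apply: mF => //; exact: measurable_set1.
Qed.

(** The conormal cut off outside the bundle. On the bundle |nu P| = sin beta, so dividing by sin
    beta, which does not vanish on [S], replaces dividing by |nu P|. *)
Definition bundle_conormal i (z : borel E * borel M) : R :=
  \1_(bundle : set (borel E * borel M)) z * (isinS z.1 * q i z).

Lemma bundle_conormalE i x P : bundle_conormal i (x, P) =
  \1_(bundle : set (borel E * borel M)) (x, P) * conormal Omega x P 0 i.
Proof.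
rewrite /bundle_conormal indicE; have [/set_mem bxP|_] := boolP (_ \in _); last by rewrite !mul0r.
have [Sx [_ nuP _]] := bxP; rewrite !mul1r /isinS /patch mem_set//= qE// /conormal [in RHS]mxE.
by rewrite nuP.
Qed.

Lemma conormal_le1 x P : enorm (conormal Omega x P) <= 1.
Proof.
rewrite /conormal enormZ ger0_norm ?invr_ge0 ?enorm_ge0//.
by have [->|q0] := eqVneq (enorm (nu x *m P)) 0; rewrite ?mulr0// mulVf.
Qed.

Lemma bundle_conormal_le1 i z : `|bundle_conormal i z| <= 1.
Proof.
case: z => x P; rewrite bundle_conormalE normrM -[leRHS]mulr1 ler_pM//.
  by rewrite indicE; case: (_ \in _); rewrite ?normr1 ?normr0.
exact: le_trans (coord_le_enorm _ _) (conormal_le1 x P).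
Qed.

Lemma measurable_bundle_conormal i : measurable_fun setT (bundle_conormal i).
Proof.
apply: measurable_funM; first exact: measurable_indic.
apply: measurable_funM => //.
by apply: measurableT_comp; [exact: patch_measurable inv_sin_beta_continuous|exact:
  measurable_fst].
Qed.

Let cptS : compact S.
Proof.
case: (dO) => _ _ _ bO _; apply: (subclosed_compact _ (closure_bounded_compact bO)).
  exact: frontier_closed.
by move=> x [].
Qed.

Let mbun : measurable (bundle : set (borel (E * M)%type)).
Proof. by apply: closed_borel; exact: capillary_bundle_closed. Qed.

Lemma capillary_null : Gamma (~` plane_bundle m S) = 0%E.
Proof.
have mp := plane_bundle_measurable m (frontier_closed (Omega := Omega)).
apply/eqP; rewrite eq_le measure_ge0 andbT -nullG le_measure ?inE//.
- exact: measurableC.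
- exact: measurableC.
- by apply: subsetC; rewrite capillary_bundleE => y [].
Qed.

Lemma boundary_measure_finite A : measurable A -> (sG A < +oo)%E.
Proof. exact: (base_finite cptS rG capillary_null). Qed.

Let GT : (Gamma setT < +oo)%E.
Proof. by have := boundary_measure_finite measurableT;
  rewrite /= /base_measure /pushforward preimage_setT. Qed.

(** Both projections are continuous, hence Borel; this is the passage from the Borel sigma-algebra
    of the product to the product sigma-algebra. *)
Lemma measurable_split :
  measurable_fun setT (fun y : borel (E * M)%type => (y.1, y.2) : borel E * borel M).
Proof.
have msnd : measurable_fun setT (fun y : borel (E * M)%type => (y : E * M).2 : borel M).
  apply: (@measurability _ _ (borel (E * M)%type) (borel M) _ _ (@open M)) => //.
  move=> _ [B oB <-]; rewrite setTI; apply: sub_sigma_algebra.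
  by have /continuousP := @snd_continuous R n; exact.
exact: measurable_fun_pair measurable_point_of msnd.
Qed.

Lemma measurable_conormal i : measurable_fun (bundle : set (borel (E * M)%type))
  (fun y : borel (E * M)%type => conormal Omega y.1 y.2 0 i).
Proof.
apply: (eq_measurable_fun (fun y : borel (E * M)%type => bundle_conormal i (y.1, y.2))).
  by move=> y /set_mem by_; rewrite bundle_conormalE indicE mem_set ?mul1r//; case: y by_.
apply: measurable_funTS.
exact: measurableT_comp (@measurable_bundle_conormal i) measurable_split.
Qed.

Variable Gx : R.-pker borel E ~> borel M.
Hypothesis dis : disintegrates Omega beta m Gamma Gx.
Local Notation nV := (mean_conormal Omega beta m Gx).
Local Notation nW := (wetting_conormal Omega beta m Gx).

Let proj (y : borel (E * M)%type) : borel E * borel M := ((y : E * M).1, (y : E * M).2).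

Let mproj : measurable_fun setT proj. Proof. exact: measurable_split. Qed.

Let disint A : measurable A -> Gamma (proj @^-1` A) = (\int[sG]_(x in S) Gx x (xsection A x))%E.
Proof.
move=> mA; have mpA : measurable (proj @^-1` A).
  by rewrite -[X in measurable X]setTI; exact: mproj.
rewrite (dis.2 _ mpA); apply: eq_integral => x _; congr (Gx x _).
by rewrite xsectionE.
Qed.

Lemma mean_conormalE x i : S x -> nV x 0 i = \int[Gx x]_P bundle_conormal i (x, P).
Proof.
move=> Sx; rewrite mxE Rintegral_mkcond; apply: eq_Rintegral => P _.
rewrite bundle_conormalE /patch indicE.
have -> : ((x, P) \in (bundle : set (borel E * borel M))) = (P \in capillary_planes Omega beta m
  x).
  by apply/idP/idP => /set_mem xP; apply/mem_set; [case: xP|split].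
by case: (_ \in _); rewrite ?mul1r ?mul0r.
Qed.

Lemma mean_conormal_measurable i : measurable_fun (S : set (borel E)) (fun x : borel E => nV x 0
  i).
Proof.
apply: (eq_measurable_fun (fun x => \int[Gx x]_P bundle_conormal i (x, P))).
  by move=> x; rewrite inE => Sx; rewrite mean_conormalE.
apply: measurable_funTS.
exact: (measurable_fiber_mean _ (@measurable_bundle_conormal i) (@bundle_conormal_le1 i)).
Qed.

Lemma mean_conormal_bound x i : S x -> `|nV x 0 i| <= 1.
Proof.
move=> Sx; rewrite mean_conormalE//; 
exact: (fiber_mean_bound _ _ (@measurable_bundle_conormal i) (@bundle_conormal_le1 i)).
Qed.

(** Disintegration of a finite sum of products p_i(x) n_i(x, P): on each fibre p_i(x) is a constant
    and the mean of n_i is the coordinate of n_V. *)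
Lemma boundary_term (phi : E -> E) : (forall i, {within S, continuous (fun x => phi x 0 i)}) ->
  \int[Gamma]_(y in bundle) dot (conormal Omega y.1 y.2) (phi y.1) =
  \int[sG]_(x in S) dot (nV x) (phi x).
Proof.
move=> cphi.
have B0 i := within_bounded cptS (cphi i).
have {}B0 : exists C, 0 <= C /\ forall i x, S x -> `|phi x 0 i| <= C.
  have /choice[C HC] : forall i, exists C, 0 <= C /\ forall x, S x -> `|phi x 0 i| <= C.
    by move=> i; have [C /ltW C0 HC] := B0 i; exists C.
  exists (\sum_i C i); split; first by apply: sumr_ge0 => i _; case: (HC i).
  move=> i x Sx; apply: le_trans ((HC i).2 x Sx) _.
  rewrite (bigD1 i)//= lerDl sumr_ge0// => j _; by case: (HC j).
have [C [C0 phiC]] := B0.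
pose p i : borel E -> R := (fun x : borel E => phi x 0 i) \_ S.
have mp i : measurable_fun setT (p i) by exact: patch_measurable.
have pC i x : `|p i x| <= C.
  by rewrite /p /patch; case: ifPn => [/set_mem/phiC//|_]; rewrite normr0.
pose F (z : borel E * borel M) := \sum_i p i z.1 * bundle_conormal i z.
have mF : measurable_fun setT F.
  apply: measurable_sum => i; apply: measurable_funM; last exact: measurable_bundle_conormal.
  by apply: measurableT_comp => //; exact: measurable_fst.
have FC z : `|F z| <= \sum_(i < n.+1) C.
  apply: le_trans (ler_norm_sum _ _ _) _; apply: ler_sum => i _.
  rewrite normrM -[leRHS]mulr1 ler_pM//; exact: bundle_conormal_le1.
transitivity (\int[Gamma]_y F (proj y)).
  rewrite Rintegral_mkcond; apply: eq_Rintegral => -[x P] _.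
  rewrite /patch; have [/set_mem bxP|bxP] := ifPn.
    apply: eq_bigr => i _; rewrite bundle_conormalE indicE mem_set// mul1r mulrC.
    by congr (_ * _); rewrite /p /patch mem_set//; case: bxP.
  rewrite /F big1// => i _; rewrite bundle_conormalE indicE (_ : _ \in _ = false) ?mul0r ?mulr0//.
  by apply/negbTE; exact: bxP.
rewrite (Rintegral_disintegration mS mproj disint GT mF FC).
apply: eq_Rintegral => x; rewrite inE => Sx.
have iG (f : borel M -> R) c : measurable_fun setT f -> (forall P, `|f P| <= c) ->
    (Gx x).-integrable setT (EFin \o f).
  by move=> mf fc; apply: (bounded_integrable (M := c)) => //; rewrite prob_kernel ltry.
have ic i : (Gx x).-integrable setT (EFin \o (fun P => bundle_conormal i (x, P))).
  apply: (iG _ 1); last by move=> P; exact: bundle_conormal_le1.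
  by apply: measurable_fun_pair2; exact: measurable_bundle_conormal.
have ipc i : (Gx x).-integrable setT (EFin \o (fun P => p i x * bundle_conormal i (x, P))).
  by apply: integrable_mul (ic i) _ _ => //.
rewrite /dot /F /=.
have key (s : seq 'I_n.+1) : \int[Gx x]_P (\sum_(i <- s) p i x * bundle_conormal i (x, P)) =
    \sum_(i <- s) nV x 0 i * phi x 0 i.
  elim: s => [|i s IH].
    rewrite big_nil (eq_Rintegral (Gx x) (g := fun=> 0)) ?Rintegral_cst ?mul0r// => P _.
    by rewrite big_nil.
  rewrite big_cons (eq_Rintegral (Gx x) (g := fun P => p i x * bundle_conormal i (x, P) +
    \sum_(i <- s) p i x * bundle_conormal i (x, P))); last by move=> P _; rewrite big_cons.
  rewrite (RintegralD measurableT (ipc i)); last exact: integrable_big.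
  rewrite IH RintegralZl//; last exact: ic.
  congr (_ + _); rewrite mulrC; congr (_ * _); last by rewrite /p /patch mem_set.
  exact/esym/mean_conormalE.
exact: key.
Qed.

(* Then |nu P| = sin beta = 1 = |nu|, so nu lies in the plane. *)
Lemma cos_eq0_conormal x P : S x -> cos (beta x) = 0 -> capillary_planes Omega beta m x P ->
  conormal Omega x P = nu x.
Proof.
move=> Sx cx [[PT PP _] nuP _].
have nu1 := inner_normal_unit dO Sx.
have s1 : sin (beta x) = 1.
  apply/eqP; rewrite -(@eqrXn2 _ 2) ?ler01//; last by rewrite ltW// sin_gt0.
  by have := cos2Dsin2 (beta x); rewrite cx expr0n add0r expr1n => ->.
have h1 : enorm (nu x *m P) = 1 by rewrite nuP.
rewrite /conormal h1 invr1 scale1r; apply/eqP; rewrite -subr_eq0 -enorm_eq0 -sqrf_eq0 enorm_sqr.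
rewrite dotBl !dotBr -!enorm_sqr h1 nu1 !expr1n.
have h2 : dot (nu x *m P) (nu x) = 1.
  have : dot (nu x *m P) (nu x *m P) = dot (nu x) (nu x *m P).
    by rewrite [LHS]dot_mulmx PT -mulmxA PP.
  by rewrite -enorm_sqr h1 expr1n dotC => <-.
by rewrite (dotC (nu x)) h2; lra.
Qed.

(** All capillary conormals at x equal nu, so n_V is nu times the mass that [Gx x] gives to the
    capillary planes. This factor is left unevaluated, and the identity holds at every such x, not
    just almost everywhere. *)
Lemma cos_eq0_mean_conormal x v : S x -> cos (beta x) = 0 -> dot (nV x) (tproj Omega x v) = 0.
Proof.
move=> Sx cx; have nu1 := inner_normal_unit dO Sx.
pose b (P : borel M) : R := \1_(bundle : set (borel E * borel M)) (x, P).
have ib : (Gx x).-integrable setT (EFin \o b).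
  apply: (bounded_integrable (M := 1)) => //; first by rewrite prob_kernel ltry.
    by apply: measurableT_comp (measurable_indic mbundle) _; exact: pair1_measurable.
  by move=> P _; rewrite /b indicE; case: (_ \in _); rewrite ?normr1 ?normr0.
have -> : nV x = (\int[Gx x]_P b P) *: nu x.
  apply/rowP => i; rewrite mean_conormalE// [RHS]mxE mulrC -RintegralZl//.
  apply: eq_Rintegral => P _; rewrite bundle_conormalE /b indicE.
  have [/set_mem[_ xP]|_] := boolP (_ \in _); last by rewrite mul0r mulr0.
  by rewrite mulr1 mul1r (cos_eq0_conormal Sx cx xP).
by rewrite dotZl /tproj dotBr dotZr -(enorm_sqr (nu x)) nu1 expr1n mulr1 (dotC v) subrr mulr0.
Qed.

Lemma wetting_tproj x : cos (beta x) != 0 -> cos (beta x) *: nW x = tproj Omega x (nV x).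
Proof. by move=> cx; rewrite /wetting_conormal scalerA mulfV// scale1r. Qed.

Lemma tproj_sym x u v : dot (tproj Omega x u) v = dot u (tproj Omega x v).
Proof. by rewrite /tproj dotBl dotBr dotZl dotZr mulrC (dotC (nu x) v). Qed.

Lemma boundary_term_tproj (phi : E -> E) :
  \int[sG]_(x in S) dot (nV x) (tproj Omega x (phi x)) =
  \int[sG]_(x in S `&` [set x | cos (beta x) != 0]) dot (nV x) (tproj Omega x (phi x)).
Proof.
rewrite [LHS]Rintegral_mkcond [RHS]Rintegral_mkcond; apply: eq_Rintegral => x _.
rewrite /patch (in_setI x (S : set (borel E)) _); have [/set_mem Sx|//] := boolP (x \in S).
have [cx|cx] := eqVneq (cos (beta x)) 0.
  by rewrite cos_eq0_mean_conormal// if_same.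
by rewrite (mem_set (A := [set x | cos (beta x) != 0]) cx).
Qed.

Lemma boundary_term_wetting (phi : E -> E) :
  \int[sG]_(x in S) dot (nV x) (tproj Omega x (phi x)) =
  \int[sG]_(x in S) dot (cos (beta x) *: nW x) (phi x).
Proof.
apply: eq_Rintegral => x; rewrite inE => Sx.
have [cx|cx] := eqVneq (cos (beta x)) 0.
  by rewrite cx scale0r dot0l cos_eq0_mean_conormal.
by rewrite wetting_tproj// tproj_sym.
Qed.

Lemma wetting_integrable (phi : E ->
  E) : (forall i, {within S, continuous (fun x => phi x 0 i)}) ->
  sG.-integrable S (EFin \o (fun x : borel E => dot (cos (beta x) *: nW x) (phi x))).
Proof.
move=> cphi.
apply: (eq_integrable mS (EFin \o (fun x : borel E => dot (nV x) (tproj Omega x (phi x))))).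
  move=> x; rewrite inE => Sx /=; congr EFin.
  have [cx|cx] := eqVneq (cos (beta x)) 0.
    by rewrite cx scale0r dot0l cos_eq0_mean_conormal.
  by rewrite wetting_tproj// tproj_sym.
have sS : (sG S < +oo)%E by exact: boundary_measure_finite.
apply: integrable_big => // i.
apply: (eq_integrable mS (EFin \o (fun x : borel E => tproj Omega x (phi x) 0 i * nV x 0 i))).
  by move=> x _; rewrite /= mulrC.
have ct : {within S, continuous (fun x => tproj Omega x (phi x) 0 i)}.
  rewrite (_ : (fun x => _) = fun x => phi x 0 i - dot (phi x) (nu x) * nu x 0 i); last first.
    by apply/funext => x; rewrite !mxE.
  apply: withinB => //; apply: withinM => //.
  by apply: within_sum => j; exact: withinM.
have [C _ CB] := within_bounded cptS ct.
apply: (integrable_mul (C := C)) => //; last exact: within_measurable.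
apply: (bounded_integrable (M := 1)) => //; first exact: mean_conormal_measurable.
by move=> x Sx; exact: mean_conormal_bound.
Qed.
End CapillaryBoundary.

(** * The estimates *)

Section Cutoff.
Context {R : realType} {n : nat}.
Local Notation E := 'rV[R]_n.+1.
Implicit Types (x y : E) (t r : R).

(* [cut] is 1 on [0, 1/4], where 16/9 (1 - t)^2 >= 1, and 0 on [1, +oo). *)
Definition cut t : R := 1 - pospow 2 (1 - 16 / 9 * pospow 2 (1 - t)).
Definition dcut t : R := - (64 / 9) * (pospow 1 (1 - 16 / 9 * pospow 2 (1 - t)) * pospow 1 (1 -
  t)).

Lemma is_derive_cut t : is_derive t 1 cut (dcut t).
Proof.
have d1 (s : R) : is_derive s 1 (fun s : R => 1 - s) (-1).
  by have := is_deriveB (is_derive_cst (1 : R) s (1 : R)) (is_derive_id s (1 : R)); rewrite sub0r.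
have d2 (s : R) : is_derive s 1 (fun s => pospow 2 (1 - s)) (- (2 * pospow 1 (1 - s))).
  by have := @is_derive1_comp R (pospow 2) (fun s => 1 - s) s _ _ (is_derive_pospow 0 (1 - s))
    (d1 s); rewrite mulrN1.
have d3 : is_derive t 1 (fun s => 16 / 9 * pospow 2 (1 - s)) (16 / 9 * - (2 * pospow 1 (1 - t))).
  exact: is_deriveZ.
have d4 : is_derive t 1 (fun s => pospow 2 (1 - 16 / 9 * pospow 2 (1 - s)))
   (- (2 * pospow 1 (1 - 16 / 9 * pospow 2 (1 - t))) * (16 / 9 * - (2 * pospow 1 (1 - t)))).
  exact: (@is_derive1_comp R (fun s => pospow 2 (1 - s)) (fun s => 16 / 9 * pospow 2 (1 - s)) t _
    _ (d2 (16 / 9 * pospow 2 (1 - t))) d3).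
have := is_deriveB (is_derive_cst (1 : R) t (1 : R)) d4; rewrite sub0r.
by congr is_derive; rewrite /dcut; field.
Qed.

Lemma continuous_dcut : continuous dcut.
Proof.
have c1 : continuous (fun t : R => 1 - t).
  by move=> t; apply: cvgB; [exact: cvg_cst|exact: cvg_id].
have cp k : continuous (fun t : R => pospow k.+1 (1 - t)).
  by move=> t; apply: (@continuous_comp R R R (fun t => 1 - t) (pospow k.+1) t (c1 t));
    exact: continuous_pospow.
have c2 : continuous (fun t : R => pospow 1 (1 - 16 / 9 * pospow 2 (1 - t))).
  move=> t; apply: (@continuous_comp R R R (fun t => 16 / 9 * pospow 2 (1 - t)) (fun s => pospow
    1 (1 - s)) t); last exact: cp.
  by apply: (@cvgM R R (nbhs t) _ (fun=> 16 / 9)); [exact: cvg_cst|exact: cp].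
move=> t; apply: (@cvgM R R (nbhs t) _ (fun=> - (64 / 9))); first exact: cvg_cst.
by apply: (@cvgM R R (nbhs t) _ (fun t => pospow 1 (1 - 16 / 9 * pospow 2 (1 - t))) (fun t =>
  pospow 1 (1 - t))); [exact: c2|exact: cp].
Qed.

Lemma pospow_bound k t a : t <= a -> 0 <= a -> pospow k t <= a ^+ k.
Proof.
move=> ta a0; rewrite /pospow; apply: lerXn2r; rewrite ?nnegrE//.
  by rewrite le_max lexx orbT.
by rewrite ge_max ta.
Qed.

Lemma cut_bound t : 0 <= cut t <= 1.
Proof.
rewrite /cut lerBlDr lerDl pospow_ge0 andbT subr_ge0 -[leRHS](expr1n _ 2).
by apply: pospow_bound => //; rewrite lerBlDr lerDl mulr_ge0 ?pospow_ge0.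
Qed.

Lemma cut_eq1 t : t <= 1 / 4 -> cut t = 1.
Proof.
move=> t4; rewrite /cut {1}/pospow (max_idPr _) ?expr0n ?subr0//.
rewrite subr_le0 /pospow (max_idPl _); last lra.
have : (3 / 4) ^+ 2 <= (1 - t) ^+ 2 by apply: lerXn2r; rewrite ?nnegrE; lra.
by lra.
Qed.

Lemma cut_eq0 t : 1 <= t -> cut t = 0.
Proof.
move=> t1; rewrite /cut {2}/pospow (max_idPr _); last lra.
by rewrite expr0n mulr0 subr0 /pospow (max_idPl _) ?ler01// expr1n subrr.
Qed.

Lemma dcut_eq0 t : 1 <= t -> dcut t = 0.
Proof.
move=> t1; rewrite /dcut [X in _ * (_ * X)]/pospow (max_idPr _); last lra.
by rewrite expr0n !mulr0.
Qed.

(** Both truncated factors are at most 1 for t >= 0, and 64/9 <= 8. *)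
Lemma dcut_bound t : 0 <= t -> `|dcut t| <= 8.
Proof.
move=> t0; rewrite /dcut mulNr normrN ger0_norm; last first.
  by rewrite !mulr_ge0 ?pospow_ge0.
have h1 : pospow 1 (1 - 16 / 9 * pospow 2 (1 - t)) <= 1.
  rewrite -[leRHS](expr1n _ 1); apply: pospow_bound => //.
  by rewrite lerBlDr lerDl mulr_ge0 ?pospow_ge0.
have h2 : pospow 1 (1 - t) <= 1.
  by rewrite -[leRHS](expr1n _ 1); apply: pospow_bound => //; rewrite lerBlDr lerDl.
have := ler_pM (pospow_ge0 _ _) (pospow_ge0 _ _) h1 h2; rewrite mulr1.
set a := pospow 1 _ * _ => a1; lra.
Qed.

(** The squared distance is smooth at the centre; the thresholds 1/4 and 1 of [cut] correspond to
    the radii r/2 and r. *)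
Definition cutoff x r y : R := cut (r ^- 2 * sqdist x y).
Definition cutoff_grad x r y : E := (dcut (r ^- 2 * sqdist x y) * r ^- 2 * 2) *: (y - x).

Lemma sqdist_ge x y r : 0 < r -> ~ eball x r y -> 1 <= r ^- 2 * sqdist x y.
Proof.
move=> r0 /negP; rewrite -ltNge => rxy; rewrite ler_pdivlMl ?exprn_gt0// mulr1 /sqdist -enorm_sqr.
by rewrite lerXn2r ?nnegrE ?enorm_ge0 ?(ltW r0)// ltW.
Qed.

Lemma cutoff_bound x r y : 0 <= cutoff x r y <= 1.
Proof. exact: cut_bound. Qed.

Lemma cutoff_eq0 x r y : 0 < r -> ~ eball x r y -> cutoff x r y = 0.
Proof. by move=> r0 xy; apply: cut_eq0; exact: sqdist_ge. Qed.

Lemma cutoff_eq1 x r y : 0 < r -> eball x (r / 2) y -> cutoff x r y = 1.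
Proof.
move=> r0 xy; apply: cut_eq1; rewrite ler_pdivrMl ?exprn_gt0// /sqdist -enorm_sqr.
have : enorm (y - x) ^+ 2 <= (r / 2) ^+ 2.
  by rewrite lerXn2r ?nnegrE ?enorm_ge0// divr_ge0// ltW.
by rewrite expr_div_n; lra.
Qed.

Lemma cutoff_grad_eq0 x r y : 0 < r -> ~ eball x r y -> cutoff_grad x r y = 0.
Proof. by move=> r0 xy; rewrite /cutoff_grad dcut_eq0 ?mul0r ?scale0r//; exact: sqdist_ge. Qed.

(** Chain rule on the ball: 8 times 2 |y - x| / r^2, with |y - x| <= r. Off the ball the gradient is
    0. *)
Lemma cutoff_grad_bound x r y : 0 < r -> enorm (cutoff_grad x r y) <= 16 / r.
Proof.
move=> r0; have [xy|/(cutoff_grad_eq0 r0)->] := pselect (eball x r y); last first.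
  by rewrite enorm0 divr_ge0 ?(ltW r0).
have s0 : 0 <= r ^- 2 * sqdist x y by rewrite mulr_ge0 ?invr_ge0 ?exprn_ge0 ?dotvv_ge0 ?(ltW r0).
rewrite /cutoff_grad; move: (dcut _) (dcut_bound s0) => d h1; rewrite enormZ !normrM.
rewrite (@ger0_norm _ (r ^- 2)) ?invr_ge0 ?exprn_ge0 ?(ltW r0)// normr_nat.
have h2 : r ^- 2 * 2 * enorm (y - x) <= 2 / r.
  rewrite -mulrA ler_pdivrMl ?exprn_gt0//.
  rewrite (_ : r ^+ 2 * (2 / r) = 2 * r) ?ler_pM2l//.
  by field; rewrite gt_eqF.
rewrite -!mulrA (mulrA (r ^- 2)); apply: le_trans (ler_pM _ _ h1 h2) _ => //.
  by rewrite !mulr_ge0 ?invr_ge0 ?exprn_ge0 ?enorm_ge0 ?(ltW r0).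
by rewrite mulrA -natrM.
Qed.

Lemma cutoff_up1 Omega x r : 0 < r -> up1 Omega (cutoff x r) (cutoff_grad x r).
Proof.
move=> r0; have u1 := isC1_up1 (@subsetT _ (closure Omega)) (isC2_sqdist x).1.
have u2 := up1M (up1_cst Omega (r ^- 2)) u1.
have := up1_comp (h := cut) (dh := dcut) u2 (fun y _ => is_derive_cut _) (fun y _ =>
  @continuous_dcut _).
congr up1; apply/funext => y; rewrite /cutoff_grad scaler0 addr0 scalerA.
rewrite (has_grad_grad (has_grad_sqdist x y)) scalerA.
by congr (_ *: _).
Qed.
Lemma cutoff_indic (x0 : E) r x : 0 < r -> `|cutoff x0 r x| <= \1_(eball x0 r) x.
Proof.
move=> r0; have /andP[c0 c1] := cutoff_bound x0 r x; rewrite ger0_norm// indicE.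
have [|/negP xB] := boolP (x \in _); first by [].
by rewrite cutoff_eq0// => xB'; apply: xB; rewrite inE.
Qed.

Lemma cutoff_grad_indic (x0 : E) r x : 0 < r ->
  enorm (cutoff_grad x0 r x) <= \1_(eball x0 r) x * (16 / r).
Proof.
move=> r0; rewrite indicE; have [_|/negP xB] := boolP (x \in _).
  by rewrite mul1r cutoff_grad_bound.
by rewrite cutoff_grad_eq0 ?enorm0 ?mul0r// => xB'; apply: xB; rewrite inE.
Qed.

End Cutoff.

(** * The first variation of a capillary varifold *)

Section CapillaryVariation.
Context {R : realType} {n : nat}.
Local Notation E := 'rV[R]_n.+1.
Local Notation M := 'M[R]_n.+1.
Variables (Omega : set E) (m : nat) (beta : E -> R).
Variables V Gamma : {measure set (borel (E * M)%type) -> \bar R}.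
Variable H : E -> E.
Local Notation K := (closure Omega).
Local Notation S := (frontier Omega).
Local Notation nu := (inner_normal Omega).
Local Notation D := (plane_bundle m K : set (borel (E * M)%type)).
Local Notation bundle := (capillary_bundle Omega beta m).
Local Notation mu := (base_measure V : {measure set (borel E) -> \bar R}).
Local Notation sG := (base_measure Gamma : {measure set (borel E) -> \bar R}).
Local Notation cK f := {within K, continuous (f : E -> R)}.
Hypothesis dO : bounded_C2_domain Omega.
Hypothesis cbeta : {within S, continuous beta}.
Hypothesis beta_pi : forall x, S x -> 0 < beta x < pi.
Hypothesis cap : capillary_varifold Omega beta m V Gamma H.
Variables (g : E -> R) (N : E -> E) (W : set E).
Hypothesis Cg : isC2 setT g.
Hypothesis g_gt0 : forall x, Omega x -> 0 < g x.
Hypothesis g_eq0 : forall x, S x -> g x = 0.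
Hypothesis oW : open W.
Hypothesis KW : K `<=` W.
Hypothesis CN : isC1_field W N.
Hypothesis N_le1 : forall x, K x -> enorm (N x) <= 1.
Hypothesis N_normal : forall x, S x -> N x = nu x.
Hypothesis N_grad : forall x, W x -> exists2 k, 0 < k & N x = k *: grad g x.
Local Notation B := (n.+1%:R * `|second_ff_norm Omega|).

Let oO : open Omega. Proof. by case: dO. Qed.
Let cptK : compact K. Proof. by case: dO => _ _ _ bO _; exact: closure_bounded_compact. Qed.
Let isV : is_varifold Omega m V. Proof. by case: cap. Qed.
Let rV : radon V. Proof. by case: isV. Qed.
Let nullV : V (~` D) = 0%E. Proof. by case: isV. Qed.
Let rG : radon Gamma. Proof. by case: cap => _ []. Qed.
Let nullG : Gamma (~` bundle) = 0%E. Proof. by case: cap => _ []. Qed.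
Let mK : measurable (K : set (borel E)). Proof. exact: base_measurable. Qed.
Let mD : measurable D. Proof. exact: bundle_measurable. Qed.
Let mS : measurable (S : set (borel E)). Proof. by apply: closed_borel;
  exact: frontier_closed. Qed.
Let SK x : S x -> K x. Proof. by case. Qed.
Let iH i : mu.-integrable (K : set (borel E)) (fun x : borel E => (H x 0 i)%:E).
Proof. by case: cap => _ _ LH _ _; exact: (LH K cptK (@subset_refl _ K) i). Qed.
Let N_upV : upV Omega N (jac N).
Proof. exact: isC1_field_upV KW CN. Qed.
Let cN i : cK (fun x => N x 0 i). Proof. by have [] := N_upV i. Qed.

Lemma within_frontier (f : E -> R) : cK f -> {within S, continuous f}.
Proof. by apply: continuous_subspaceW; exact: SK. Qed.

Lemma inner_normal_within i : {within S, continuous (fun x => nu x 0 i)}.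
Proof.
apply: (@subspace_eq_continuous E S R (fun x => N x 0 i)).
  by move=> x /set_mem Sx; rewrite /= N_normal.
exact/within_frontier/cN.
Qed.

Let mbun : measurable (bundle : set (borel (E * M)%type)).
Proof. by apply: closed_borel; apply: capillary_bundle_closed => //;
  exact: inner_normal_within. Qed.

Lemma field_support_compact (phi : E -> E) : compact (closure [set x | K x /\ phi x != 0]).
Proof.
apply: (subclosed_compact (@closed_closure _ _) cptK).
have KE : closure K = K by apply/esym/closure_id; exact: closed_closure.
by rewrite -[X in _ `<=` X]KE; apply: closure_subset => x [].
Qed.

Lemma tangential_variation phi : tangential_field Omega phi ->
  first_variation Omega m V phi = - (\int[mu]_(x in K) dot (H x) (phi x))
    - (\int[Gamma]_(y in bundle) dot (conormal Omega y.1 y.2) (phi y.1)).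
Proof. by case: cap => _ _ _ _ /[apply]; apply; exact: field_support_compact. Qed.

Lemma interior_variation phi : C1_closure Omega phi -> (forall x, S x -> phi x = 0) ->
  first_variation Omega m V phi = - (\int[mu]_(x in K) dot (H x) (phi x)).
Proof.
move=> Cphi phi0; rewrite tangential_variation; last first.
  by split => // x Sx; rewrite phi0// /tangent /= dot0l.
rewrite (eq_Rintegral Gamma (g := fun=> 0)); last first.
  by move=> y; rewrite inE => -[Sy _]; rewrite phi0// dot0r.
by rewrite Rintegral_cst// mul0r subr0.
Qed.

(** Written with [N] instead of the normal, so that it is defined and C^1 up to the boundary on the
    whole closure; it is the tangential projection on the frontier only. *)
Definition tangential_part (phi : E -> E) (x : E) : E := phi x - dot (phi x) (N x) *: N x.

Lemma tangential_partE phi x : S x -> tangential_part phi x = tproj Omega x (phi x).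
Proof. by move=> Sx; rewrite /tangential_part /tproj N_normal. Qed.

Lemma tangential_part_upV phi J : upV Omega phi J ->
  exists J', upV Omega (tangential_part phi) J'.
Proof.
move=> pJ; have [c fc] := up1_dot pJ N_upV.
eexists; have := upVD pJ (upV_scale (up1M (up1_cst _ (-1)) fc) N_upV); congr upV.
by apply/funext => x; rewrite /tangential_part mulN1r scaleNr.
Qed.

Lemma tproj_tangent x v : S x -> tangent Omega x (tproj Omega x v).
Proof.
move=> Sx; rewrite /tangent /= /tproj dotBl dotZl -(enorm_sqr (nu x)) inner_normal_unit//.
by rewrite expr1n mulr1 subrr.
Qed.

Lemma tangential_part_field phi J : upV Omega phi J ->
  tangential_field Omega (tangential_part phi).
Proof.
move=> pJ; have [J' pJ'] := tangential_part_upV pJ; split; first exact: upV_C1_closure pJ'.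
by move=> x Sx; rewrite tangential_partE//; exact: tproj_tangent.
Qed.

Let pdiv_integrable phi J : upV Omega phi J ->
  V.-integrable D (EFin \o (fun y : borel (E * M)%type => Defs.pdiv Omega phi y.2 y.1)).
Proof.
move=> pJ; apply: (eq_integrable mD (EFin \o (fun y : borel (E * M)%type => \tr (y.2 *m J y.1)))).
  by move=> y; rewrite inE => -[Ky _]; rewrite /= /Defs.pdiv (upV_ext_jacobian pJ Ky).
apply: bundle_integrable => //; apply: within_trace => i j.
exact: upV_jac_continuous pJ.
Qed.

Lemma first_variationD phi psi J J' : upV Omega phi J -> upV Omega psi J' ->
  first_variation Omega m V (fun x => phi x + psi x) =
  first_variation Omega m V phi + first_variation Omega m V psi.
Proof.
move=> pJ pJ'; rewrite /first_variation -(RintegralD mD (pdiv_integrable pJ) (pdiv_integrable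
  pJ')).
apply: eq_Rintegral => y; rewrite inE => -[Ky _].
rewrite /Defs.pdiv (upV_ext_jacobian (upVD pJ pJ') Ky) (upV_ext_jacobian pJ Ky) (upV_ext_jacobian
  pJ' Ky).
by rewrite mulmxDr mxtraceD.
Qed.

Let dot_H_int (c : E -> E) : (forall i, cK (fun x => c x 0 i)) ->
  mu.-integrable (K : set (borel E)) (EFin \o (fun x : borel E => dot (H x) (c x))).
Proof. exact: dot_H_integrable. Qed.

(** [w] is minus the normal component of the curvature field, and [s] is sigma^perp. The last clause
    bounds [s] from above by test functions; the local and global estimates of the normal part rest
    on it. *)
Lemma capillary_decomposition : exists (w : borel E -> R) (s : {measure set (borel E) -> \bar R}),
  [/\ measurable_fun setT w /\ forall x, `|w x| <= B, (s setT < +oo)%E /\ s (~` S) = 0%E,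
    forall phi, C1_closure Omega phi -> first_variation Omega m V phi =
      - (\int[mu]_(x in K) dot (H x) (phi x)) + \int[mu]_(x in S) (dot (phi x) (N x) * w x)
      - \int[s]_(x in S) dot (phi x) (N x)
      - \int[Gamma]_(y in bundle) dot (conormal Omega y.1 y.2) (tangential_part phi y.1) &
    forall (A : set E) f c, up1 Omega f c -> (forall x, K x -> 0 <= f x) ->
        (forall x, A x -> K x -> 1 <= f x) -> (s A <= (normal_mass Omega m V N H f c)%:E)%E].
Proof.
have [s [sT sS sE sle]] := exists_normal_measure dO isV Cg g_gt0 g_eq0 KW CN N_grad iH
  interior_variation.
have [w [mw wB wE]] := exists_wall_curvature dO isV Cg g_gt0 g_eq0 KW CN N_grad iH
  interior_variation oW N_normal.
exists w, s; split => // phi Cphi.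
have pJ := C1_closure_upV Cphi.
have [c fc] := up1_dot pJ N_upV.
have [J' pJ'] := tangential_part_upV pJ.
have pN := upV_scale fc N_upV.
have Htan : {ae mu, forall x : borel E, S x -> tangent Omega x (H x)} by case: cap.
have cf : cK (fun x => dot (phi x) (N x)) by case: fc.
have -> : first_variation Omega m V phi = first_variation Omega m V (tangential_part phi) +
    first_variation Omega m V (fun x => dot (phi x) (N x) *: N x).
  rewrite -(first_variationD pJ' pN); congr first_variation.
  by apply/funext => x; rewrite /tangential_part subrK.
rewrite (tangential_variation (tangential_part_field pJ)).
rewrite (first_variation_normalE dO isV Cg g_gt0 g_eq0 KW CN N_grad iH interior_variation
  N_normal Htan fc (wE _ cf) (sE _ _ fc)).
have -> : \int[mu]_(x in K) dot (H x) (phi x) = \int[mu]_(x in K) dot (H x) (tangential_part phi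
  x) +
    \int[mu]_(x in K) dot (H x) (dot (phi x) (N x) *: N x).
  rewrite -RintegralD//.
  - apply: eq_Rintegral => x _; rewrite -dotDr; congr dot.
    by rewrite /tangential_part subrK.
  - by apply: dot_H_int => i; have [] := pJ' i.
  - by apply: dot_H_int => i; have [] := pN i.
by ring.
Qed.

Let OK : Omega `<=` K. Proof. exact: subset_closure. Qed.
Let mO : measurable (Omega : set (borel E)). Proof. exact: open_borel. Qed.

Lemma measurable_enorm_H : measurable_fun (K : set (borel E)) (fun x : borel E => enorm (H x)).
Proof.
have mH i : measurable_fun (K : set (borel E)) (fun x : borel E => H x 0 i).
  by apply/measurable_EFinP; exact: measurable_int (iH i).
have mS2 : measurable_fun (K : set (borel E)) (fun x : borel E => \sum_i H x 0 i * H x 0 i).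
  by apply: measurable_sum => i; exact: measurable_funM.
have ms : measurable_fun setT (@Num.sqrt R) by apply: continuous_measurable_fun;
  exact: sqrt_continuous.
exact: measurableT_comp ms mS2.
Qed.

Lemma enorm_H_integrable : mu.-integrable (K : set (borel E)) (EFin \o (fun x : borel E => enorm
  (H x))).
Proof.
apply: (@le_integrable _ _ _ mu K mK _ (EFin \o (fun x : borel E => \sum_i `|H x 0 i|))).
- by apply/measurable_EFinP; exact: measurable_enorm_H.
- move=> x _; rewrite /= lee_fin !ger0_norm ?enorm_ge0 ?sumr_ge0//; exact: enorm_le_sum.
- by apply: integrable_big => // i; exact: integrable_norm (iH i).
Qed.

Lemma dot_H_bound (f : borel E -> R) (A : set (borel E)) (c : E -> E) : measurable A ->
  (forall i, cK (fun x => c x 0 i)) ->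
  measurable_fun (K : set (borel E)) f -> (forall x, K x -> `|f x| <= 1) ->
  (forall x, K x -> `|f x| * enorm (c x) <= \1_A x) ->
  `|\int[mu]_(x in K) (f x * dot (H x) (c x))| <= \int[mu]_(x in K) (\1_A x * enorm (H x)).
Proof.
move=> mA cc mf f1 cA; have iHc := dot_H_integrable dO iH cc.
apply: le_Rintegral_norm => //.
- exact: (integrable_mul (C := 1)).
- apply: (integrable_mul (C := 1) mK enorm_H_integrable); first exact: measurable_indic.
  by move=> y _; exact: indic_norm_le1.
- move=> x Kx; rewrite normrM.
  apply: (@le_trans _ _ (`|f x| * (enorm (H x) * enorm (c x)))).
    by rewrite ler_wpM2l// dot_le_enorm.
  by rewrite mulrCA mulrC ler_wpM2r ?enorm_ge0//; exact: cA.
Qed.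

Lemma curvature_mass (A : set (borel E)) : measurable A ->
  (\int[mu]_(x in K) (\1_A x * enorm (H x)))%:E = (\int[mu]_(x in A `&` K) (enorm (H x))%:E)%E.
Proof.
move=> mA; rewrite -Rintegral_setI_indic// setIC; apply: Rintegral_EFin; first exact: measurableI.
by apply: (integrableS mK _ _ enorm_H_integrable); [exact: measurableI|move=> x []].
Qed.

Variable b : R.
Hypothesis jac_le : forall x i j, K x -> `|jac N x i j| <= b.
Local Notation CJ := (n.+1%:R * (n.+1%:R * b)).

(** The trace is a sum of (n+1)^2 products of an entry of a projection, at most 1, and an entry of
    [jac N], at most [b]. *)
Lemma trace_le (y : E * M) : D y -> `|\tr (y.2 *m jac N y.1)| <= CJ.
Proof.
move=> [Ky [PT PP _]]; apply: le_trans (ler_norm_sum _ _ _) _.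
rewrite -[CJ](_ : \sum_(i < n.+1) n.+1%:R * b = _);
  last by rewrite sumr_const card_ord [RHS]mulr_natl.
apply: ler_sum => i _; rewrite mxE; apply: le_trans (ler_norm_sum _ _ _) _.
rewrite -[n.+1%:R * b](_ : \sum_(i < n.+1) b = _);
  last by rewrite sumr_const card_ord [RHS]mulr_natl.
apply: ler_sum => k _; rewrite normrM -[leRHS]mul1r.
by apply: ler_pM => //; [exact: proj_entry|exact: jac_le].
Qed.

Lemma bundle_mass (F : borel (E * M)%type -> R) (A : set (borel E)) (C : R) : measurable A ->
  V.-integrable D (EFin \o F) ->
  (forall y, D y -> `|F y| <= \1_A y.1 * C) ->
  (`|\int[V]_(y in D) F y|%:E <= C%:E * mu A)%E.
Proof.
move=> mA iF FA; have mpA := measurable_pre_point mA.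
have VD : (V D < +oo)%E by exact: bundle_finite.
have iC : V.-integrable D (EFin \o cst C) by apply: (bounded_integrable (M := `|C|)).
have VA : (V (D `&` point_of @^-1` A) < +oo)%E.
  by apply: le_lt_trans VD; rewrite le_measure ?inE//; exact: measurableI.
rewrite [mu A](base_measure_bundle cptK nullV mA) -[V _]fineK; last by rewrite ge0_fin_numE.
rewrite -EFinM -Rintegral_cst; last exact: measurableI.
rewrite lee_fin (@Rintegral_setI_indic _ _ _ V D (point_of @^-1` A) (fun=> C) mD mpA).
apply: le_Rintegral_norm => //.
apply: (integrable_mul (C := 1) mD iC); first exact: measurable_indic.
by move=> y _; exact: indic_norm_le1.
Qed.

Lemma proj_dot_le (y : E * M) (u v : E) (C : R) : D y -> enorm u <= 1 -> enorm v <= C ->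
  `|dot (u *m y.2) v| <= C.
Proof.
move=> [_ [PT PP _]] u1 vC; apply: le_trans (dot_le_enorm _ _) _; rewrite -[leRHS]mul1r.
rewrite ler_pM ?enorm_ge0//; apply: le_trans u1; exact: enorm_proj.
Qed.

(** [C] bounds the gradient of the test function and [CJ] the trace of P DN. The indicator of
    [Omega] in [normal_mass] is why only the curvature inside [Omega] appears. *)
Lemma normal_mass_le (A : set (borel E)) f c (C : R) : measurable A -> 0 <= C -> up1 Omega f c ->
  (forall x, K x -> `|f x| <= \1_A x) -> (forall x, K x -> enorm (c x) <= \1_A x * C) ->
  ((normal_mass Omega m V N H f c)%:E <=
     (CJ + C)%:E * mu A + \int[mu]_(x in A `&` Omega) (enorm (H x))%:E)%E.
Proof.
move=> mA C0 fc fA cA; have cf : cK f by case: fc.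
have OKA : A `&` Omega `&` K = A `&` Omega by apply/setIidl => x [_ /OK].
rewrite -[in leRHS]OKA -curvature_mass; last exact: measurableI.
have h1 : `|\int[mu]_(x in K) (\1_Omega x * (f x * dot (H x) (N x)))| <=
    \int[mu]_(x in K) (\1_(A `&` Omega) x * enorm (H x)).
  rewrite (_ : \int[mu]_(x in K) _ = \int[mu]_(x in K) (\1_Omega x * dot (H x) (f x *: N x)));
    last first.
    by apply: eq_Rintegral => x _; rewrite dotZr.
  apply: dot_H_bound.
  - exact: measurableI.
  - move=> i; rewrite (_ : (fun x => _) = fun x => f x * N x 0 i); last by apply/funext => x;
    rewrite mxE.
    exact: withinM.
  - exact: measurable_indic.
  - by move=> x _; exact: indic_norm_le1.
  - move=> x Kx; rewrite enormZ !indicE in_setI; have [_|_] := boolP (x \in Omega); last first.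
      by rewrite normr0 mul0r andbF.
    rewrite normr1 mul1r andbT -[leRHS]mulr1 ler_pM ?enorm_ge0 ?N_le1//.
    by have := fA x Kx; rewrite indicE.
have indiv : V.-integrable D (EFin \o (normal_div N f c : borel (E * M)%type -> R)).
  by apply: bundle_integrable => //; exact: (normal_div_continuous KW CN fc).
have h2 : (`|\int[V]_(y in D) (\1_Omega y.1 * normal_div N f c y)|%:E <= (CJ + C)%:E * mu A)%E.
  apply: bundle_mass => //.
    apply: (integrable_mul (C := 1) mD indiv).
      exact: measurable_indic_base.
    by move=> y _; exact: indic_norm_le1.
  move=> y Dy; rewrite normrM -[leRHS]mul1r ler_pM//.
    exact: indic_norm_le1.
  rewrite /normal_div; apply: le_trans (ler_normD _ _) _; rewrite mulrDr lerD//.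
    by rewrite normrM ler_pM// ?trace_le//; apply: fA; case: Dy.
  by apply: (proj_dot_le Dy); [apply: N_le1; case: Dy|apply: cA; case: Dy].
apply: (@le_trans _ _ (`|\int[V]_(y in D) (\1_Omega y.1 * normal_div N f c y)|%:E +
   (\int[mu]_(x in K) (\1_(A `&` Omega) x * enorm (H x)))%:E)%E); last exact: leeD2r.
rewrite -EFinD lee_fin /normal_mass addrC; apply: lerD.
  by apply: le_trans (ler_norm _) _; rewrite normrN.
by apply: le_trans h1; apply: le_trans (ler_norm _) _; rewrite normrN.
Qed.

(** This is not an orthogonal projection where |N| < 1, but with a = <phi, N> one has |phi - a N|^2
    = |phi|^2 - (2 - |N|^2) a^2, and |N| <= 1. *)
Lemma tangential_le phi x : K x -> enorm (tangential_part phi x) <= enorm (phi x).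
Proof.
move=> Kx; rewrite /tangential_part -(@ler_pXn2r _ 2) ?nnegrE ?enorm_ge0//.
set a := dot (phi x) (N x); rewrite !enorm_sqr dotBl !dotBr !dotZl !dotZr -(dotC (phi x)) -/a
  -(enorm_sqr (N x)).
have h : a ^+ 2 * enorm (N x) ^+ 2 <= a ^+ 2 * 1.
  by rewrite ler_wpM2l ?sqr_ge0// expr_le1 ?enorm_ge0// N_le1.
have := sqr_ge0 a; move: h; move: (enorm (N x) ^+ 2) (dot (phi x) (phi x)) => u v; lra.
Qed.

Lemma bounded_variation : bounded_first_variation Omega m V.
Proof.
have [w [s [[mw wB] [sT _] FV _]]] := capillary_decomposition.
(* One finite mass for each of the four terms of the decomposition, all of whose integrands are
   controlled by |phi| <= 1. *)
pose C := \int[mu]_(x in K) (\1_[set: borel E] x * enorm (H x)) + \int[mu]_(x in S) B +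
  \int[s]_(x in S) 1 + \int[Gamma]_(y in bundle) 1.
apply: (@le_lt_trans _ _ C%:E); last exact: ltry.
apply: ub_ereal_sup => _ [phi [Cphi phi1] <-]; rewrite lee_fin FV//.
have pJ := C1_closure_upV Cphi.
have [c [cf _ _]] := up1_dot pJ N_upV.
have [J' pJ'] := tangential_part_upV pJ.
have cphi i : cK (fun x => phi x 0 i) by have [] := pJ i.
have ct i : cK (fun x => tangential_part phi x 0 i) by have [] := pJ' i.
have dN x : K x -> `|dot (phi x) (N x)| <= 1.
  move=> Kx; apply: le_trans (dot_le_enorm _ _) _; rewrite -[leRHS]mulr1.
  by apply: ler_pM; rewrite ?enorm_ge0 ?phi1 ?N_le1.
have muS : (mu S < +oo)%E by exact: (base_finite cptK rV nullV).
have sS : (s S < +oo)%E by apply: le_lt_trans sT; rewrite le_measure ?inE.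
have GS : (Gamma bundle < +oo)%E.
  have cptS : compact S by apply: (subclosed_compact _ cptK); [exact: frontier_closed|exact: SK].
  have GD : (Gamma (plane_bundle m S) < +oo)%E by apply: rG; exact: plane_bundle_compact.
  apply: le_lt_trans GD; rewrite le_measure ?inE//.
    by apply: plane_bundle_measurable; exact: frontier_closed.
  by rewrite capillary_bundleE => y [].
have cfS := within_frontier cf.
apply: le_trans (ler_normB _ _) _; apply: lerD.
  apply: le_trans (ler_normB _ _) _; apply: lerD.
    apply: le_trans (ler_normD _ _) _; rewrite normrN; apply: lerD.
      rewrite (_ : \int[mu]_(x in K) dot (H x) (phi x) = \int[mu]_(x in K) (1 * dot (H x) (phi
        x))).
        apply: (@dot_H_bound (fun=> 1) setT phi) => //.
          by move=> x _; rewrite normr1.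
        by move=> x Kx; rewrite normr1 mul1r indicT phi1.
      by apply: eq_Rintegral => x _; rewrite mul1r.
    apply: le_Rintegral_norm => //.
    + apply: (bounded_integrable (M := B)) => //.
        apply: measurable_funM; first exact: within_measurable.
        exact: measurable_funTS.
      move=> x [Kx _]; rewrite normrM -[leRHS]mul1r; apply: ler_pM => //; exact: dN.
    + by apply: (bounded_integrable (M := B)) => // x _; rewrite ger0_norm// mulr_ge0.
    + move=> x [Kx _]; rewrite normrM -[leRHS]mul1r; apply: ler_pM => //; exact: dN.
  apply: le_Rintegral_norm => //.
  + by apply: (bounded_integrable (M := 1)) => //; [exact: within_measurable|move=> x [Kx _];
    exact: dN].
  + by apply: (bounded_integrable (M := 1)) => // x _; rewrite normr1.
  + by move=> x [Kx _]; exact: dN.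
have bd (y : borel (E * M)%type) : bundle y ->
  `|dot (conormal Omega y.1 y.2) (tangential_part phi y.1)| <= 1.
  move=> [Sy _]; apply: le_trans (dot_le_enorm _ _) _; rewrite -[leRHS]mulr1.
  apply: ler_pM; rewrite ?enorm_ge0 ?conormal_le1//.
  exact: le_trans (tangential_le _ (SK Sy)) (phi1 _ (SK Sy)).
apply: le_Rintegral_norm => //.
- apply: (bounded_integrable (M := 1)) => //.
  apply: measurable_sum => i; apply: measurable_funM.
    exact: (measurable_conormal cbeta beta_pi inner_normal_within).
  have mt : measurable_fun (plane_bundle m S : set (borel (E * M)%type)) (fun y =>
    tangential_part phi y.1 0 i).
    apply: within_measurable; first by apply: plane_bundle_measurable; exact: frontier_closed.
    exact: (within_fst (within_frontier (ct i))).
  apply: measurable_funS mt; first by apply: plane_bundle_measurable; exact: frontier_closed.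
  by rewrite capillary_bundleE => y [].
- by apply: (bounded_integrable (M := 1)) => // y _; rewrite normr1.
Qed.

Let meball (x0 : E) r : measurable (eball x0 r : set (borel E)).
Proof. by apply: closed_borel; exact: eball_closed. Qed.

Section NormalEstimate.
Variable s : {measure set (borel E) -> \bar R}.
Hypothesis sle : forall (A : set E) f c, up1 Omega f c -> (forall x, K x -> 0 <= f x) ->
  (forall x, A x -> K x -> 1 <= f x) -> (s A <= (normal_mass Omega m V N H f c)%:E)%E.

Lemma normal_local (x0 : E) r : 0 < r ->
  (s (eball x0 (r / 2)) <= (CJ + 16 / r)%:E * mu (eball x0 r) +
    \int[mu]_(x in eball x0 r `&` Omega) (enorm (H x))%:E)%E.
Proof.
move=> r0; apply: le_trans (sle (cutoff_up1 Omega x0 r0) _ _) _.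
- by move=> x _; case/andP: (cutoff_bound x0 r x).
- by move=> x xB _; rewrite cutoff_eq1.
apply: normal_mass_le => //.
- by rewrite divr_ge0 ?ltW.
- exact: cutoff_up1.
- by move=> x _; exact: cutoff_indic.
- by move=> x _; exact: cutoff_grad_indic.
Qed.

(** The test function is the constant 1, whose gradient is 0. *)
Lemma normal_global :
  (s S <= CJ%:E * mu K + \int[mu]_(x in Omega) (enorm (H x))%:E)%E.
Proof.
apply: le_trans (sle (up1_cst Omega 1) _ _) _ => //.
have := @normal_mass_le setT _ _ 0 measurableT (lexx 0) (up1_cst Omega 1).
rewrite addr0 setTI (base_measureI cptK nullV (A := setT))// setTI; apply.
- by move=> x _; rewrite normr1 indicT.
- by move=> x _; rewrite enorm0 mulr0.
Qed.
End NormalEstimate.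

Section TangentialEstimate.
Variable tau : E.
Hypothesis tau1 : enorm tau = 1.

(** [tangential_part_upV] provides some Jacobian only; here it is written out for a constant field
    [tau], because its size enters the constant [CJ + CJ]. *)
Let f0 x : R := \sum_j - tau 0 j * N x 0 j.
Let c0 x : E := \sum_j (- tau 0 j *: (\row_i jac N x i j) + N x 0 j *: 0).
Let J0 x : M := 0 + (f0 x *: jac N x + (c0 x)^T *m N x).
Let T0 x : E := tangential_part (fun=> tau) x.

Let f0E x : f0 x = - dot tau (N x).
Proof. by rewrite /f0 /dot -sumrN; apply: eq_bigr => j _; rewrite mulNr. Qed.

Let T0_upV : upV Omega T0 J0.
Proof.
have fc : up1 Omega f0 c0.
  by apply: up1_sum => j; exact: up1M (up1_cst Omega (- tau 0 j)) (N_upV j).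
have := upVD (upV_cst Omega tau) (upV_scale fc N_upV); congr upV.
by apply/funext => x; rewrite /T0 /tangential_part f0E scaleNr.
Qed.

Let c0_le x : K x -> enorm (c0 x) <= CJ.
Proof.
move=> Kx; apply: enorm_le_coord => i; rewrite /c0 summxE.
apply: le_trans (ler_norm_sum _ _ _) _.
rewrite -[n.+1%:R * b](_ : \sum_(i < n.+1) b = _);
  last by rewrite sumr_const card_ord [RHS]mulr_natl.
apply: ler_sum => j _; rewrite scaler0 addr0 mxE [X in _ * X]mxE normrM normrN -[leRHS]mul1r.
by apply: ler_pM => //; [rewrite -tau1; exact: coord_le_enorm|exact: jac_le].
Qed.

Let T0_le1 x : K x -> enorm (T0 x) <= 1.
Proof. by move=> Kx; rewrite -tau1; exact: tangential_le. Qed.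

Let trace_J0 y : D y -> `|\tr (y.2 *m J0 y.1)| <= CJ + CJ.
Proof.
move=> Dy; rewrite /J0 add0r mulmxDr -scalemxAr mxtraceD mxtraceZ trace_outer.
have Ky : K y.1 by case: Dy.
apply: le_trans (ler_normD _ _) _; apply: lerD.
  rewrite normrM -[leRHS]mul1r; apply: ler_pM => //; last exact: trace_le.
  rewrite f0E normrN; apply: le_trans (dot_le_enorm _ _) _.
  by rewrite tau1 mul1r N_le1.
by apply: (proj_dot_le Dy); [exact: N_le1|exact: c0_le].
Qed.

Variable Gx : R.-pker borel E ~> borel M.
Hypothesis dis : disintegrates Omega beta m Gamma Gx.
Local Notation nW := (wetting_conormal Omega beta m Gx).

(** The test field is the cutoff times the tangential part of [tau]. It is tangent on [S], where it
    turns the boundary term into the flux of cos(beta) n_W against the cutoff times [tau]. *)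
Lemma tangential_flux (x0 : E) r : 0 < r ->
  ((\int[sG]_(x in S) dot (cos (beta x) *: nW x) (cutoff x0 r x *: tau))%:E <=
    (CJ + CJ + 16 / r)%:E * mu (eball x0 r) +
    \int[mu]_(x in eball x0 r `&` K) (enorm (H x))%:E)%E.
Proof.
move=> r0; pose f := cutoff x0 r.
have fc := cutoff_up1 Omega x0 r0; rewrite -/f in fc.
pose phi x := f x *: T0 x.
pose J x : M := f x *: J0 x + (cutoff_grad x0 r x)^T *m T0 x.
have pJ : upV Omega phi J by exact: upV_scale fc T0_upV.
have cphi i : cK (fun x => phi x 0 i) by have [] := pJ i.
have tphi x : S x -> phi x = tproj Omega x (f x *: tau).
  move=> Sx; rewrite /phi /T0 tangential_partE// /tproj scalerBr scalerA dotZl.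
  by [].
have tfield : tangential_field Omega phi.
  split; first exact: upV_C1_closure pJ.
  by move=> x Sx; rewrite tphi//; exact: tproj_tangent.
have := tangential_variation tfield.
rewrite (boundary_term dO cbeta beta_pi inner_normal_within rG nullG dis); last by move=> i;
  exact: within_frontier.
rewrite (eq_Rintegral sG (g := fun x => dot (mean_conormal Omega beta m Gx x) (tproj Omega x (f x
  *: tau)))); last first.
  by move=> x; rewrite inE => Sx; rewrite tphi.
rewrite (boundary_term_wetting m Gamma dO cbeta beta_pi inner_normal_within Gx (fun x => f x *:
  tau)).
set I := \int[sG]_(x in S) _; set Q := \int[mu]_(x in K) _ => FV.
have {FV}-> : I = - first_variation Omega m V phi - Q by rewrite FV; ring.
have hQ : `|Q| <= \int[mu]_(x in K) (\1_(eball x0 r) x * enorm (H x)).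
  rewrite /Q (_ : \int[mu]_(x in K) _ = \int[mu]_(x in K) (1 * dot (H x) (phi x))).
    apply: dot_H_bound => //.
    - by move=> x _; rewrite normr1.
    - move=> x Kx; rewrite normr1 mul1r /phi enormZ -[leRHS]mulr1.
      by apply: ler_pM; rewrite ?enorm_ge0 ?T0_le1//; exact: cutoff_indic.
  by apply: eq_Rintegral => x _; rewrite mul1r.
have hF : (`|first_variation Omega m V phi|%:E <= (CJ + CJ + 16 / r)%:E * mu (eball x0 r))%E.
  have -> : first_variation Omega m V phi = \int[V]_(y in D) \tr (y.2 *m J y.1).
    apply: eq_Rintegral => y; rewrite inE => -[Ky _].
    by rewrite /Defs.pdiv (upV_ext_jacobian pJ Ky).
  apply: bundle_mass => //.
    apply: bundle_integrable => //; apply: within_trace => i j.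
    exact: upV_jac_continuous pJ.
  move=> y Dy; have Ky : K y.1 by case: Dy.
  rewrite /J mulmxDr -scalemxAr mxtraceD mxtraceZ trace_outer.
  apply: le_trans (ler_normD _ _) _; rewrite mulrDr; apply: lerD.
    by rewrite normrM; apply: ler_pM => //; [exact: cutoff_indic|exact: trace_J0].
  by apply: (proj_dot_le Dy); [exact: T0_le1|exact: cutoff_grad_indic].
rewrite -curvature_mass//.
apply: (@le_trans _ _ (`|first_variation Omega m V phi|%:E +
   (\int[mu]_(x in K) (\1_(eball x0 r) x * enorm (H x)))%:E)%E); last exact: leeD2r.
rewrite -EFinD lee_fin; apply: lerD.
  by apply: le_trans (ler_norm _) _; rewrite normrN.
by apply: le_trans hQ; apply: le_trans (ler_norm _) _; rewrite normrN.
Qed.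

(** The cutoff is nonnegative, supported where the lower bound [eps0] holds since r <= rho0, and
    equal to 1 on the half ball: the flux is at least [eps0] times the mass of the half ball. *)
Lemma tangential_estimate (x0 : E) eps0 rho0 r : 0 < eps0 -> 0 < r <= rho0 ->
  {ae sG, forall x : borel E, eball x0 rho0 x -> eps0 <= dot (cos (beta x) *: nW x) tau} ->
  (eps0%:E * sG (eball x0 (r / 2)) <=
    (CJ + CJ + 16 / r)%:E * mu (eball x0 r) +
    \int[mu]_(x in eball x0 r `&` K) (enorm (H x))%:E)%E.
Proof.
move=> e0 /andP[r0 rr0] lb; apply: le_trans (tangential_flux x0 r0).
have fc := cutoff_up1 Omega x0 r0.
have cphi i : {within S, continuous (fun x => (cutoff x0 r x *: tau) 0 i)}.
  rewrite (_ : (fun x => _) = fun x => cutoff x0 r x * tau 0 i); last by apply/funext => x;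
    rewrite mxE.
  by apply: withinM; [apply: within_frontier; case: fc|exact: within_cst].
have iF := wetting_integrable dO cbeta beta_pi inner_normal_within rG nullG Gx cphi.
set F := fun x : borel E => dot (cos (beta x) *: nW x) (cutoff x0 r x *: tau).
rewrite -/F in iF; rewrite (Rintegral_EFin mS iF).
have mF := measurable_int _ iF.
pose L (x : borel E) : \bar R := (eps0 * \1_(eball x0 (r / 2)) x)%:E.
have mL : measurable_fun (S : set (borel E)) L.
  apply/measurable_EFinP; apply: measurable_funM => //; exact: measurable_indic.
have LF : {ae sG, forall x : borel E, S x -> (L x <= (F x)%:E)%E}.
  apply: filterS lb => x xlb _; rewrite lee_fin /F dotZr.
  have /andP[c0' c1] := cutoff_bound x0 r x.
  have [xB|xB] := pselect (eball x0 r x); last first.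
    rewrite cutoff_eq0// mul0r indicE memNset ?mulr0// => xB'; apply: xB.
    by apply: le_trans xB' _; rewrite ler_pdivrMr// ler_pMr// ler1n.
  have := xlb (le_trans xB rr0) => h.
  apply: (@le_trans _ _ (cutoff x0 r x * eps0)); last by rewrite ler_wpM2l.
  rewrite mulrC ler_wpM2r ?(ltW e0)// indicE.
  by have [/set_mem/(cutoff_eq1 r0)->|_] := boolP (x \in _).
have -> : (eps0%:E * sG (eball x0 (r / 2)) = \int[sG]_(x in S) L x)%E.
  have cptS : compact S by apply: (subclosed_compact _ cptK); [exact: frontier_closed|exact: SK].
  rewrite (base_measureI cptS (capillary_null cbeta inner_normal_within nullG))//.
  rewrite -integral_indic// -ge0_integralZl//; last by rewrite lee_fin ltW.
  by apply/measurable_EFinP; exact: measurable_indic.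
(* The inequality L <= F holds only almost everywhere; replacing F by max(L, F) makes it pointwise,
   and keeps the integrand nonnegative. *)
have mx : measurable_fun (S : set (borel E)) (fun x => maxe (L x) (F x)%:E).
  by apply: measurable_maxe.
have -> : (\int[sG]_(x in S) (F x)%:E = \int[sG]_(x in S) maxe (L x) (F x)%:E)%E.
  apply: ae_eq_integral => //; apply: filterS LF => x xLF Sx.
  by rewrite (max_idPr (xLF Sx)).
have L0 x : (0 <= L x)%E by rewrite lee_fin mulr_ge0 ?(ltW e0).
apply: ge0_le_integral => //.
by move=> x _; rewrite le_max lexx.
Qed.
End TangentialEstimate.
End CapillaryVariation.

(** * Constants of the domain *)

Section DomainConstants.
Context {R : realType} {n : nat}.
Local Notation E := 'rV[R]_n.+1.
Implicit Types (Omega : set E) (N : E -> E).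

Lemma frontier_continuous Omega (beta : E -> R) : C1_on_frontier Omega (beta : _ -> R^o) ->
  {within frontier Omega, continuous beta}.
Proof.
move=> bC; rewrite continuous_subspace_in => x /set_mem Sx.
have [U [G [oU Ux CG GS]]] := bC x Sx.
have cG : {for x, continuous G} by apply: differentiable_continuous; case: (CG x Ux).
apply/cvgrPdist_lt => e e0.
have h1 : \forall y \near x, `|G x - G y| < e by move/cvgrPdist_lt: cG => /(_ e e0).
have h2 : \forall y \near x, U y by apply: open_nbhs_nbhs.
have h : within (frontier Omega) (nbhs x) [set y | `|beta x - beta y| < e].
  by apply: filterS2 h1 h2 => y Gy Uy Sy; rewrite /= -!GS.
by rewrite nbhs_subspace_in in h.
Qed.

Lemma exists_jac_bound Omega N W : bounded_C2_domain Omega -> closure Omega `<=` W ->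
  isC1_field W N -> exists2 b : R, 0 <= b &
    forall x i j, closure Omega x -> `|jac N x i j| <= b.
Proof.
move=> dO KW CN; have cptK : compact (closure Omega).
  by case: dO => _ _ _ bO _; exact: closure_bounded_compact.
have cJ i j : {within closure Omega, continuous (fun x => jac N x i j)}.
  exact: upV_jac_continuous (isC1_field_upV KW CN).
have /choice[C CP] : forall p : 'I_n.+1 * 'I_n.+1, exists C : R, 0 <= C /\
    forall x, closure Omega x -> `|jac N x p.1 p.2| <= C.
  by move=> p; have [C /ltW C0 h] := within_bounded cptK (cJ p.1 p.2); exists C.
exists (\sum_p C p); first by apply: sumr_ge0 => p _; case: (CP p).
move=> x i j Kx; apply: le_trans ((CP (i, j)).2 x Kx) _.
by rewrite (bigD1 (i, j))//= lerDl sumr_ge0// => p _; case: (CP p).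
Qed.

Lemma exists_diameter Omega : bounded_C2_domain Omega -> exists2 d : R, 0 < d &
  forall x y, closure Omega x -> closure Omega y -> enorm (y - x) <= d.
Proof.
move=> dO; have cptK : compact (closure Omega).
  by case: dO => _ _ _ bO _; exact: closure_bounded_compact.
have [C [_ CK]] := compact_bounded cptK.
have {}CK x : closure Omega x -> `|x| <= `|C| + 1.
  by move=> Kx; apply: (CK (`|C| + 1)) => //; rewrite (le_lt_trans (ler_norm C))// ltrDl.
exists (n.+1%:R * ((`|C| + 1) + (`|C| + 1))).
  by rewrite mulr_gt0// addr_gt0// ltr_wpDl.
move=> x y Kx Ky; apply: le_trans (enorm_le_norm _) _; rewrite ler_wpM2l//.
by apply: le_trans (ler_normB _ _) _; apply: lerD; exact: CK.
Qed.

(** If rho > d, the point x + (d + rho)/2 nu(x) would lie in the closure at a distance greater than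
    [d] from x. Through this bound the constant of the local estimate depends on [Omega] alone. *)
Lemma tubular_radius_le Omega (rho d : R) x : bounded_C2_domain Omega ->
  (forall x y, closure Omega x -> closure Omega y -> enorm (y - x) <= d) ->
  frontier Omega x -> tubular_radius Omega rho -> rho <= d.
Proof.
move=> dO Kd Sx [rho0 [_ [xi [t [tube _ _ _]]]]].
have Kx : closure Omega x by case: Sx.
have d0 : 0 <= d by apply: le_trans (Kd x x Kx Kx); rewrite enorm_ge0.
rewrite leNgt; apply/negP => drho.
pose r := (d + rho) / 2.
have r0 : 0 <= r by rewrite divr_ge0// addr_ge0// ltW.
have rr : 0 <= r < rho by rewrite r0/= /r; lra.
have [[Ky _] _ _] := tube x r Sx rr.
have := Kd _ _ Kx Ky; rewrite addrC addKr enormZ inner_normal_unit// mulr1 ger0_norm//.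
by rewrite /r; lra.
Qed.

End DomainConstants.

Lemma Lnorm_pinfty_le d (T : measurableType d) (R : realType) (mu : {measure set T -> \bar R})
    (f : T -> \bar R) (C : R) : 0 <= C -> (forall x, `|f x| <= C%:E)%E ->
  (Lnorm mu +oo f <= C%:E)%E.
Proof.
move=> C0 fC; rewrite unlock /Lnorm; case: ifPn => _; last by rewrite lee_fin.
by apply/ess_supP; apply/aeW => x; exact: fC.
Qed.
Theorem proposition3p2 (R : realType) (n : nat) (hn : (2 <= n)%N) :
  (* L bounds the norm of \tilde H and sees S only through its second
     fundamental form *)
  exists L : R -> R,
  forall Omega : set 'rV[R]_n.+1, bounded_C2_domain Omega ->
  (* the constants c(Omega), C_0(Omega) *)
  exists c C0 : R, 0 < c /\ 0 < C0 /\
  forall (m : nat) (hm : (1 <= m <= n)%N) (beta : 'rV[R]_n.+1 -> R),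
  C1_on_frontier Omega (beta : _ -> R^o) ->
  (forall x, frontier Omega x -> 0 < beta x < pi) ->
  forall (V Gamma : {measure set (borel ('rV[R]_n.+1 * 'M[R]_n.+1)%type) -> \bar R})
         (H : 'rV[R]_n.+1 -> 'rV[R]_n.+1),
  capillary_varifold Omega beta m V Gamma H ->
  bounded_first_variation Omega m V /\
  exists (Ht : 'rV[R]_n.+1 -> 'rV[R]_n.+1)
         (sperp : {measure set (borel 'rV[R]_n.+1) -> \bar R}),
  let S : set (borel 'rV[R]_n.+1) := frontier Omega in
  let nu := inner_normal Omega in
  let muV : {measure set (borel 'rV[R]_n.+1) -> \bar R} := base_measure V in
  let sG : {measure set (borel 'rV[R]_n.+1) -> \bar R} := base_measure Gamma in
  [/\ forall i, measurable_fun S (fun x : borel 'rV[R]_n.+1 => Ht x 0 i),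
      {ae muV, forall x : borel 'rV[R]_n.+1, S x ->
         forall v, tangent Omega x v -> dot (Ht x) v = 0},
      (Lnorm muV +oo (fun x => (\1_S x * enorm (Ht x))%:E)
         <= (L (second_ff_norm Omega))%:E)%E,
      radon sperp /\ sperp (~` S) = 0%E
    & forall Gx : R.-pker borel 'rV[R]_n.+1 ~> borel 'M[R]_n.+1,
      disintegrates Omega beta m Gamma Gx ->
      let nV := mean_conormal Omega beta m Gx in
      let nW := wetting_conormal Omega beta m Gx in
      [/\ forall phi, C1_closure Omega phi ->
            first_variation Omega m V phi =
              - (\int[muV]_(x in closure Omega) dot (H x) (phi x))
              - (\int[muV]_(x in S) dot (Ht x) (phi x))
              - (\int[sperp]_(x in S) dot (nu x) (phi x))
              - (\int[sG]_(x in S `&` [set x | cos (beta x) != 0])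
                   dot (nV x) (tproj Omega x (phi x)))
            /\
            \int[sG]_(x in S `&` [set x | cos (beta x) != 0])
                dot (nV x) (tproj Omega x (phi x)) =
            \int[sG]_(x in S) dot (cos (beta x) *: nW x) (phi x),
          (* normal part, local *)
          forall rhoS, tubular_radius Omega rhoS ->
          forall x0 rho, S x0 -> 0 < rho <= rhoS ->
            (sperp (eball x0 (rho / 2)) <=
               (c / rho)%:E * muV (eball x0 rho) +
               \int[muV]_(x in eball x0 rho `&` Omega) (enorm (H x))%:E)%E,
          (* normal part, global *)
          (sperp S <= c%:E * muV (closure Omega) +
                      \int[muV]_(x in Omega) (enorm (H x))%:E)%E
        & (* tangential part *)
          forall rhoS, tubular_radius Omega rhoS ->
          forall x0, msupport sG x0 -> approx_continuous_at sG S nV x0 ->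
          forall eps, 0 < eps <= 1 ->
          Num.sqrt (sin (beta x0) ^+ 2 + eps ^+ 2 * cos (beta x0) ^+ 2)
            <= enorm (nV x0) ->
          (exists rho1, 0 < rho1 < rhoS / 2 /\
           forall rho, 0 < rho < rho1 ->
            ((eps * `|cos (beta x0)|)%:E * sG (eball x0 (rho / 2)) <=
               (C0 / rho)%:E * muV (eball x0 (2 * rho)) +
               sG (eball x0 rho) +
               \int[muV]_(x in eball x0 (2 * rho) `&` closure Omega)
                  (enorm (H x))%:E)%E)
          /\
          (forall (tau : 'rV[R]_n.+1) (eps0 rho0 : R),
           tangent Omega x0 tau -> enorm tau = 1 ->
           0 < eps0 <= 1 -> 0 < rho0 <= 1 ->
           {ae sG, forall x : borel 'rV[R]_n.+1, eball x0 rho0 x ->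
              eps0 <= dot (cos (beta x) *: nW x) tau} ->
           forall rho, 0 < rho < Num.min rho0 (rhoS / 2) ->
            (eps0%:E * sG (eball x0 (rho / 2)) <=
               (C0 / rho)%:E * muV (eball x0 (2 * rho)) +
               \int[muV]_(x in eball x0 (2 * rho) `&` closure Omega)
                  (enorm (H x))%:E)%E)
      ]].
Proof.
exists (fun r => n.+1%:R * `|r|) => Omega dO.
have [g [N [W [[Cg g_gt0 g_eq0] [oW KW CN N_le1 [N_normal N_grad]]]]]] := exists_normal_field dO.
have [b b0 jac_le] := exists_jac_bound dO KW CN.
have [d d0 Kd] := exists_diameter dO.
pose CJ : R := n.+1%:R * (n.+1%:R * b).
have CJ0 : 0 <= CJ by rewrite !mulr_ge0.
(* In [c], the 16 is the cutoff gradient; CJ d absorbs CJ rho in the local estimate, as rho <= rho_S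
   <= d; the extra CJ serves the global one. In [C0] no diameter occurs, because there rho < rho0 <=
   1. *)
exists (CJ * (d + 1) + 16), (CJ + CJ + 16).
split; first by rewrite ltr_wpDl// mulr_ge0// addr_ge0// ltW.
split; first by rewrite ltr_wpDl// addr_ge0.
move=> m _ beta C1beta beta_pi V Gamma H cap.
have cbeta := frontier_continuous C1beta.
split; first exact: (bounded_variation dO cbeta beta_pi cap Cg g_gt0 g_eq0 oW KW CN N_le1 N_normal N_grad).
have [w [s [[mw wB] [sT sS] FV sle]]] :=
  capillary_decomposition dO cbeta cap Cg g_gt0 g_eq0 oW KW CN N_normal N_grad.
(* The sign is that of the statement, where the curvature term is subtracted. *)
exists (fun x => - w x *: N x), s; cbv zeta.
have cptK : compact (closure Omega).
  by case: dO => _ _ _ bO _; exact: closure_bounded_compact.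
have mS : measurable (frontier Omega : set (borel 'rV[R]_n.+1)).
  by apply: closed_borel; exact: frontier_closed.
have cN i : {within closure Omega, continuous (fun x => N x 0 i)}.
  by have [] := isC1_field_upV KW CN i.
have cnu := inner_normal_within KW CN N_normal.
have [[rV nullV] [rG nullG] _ _ _] := cap.
split.
- move=> i; rewrite (_ : (fun x => _) = fun x => - w x * N x 0 i); last by apply/funext => x; rewrite mxE.
  apply: measurable_funM; first by apply: measurableT_comp => //; exact: measurable_funTS.
  exact: within_measurable mS (within_frontier (cN i)).
- apply: aeW => x Sx v tv; rewrite dotZl N_normal// dotC.
  by move: tv; rewrite /tangent /= => ->; rewrite mulr0.
- apply: Lnorm_pinfty_le => [|x]; first by rewrite mulr_ge0.
  rewrite lee_fin normrM ger0_norm; last by rewrite indicE.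
  rewrite (ger0_norm (enorm_ge0 _)) indicE; have [/set_mem Sx|_] := boolP (x \in _).
    by rewrite mul1r enormZ N_normal// inner_normal_unit// mulr1 normrN.
  by rewrite mul0r mulr_ge0.
- split => // A cA; apply: le_lt_trans sT; rewrite le_measure ?inE//.
  by apply: closed_borel; apply: compact_closed => //; exact: norm_hausdorff.
move=> Gx dis; split.
- move=> phi Cphi; have pJ := C1_closure_upV Cphi.
  have [J' pJ'] := tangential_part_upV KW CN pJ.
  have e1 := boundary_term_tproj m Gamma dO cbeta beta_pi cnu Gx phi.
  have e2 := boundary_term_wetting m Gamma dO cbeta beta_pi cnu Gx phi.
  split; last by rewrite -e1.
  rewrite FV// -e1.
  rewrite (boundary_term dO cbeta beta_pi cnu rG nullG dis) => [|i]; last first.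
    by apply: within_frontier; have [] := pJ' i.
  have -> : \int[base_measure V]_(x in frontier Omega) dot (- w x *: N x) (phi x) =
      - \int[base_measure V]_(x in frontier Omega) (dot (phi x) (N x) * w x).
    rewrite -RintegralN//.
      by apply: eq_Rintegral => x _; rewrite dotZl mulNr (dotC (N x)) mulrC.
    have [c [cf _ _]] := up1_dot pJ (isC1_field_upV KW CN).
    have cfS := within_frontier cf.
    have cptS : compact (frontier Omega).
      by apply: (subclosed_compact _ cptK); [exact: frontier_closed|move=> x []].
    have [C _ fC] := within_bounded cptS cfS.
    have muS : (base_measure V (frontier Omega) < +oo)%E by exact: (base_finite cptK rV nullV).
    have iw : (base_measure V).-integrable (frontier Omega : set (borel 'rV[R]_n.+1)) (EFin \o w).
      by apply: (bounded_integrable mS muS) (fun x _ => wB x); exact: measurable_funTS.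
    exact: (integrable_mul mS iw (within_measurable mS cfS) fC).
  rewrite opprK; congr (_ - _ - _).
    by apply: eq_Rintegral => x; rewrite inE => Sx; rewrite N_normal// dotC.
  by apply: eq_Rintegral => x; rewrite inE => Sx; rewrite (tangential_partE N_normal).
- move=> rhoS tub x0 rho Sx0 /andP[rho0 rhoS_ge].
  apply: le_trans (normal_local dO cap KW CN N_le1 jac_le sle x0 rho0) _.
  apply: leeD2r; apply: lee_wpmul2r; first exact: measure_ge0.
  rewrite lee_fin ler_pdivlMr// mulrDl divfK ?gt_eqF// lerD2r ler_wpM2l//.
  by apply: le_trans rhoS_ge _; apply: le_trans (tubular_radius_le dO Kd Sx0 tub) _; rewrite lerDl.
- apply: le_trans (normal_global dO cap KW CN N_le1 jac_le sle) _.
  apply: leeD2r; apply: lee_wpmul2r; first exact: measure_ge0.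
  by rewrite lee_fin -/CJ; have := mulr_ge0 CJ0 (ltW d0); lra.
move=> rhoS [rhoS0 _] x0 _ _ eps /andP[eps0 eps1] _; split.
  (* trivial, as eps |cos beta| <= 1 and the smaller ball is contained in the larger one *)
  exists (rhoS / 4); split; first by lra.
  move=> rho /andP[rho0 _].
  have mB r : measurable (eball x0 r : set (borel 'rV[R]_n.+1)) by apply: closed_borel; exact: eball_closed.
  apply: (@le_trans _ _ (base_measure Gamma (eball x0 rho))).
    apply: (@le_trans _ _ (1%:E * base_measure Gamma (eball x0 (rho / 2)))%E).
      apply: lee_wpmul2r; first exact: measure_ge0.
      rewrite lee_fin -[leRHS]mulr1; apply: ler_pM => //; first exact: ltW.
      by rewrite ler_norml cos_geN1 cos_le1.
    rewrite mul1e le_measure ?inE//.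
    by apply: eball_sub; rewrite ler_pdivrMr// ler_pMr// ler1n.
  rewrite addeAC -[leLHS]add0e; apply: leeD2r; rewrite adde_ge0//.
    by apply: mule_ge0; rewrite ?measure_ge0// lee_fin divr_ge0 ?(ltW rho0)// !addr_ge0.
  by apply: integral_ge0 => x _; rewrite lee_fin enorm_ge0.
move=> tau e0 rho0 _ tau1 /andP[e00 _] /andP[_ rho01] lb rho /andP[r0]; rewrite lt_min => /andP[rrho0 _].
have rr : 0 < rho <= rho0 by rewrite r0 ltW.
apply: le_trans (tangential_estimate dO cbeta beta_pi cap KW CN N_le1 N_normal jac_le tau1 dis e00 rr lb) _.
have mB r : measurable (eball x0 r : set (borel 'rV[R]_n.+1)) by apply: closed_borel; exact: eball_closed.
have mK : measurable (closure Omega : set (borel 'rV[R]_n.+1)) by apply: closed_borel; exact: closed_closure.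
(* The estimate is obtained with radius [rho] on the right and then enlarged to [2 * rho]. *)
have sub : eball x0 rho `<=` eball x0 (2 * rho) by apply: eball_sub; rewrite ler_peMl ?ler1n// ltW.
apply: leeD.
  apply: lee_pmul; rewrite ?measure_ge0 ?lee_fin//.
  - by rewrite addr_ge0 ?divr_ge0 ?addr_ge0// ltW.
  - rewrite ler_pdivlMr// mulrDl divfK ?gt_eqF// lerD2r ler_piMr ?addr_ge0//.
    by apply: le_trans rho01; exact: ltW.
  - by rewrite le_measure ?inE.
apply: ge0_subset_integral.
- exact: measurableI.
- exact: measurableI.
- apply/measurable_EFinP; apply: (measurable_funS mK _ (measurable_enorm_H dO cap)).
  by move=> x [].
- by move=> x _; rewrite lee_fin enorm_ge0.
- by move=> x [/sub ? ?]; split.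
Qed.
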